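(* Let $X$ be a smooth connected complex variety, let $C\subseteq X_\infty$ be an irreducible cylinder which does not dominate $X$, and denote by $\mathrm{val}_C$ the corresponding valuation on $\mathbb{C}(X)$. Then there exist an ideal $\mathfrak{a}\subseteq\mathcal{O}_X$, an integer $p>0$ and an irreducible component $W$ of $\mathrm{Cont}^p(\mathfrak{a})$ such that $\mathrm{val}_C=\mathrm{val}_W$. Moreover $\mathrm{val}_C$ is a divisorial valuation up to a constant, i.e. it agrees up to a constant factor with the valuation given by the order of vanishing along a prime divisor in a suitable blow-up of $X$.
   Context: All points are $\mathbb{C}$-valued; $d=\dim X$. $X_m=\mathrm{Hom}(\mathrm{Spec}\,\mathbb{C}[t]/(t^{m+1}),X)$ is a smooth variety of dimension $d(m+1)$; $X_\infty=\varprojlim X_m=\mathrm{Hom}(\mathrm{Spec}\,\mathbb{C}[[t]],X)$ with the inverse limit of the Zariski topologies; $\psi_m:X_\infty\to X_m$ is truncation. A cylinder in $X_\infty$ is a set $\psi_m^{-1}(S)$ for some $m$ and some constructible $S\subseteq X_m$; it is irreducible iff $S$ is. A cylinder $C$ dominates $X=X_0$ if $\psi_0(C)$ is dense in $X$. For $\gamma\in X_\infty$ and an ideal sheaf $\mathfrak{a}$, the pull-back of $\mathfrak{a}$ by $\gamma$ is an ideal $(t^e)\subseteq\mathbb{C}[[t]]$ and $\mathrm{ord}_\gamma(\mathfrak{a})=e$ ($=\infty$ if the pull-back is zero); for a function $f$ defined near $\psi_0(\gamma)$, $\mathrm{ord}_\gamma(f)$ is the order of $\gamma^*f$ in $t$.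 $\mathrm{Cont}^p(\mathfrak{a})=\{\gamma\in X_\infty:\mathrm{ord}_\gamma(\mathfrak{a})=p\}$, a locally closed cylinder; its irreducible components are the inverse images under $\psi_m$ of those of the corresponding subset of $X_m$, for any $m\ge p$. For an irreducible cylinder $C$ not dominating $X$, $\mathrm{val}_C$ is the (non-trivial, discrete) valuation of the function field $\mathbb{C}(X)$ determined by $\mathrm{val}_C(f)=\mathrm{ord}_\gamma(f)$ for general $\gamma\in C$, for every rational function $f$ whose domain meets $\psi_0(C)$. *)

(* Defs.v *)
From HB Require Import structures.
From mathcomp Require Import all_boot all_order all_algebra.
From mathcomp Require Import complex.
From mathcomp Require Import -(notations) mpoly.
From mathcomp Require Import all_classical all_reals all_analysis.

Set Implicit Arguments.
Unset Strict Implicit.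
Unset Printing Implicit Defensive.

Import Order.TTheory GRing.Theory Num.Theory.
Local Open Scope classical_set_scope.
Local Open Scope ring_scope.

(* Integral separated schemes of finite type over an algebraically closed
   field k are presented as models in the sense of Zariski-Samuel (Commutative
   Algebra II, VI.17) and Chevalley (EGA I, 8.3): a function field K together
   with the set of the local rings of the closed points, as subrings of K.  A
   closed point is identified with its local ring O, its maximal ideal being
   the set of non-units of O.  The domain of a rational function f : K is the
   set of the points O with f \in O.  A smooth variety is integral if and only
   if it is nonempty and connected, so connectedness is built into this. *)

Section Subrings.
Variable S : comNzRingType.
Implicit Types A I P M : set S.

Definition ideal A I :=
  [/\ I `<=` A, I 0, forall f g, I f -> I g -> I (f + g)
    & forall a f, A a -> I f -> I (a * f)].

Definition ideal_gen A G := smallest (ideal A) G.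

Definition prime_ideal A P :=
  [/\ ideal A P, ~ P 1 & forall f g, A f -> A g -> P (f * g) -> P f \/ P g].

Definition maximal_ideal A M :=
  [/\ ideal A M, ~ M 1 & forall I, ideal A I -> ~ I 1 -> M `<=` I -> I = M].

Definition nonunits A := [set f | A f /\ ~ exists2 g, A g & f * g = 1].

Definition prime_chain A (n : nat) := exists p : nat -> set S,
  (forall i, (i <= n)%N -> prime_ideal A (p i)) /\
  (forall i, (i < n)%N -> p i `<` p i.+1).

Definition krull_dim A (n : nat) := prime_chain A n /\ ~ prime_chain A n.+1.

Definition regular_local A := exists n, krull_dim A n /\
  exists x : 'I_n -> S, nonunits A = ideal_gen A (range x).

End Subrings.

Section Subalgebras.
Variables (k : closedFieldType) (K : fieldType) (iota : {rmorphism k -> K}).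
Implicit Types A O L P : set K.

Definition subalgebra A :=
  [/\ forall c, A (iota c), forall f g, A f -> A g -> A (f + g)
    & forall f g, A f -> A g -> A (f * g)].

Definition alg_gen G := smallest subalgebra G.

Definition affine_alg A :=
  (exists s : seq K, A = alg_gen [set` s]) /\
  (forall f : K, exists a b, [/\ A a, A b, b != 0 & f = a / b]).

Definition localize A P :=
  [set f : K | exists a s, [/\ A a, A s, ~ P s & f = a / s]].

Definition closed_points A :=
  [set O | exists2 M, maximal_ideal A M & O = localize A M].

Definition local_subalgebra L := subalgebra L /\ ideal L (nonunits L).

Definition dominates L O := O `<=` L /\ nonunits O `<=` nonunits L.

(* The last clause is separatedness: two points whose local rings are dominated
   by a common local ring coincide. *)
Definition is_model (pts : set (set K)) :=
  (exists n (A : 'I_n.+1 -> set K),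
     (forall i, affine_alg (A i)) /\ pts = \bigcup_i closed_points (A i)) /\
  (forall O O' L, pts O -> pts O' -> local_subalgebra L ->
     dominates L O -> dominates L O' -> O = O').

Definition valuation (v : K -> \bar int) :=
  [/\ forall f, v f = +oo%E <-> f = 0,
      forall f, v f != -oo%E,
      forall f g, v (f * g) = (v f + v g)%E,
      forall f g, (Order.min (v f) (v g) <= v (f + g)%R)%E
    & forall c, c != 0 -> v (iota c) = 0%E].

(* pts is the set of closed points of a variety; prime divisors on it are
   identified with the local rings of their generic points. *)
Definition prime_divisor (pts : set (set K)) (D : set K) :=
  exists A P, [/\ affine_alg A, closed_points A `<=` pts, prime_ideal A P,
    D = localize A P & krull_dim D 1].

(* D is a discrete valuation ring and w is its normalized valuation. *)
Definition ord_along (D : set K) (w : K -> \bar int) :=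
  [/\ valuation w, exists f, w f = 1%:E & D = [set f | (0 <= w f)%E]].

End Subalgebras.

Record variety (k : closedFieldType) := Variety {
  funfield : fieldType;
  scal : {rmorphism k -> funfield};
  points : set (set funfield);
  pointsP : is_model scal points }.

Arguments scal {k} X : rename.
Arguments points {k} X : rename.

(* s : pseries R stands for the formal power series \sum_n (s n) t^n. *)
Definition pseries (R : comNzRingType) := nat -> R.

Section PowerSeries.
Variable R : comNzRingType.
Implicit Types s t u : pseries R.

HB.instance Definition _ := Choice.copy (pseries R) (nat -> R^o).
HB.instance Definition _ := GRing.Lmodule.copy (pseries R) (nat -> R^o).

Definition pseries_one : pseries R := fun n => (n == 0)%:R.
Definition pseries_mul s t : pseries R :=
  fun n => \sum_(i < n.+1) s i * t (n - i)%N.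

Definition trunc_poly (n : nat) s : {poly R} := \poly_(i < n) s i.

Lemma pseries_mulE n s t i : (i < n)%N ->
  pseries_mul s t i = (trunc_poly n s * trunc_poly n t)`_i.
Proof.
move=> lin; rewrite coefM; apply: eq_bigr => j _; rewrite !coef_poly.
by rewrite (leq_ltn_trans _ lin) ?leq_ord// (leq_ltn_trans _ lin) ?leq_subr.
Qed.

Fact pseries_mulC : commutative pseries_mul.
Proof.
by move=> s t; apply/funext => n; rewrite !(@pseries_mulE n.+1)// mulrC.
Qed.

Fact pseries_mulA : associative pseries_mul.
Proof.
have E n s t u : pseries_mul s (pseries_mul t u) n =
    (trunc_poly n.+1 s * (trunc_poly n.+1 t * trunc_poly n.+1 u))`_n.
  rewrite (@pseries_mulE n.+1)// !coefM; apply: eq_bigr => j _; congr (_ * _).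
  by rewrite coef_poly ltnS leq_subr (@pseries_mulE n.+1)// ltnS leq_subr.
move=> s t u; apply/funext => n.
by rewrite [in RHS]pseries_mulC !E mulrA mulrC.
Qed.

Fact pseries_mul1 : left_id pseries_one pseries_mul.
Proof.
move=> s; apply/funext => n.
rewrite /pseries_mul big_ord_recl /= /pseries_one eqxx mul1r subn0 big1 ?addr0//.
by move=> i _; rewrite mul0r.
Qed.

Fact pseries_mulD : left_distributive pseries_mul +%R.
Proof.
move=> s t u; apply/funext => n; rewrite /pseries_mul.
by under eq_bigr do rewrite mulrDl; rewrite big_split.
Qed.

Fact pseries_one_neq0 : pseries_one != 0.
Proof.
by apply/eqP => /(congr1 (fun s => s 0%N)); apply/eqP; rewrite oner_eq0.
Qed.

HB.instance Definition _ := GRing.Zmodule_isComNzRing.Build (pseries R)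
  pseries_mulA pseries_mulC pseries_mul1 pseries_mulD pseries_one_neq0.

Fact pseries_scaleAl (c : R) s t : c *: (s * t) = (c *: s) * t.
Proof.
apply/funext => n; rewrite [LHS]mulr_sumr; apply: eq_bigr => i _.
by rewrite mulrA.
Qed.

HB.instance Definition _ :=
  GRing.Lmodule_isLalgebra.Build R (pseries R) pseries_scaleAl.
HB.instance Definition _ :=
  GRing.Lalgebra_isComAlgebra.Build R (pseries R).

End PowerSeries.

Definition pseries_t (R : comNzRingType) : pseries R := fun n => (n == 1)%:R.

Definition ord_t (R : comNzRingType) (s : pseries R) : \bar int :=
  if pselect (exists n, s n != 0) is left h then (ex_minn h)%:Z%:E else +oo%E.

Section Truncation.
Variables (R : comNzRingType) (m : nat).

Definition trunc (s : pseries R) : {poly %/ 'X^(m.+1) : {poly R}} :=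
  in_qpoly 'X^(m.+1) (trunc_poly m.+1 s).

Fact truncD : {morph trunc : s t / s + t}.
Proof.
move=> s t; rewrite /trunc -in_qpolyD; congr in_qpoly; apply/polyP => i.
by rewrite coefD !coef_poly; case: ifP => // _; rewrite addr0.
Qed.

Fact truncM : {morph trunc : s t / s * t}.
Proof.
move=> s t; rewrite /trunc -in_qpolyM; apply: val_inj => /=.
rewrite mk_monic_Xn /= -!Pdiv.RingMonic.take_poly_rmodp.
apply/polyP => i; rewrite !coef_take_poly coef_poly; case: ifP => // im.
by rewrite im -(@pseries_mulE R m.+1 s t i).
Qed.

Fact truncC c : trunc c%:A = c%:A.
Proof.
rewrite /trunc -(in_qpoly1 ('X^(m.+1) : {poly R})) -in_qpolyZ; congr in_qpoly.
apply/polyP => i; rewrite coef_poly coefZ coef1.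
case: ltnP => // im; case: i im => // i _; by rewrite mulr0.
Qed.

Fact trunc0 : trunc 0 = 0.
Proof. by apply: (addrI (trunc 0)); rewrite -truncD !addr0. Qed.

End Truncation.

(* Hom(Spec S, X) over k, for a local k-algebra S with residue field k: a
   closed point O together with a homomorphism O -> S, which is automatically
   local since both residue fields are k.  It is extended by 0 outside of O. *)
Section SPoints.
Variables (k : closedFieldType) (X : variety k) (S : comAlgType k).

Definition is_pullback (O : set (funfield X)) (phi : funfield X -> S) :=
  [/\ forall c, phi (scal X c) = c%:A,
      forall f g, O f -> O g -> phi (f + g) = phi f + phi g,
      forall f g, O f -> O g -> phi (f * g) = phi f * phi g
    & forall f, ~ O f -> phi f = 0].

Record spoint := SPoint {
  center : set (funfield X);
  pull : funfield X -> S;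
  centerP : points X center;
  pullP : is_pullback center pull }.

HB.instance Definition _ := gen_eqMixin spoint.
HB.instance Definition _ := gen_choiceMixin spoint.

End SPoints.

Definition jets (k : closedFieldType) (X : variety k) (m : nat) :=
  spoint X {poly %/ 'X^(m.+1) : {poly k}}.

Definition arcs (k : closedFieldType) (X : variety k) := spoint X (pseries k).

(* The Zariski topology: on the m-jets centred at an affine open subset U, the
   coordinates are the coefficients of t^0, ..., t^m of the pull-backs of the
   regular functions on U. *)
Section JetTopology.
Variables (k : closedFieldType) (X : variety k) (m : nat).

Definition basic_open (n : nat) (P : mpoly.mpoly n k)
    (f : 'I_n -> funfield X) (i : 'I_n -> nat) : set (jets X m) :=
  [set g : jets X m | (forall j, center g (f j)) /\
    mpoly.meval (fun j => (pull g (f j))`_(i j)) P != 0].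

Definition basic_opens : set (set (jets X m)) :=
  [set U | exists n (P : mpoly.mpoly n k) f i, U = basic_open P f i].

HB.instance Definition _ := Choice.on (jets X m).
HB.instance Definition _ :=
  @isSubBaseTopological.Build (jets X m) (set (jets X m)) basic_opens id.

End JetTopology.

Section Arcs.
Variables (k : closedFieldType) (X : variety k).
Local Notation K := (funfield X).

Fact trunc_pullP m (g : arcs X) :
  is_pullback (center g) (trunc m \o pull g).
Proof.
have [gC gD gM g0] := pullP g; split => [c|f h Of Oh|f h Of Oh|f Of] /=.
- by rewrite gC truncC.
- by rewrite gD// truncD.
- by rewrite gM// truncM.
- by rewrite g0// trunc0.
Qed.

Definition psi (m : nat) (g : arcs X) : jets X m :=
  SPoint (centerP g) (trunc_pullP m g).

(* The inverse limit of the Zariski topologies. *)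
HB.instance Definition _ := Choice.on (arcs X).
HB.instance Definition _ :=
  @isSubBaseTopological.Build (arcs X) (set (arcs X))
    [set V | exists m, exists2 U : set (jets X m), open U & V = psi m @^-1` U]
    id.

Definition constructible (T : topologicalType) (A : set T) :=
  exists n (U F : nat -> set T), [/\ forall i, open (U i),
    forall i, closed (F i) & A = \bigcup_(i < n) (U i `&` F i)].

Definition irreducible_set (T : topologicalType) (A : set T) :=
  A !=set0 /\ forall U V, open U -> open V ->
    A `&` U !=set0 -> A `&` V !=set0 -> A `&` (U `&` V) !=set0.

Definition irreducible_component (T : topologicalType) (A W : set T) :=
  [/\ irreducible_set W, W `<=` A
    & forall Z, irreducible_set Z -> Z `<=` A -> W `<=` Z -> Z = W].

Definition cylinder (C : set (arcs X)) :=
  exists m, exists2 A : set (jets X m), constructible A & C = psi m @^-1` A.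

Definition dominating (C : set (arcs X)) := dense (psi 0 @` C).

Definition affine_open (A : set K) :=
  affine_alg (scal X) A /\ closed_points A `<=` points X.

(* A coherent ideal sheaf is given by its stalks. *)
Definition sheaf_on (a : set K -> set K) (A I : set K) :=
  ideal A I /\ forall O, closed_points A O -> a O = ideal_gen O I.

Definition ideal_sheaf (a : set K -> set K) := forall O, points X O ->
  exists A I, [/\ affine_open A, closed_points A O & sheaf_on a A I].

Definition contact (p : nat) (a : set K -> set K) : set (arcs X) :=
  [set g | ideal_gen setT (pull g @` a (center g)) =
           ideal_gen setT [set pseries_t k ^+ p]].

(* "General" means on a nonempty relatively open subset of C. *)
Definition is_val_of (C : set (arcs X)) (v : K -> \bar int) :=
  valuation (scal X) v /\
  forall f, (exists2 x, (psi 0 @` C) x & center x f) ->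
    exists U, [/\ open U, C `&` U !=set0 & forall g, (C `&` U) g ->
      center g f /\ ord_t (pull g f) = v f].

(* For C irreducible there is at most one such valuation.  The default value
   cst 0 is not a valuation, since it does not send 0 to +oo. *)
Definition arc_val (C : set (arcs X)) : K -> \bar int :=
  xget (cst 0%E) (is_val_of C).

(* Closed points of the blow-up of X along a: over an affine open subset with
   coordinate ring A, on which a is given by I, the blow-up is covered by the
   spectra of the rings A[I/g] for g nonzero in I. *)
Definition blowup (a : set K -> set K) : set (set K) :=
  [set O | exists A I g, [/\ affine_open A, sheaf_on a A I, I g, g != 0 &
    closed_points (alg_gen (scal X) (A `|` [set h / g | h in I])) O]].

(* As v is integer-valued and w is onto, a constant factor relating the two is
   necessarily an integer. *)
Definition divisorial_up_to_constant (v : K -> \bar int) :=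
  exists b D w (c : nat), [/\ ideal_sheaf b,
    prime_divisor (scal X) (blowup b) D, ord_along (scal X) D w, (0 < c)%N
    & forall f, v f = (c%:Z%:E * w f)%E].

(* Regularity is the same as smoothness over an algebraically closed field. *)
Definition smooth := forall O, points X O -> regular_local O.

End Arcs.

(* Main.v *)
Require Import Defs.
From HB Require Import structures.
From mathcomp Require Import all_boot all_order all_algebra.
From mathcomp Require Import complex.
From mathcomp Require Import all_classical all_reals all_analysis.
From mathcomp Require Import perm finmap zify ring.
Import Defs.

Set Implicit Arguments.
Unset Strict Implicit.
Unset Printing Implicit Defensive.

Import Order.TTheory GRing.Theory Num.Theory.
Local Open Scope classical_set_scope.
Local Open Scope ring_scope.

(* Let v = val_C.  Replacing an arc g of C by exp(c t^(m+1) d)^* g, for a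
   derivation d, stays in C = psi_m^-1(S), so v (d f) >= v f - (m+1) for the
   derivations d dual to regular parameters.  In characteristic zero such a bound
   forces v to be divisorial: if f_1, ..., f_r lift a transcendence basis of the
   residue field and u is a uniformizer, a derivation killing them would lower
   the values of the integral elements without bound, so K is finite over
   k(f_1, ..., f_r, u), and the trace form shows that the valuation ring D is a
   localization of a finitely generated algebra.  Writing its generators as
   fractions h / g, the ideal a of functions of value at least q = v(g) has D as a
   local ring of its blow-up.  Finally, let W be an irreducible component of
   Cont^q(a) containing the general arcs of C: along W the elements of a vanish to
   order at least q by definition and g to order q by semicontinuity, and this
   determines the orders of all units of D, hence val_W = v. *)

(** * Derivations of function fields *)

(** An integer-valued valuation of the function field need not be divisorial. On the plane, the
    order along the arc (t, e^t - 1) gives value N+1 to f_N = y - sum_(1 <= j <= N) x^j/j!, whereas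
    the derivative of f_N with respect to y is 1, of value 0. The bound v (d f) >= v f - (m+1) rules
    out exactly this behaviour: no approximation can improve without end while its derivative stays
    a unit. It must also be shown that v is finite on nonzero functions, since a fat enough set of
    arcs could a priori lie over a proper subvariety. The same bound settles this: the functions of
    infinite generic order form a proper ideal of a regular local ring that is stable under the
    derivations dual to the parameters, and in characteristic zero such an ideal is zero. The value
    group of v is cZ for some c > 0. The residue field and finiteness arguments are run on w = v/c,
    which has the same valuation ring and a uniformizer, while the ideal and the contact order q are
    measured by v, because orders of arcs are values of v. *)

Definition coefs_in (K : nzRingType) (A : set K) (p : {poly K}) :=
  forall i, A p`_i.

Definition algebraic_over (K : nzRingType) (A : set K) (z : K) :=
  exists p : {poly K}, [/\ p != 0, coefs_in A p & p.[z] = 0].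

Section Subalgebras.
Variables (k : closedFieldType) (K : fieldType) (iota : {rmorphism k -> K}).
Implicit Types (A B G I : set K) (f g : K) (s : seq K) (p q : {poly K}).
Local Notation subalg := (subalgebra iota).
Local Notation gen := (alg_gen iota).

Lemma subalg0 A : subalg A -> A 0.
Proof. by case=> /(_ 0); rewrite rmorph0. Qed.

Lemma subalg1 A : subalg A -> A 1.
Proof. by case=> /(_ 1); rewrite rmorph1. Qed.

Lemma subalgD A f g : subalg A -> A f -> A g -> A (f + g).
Proof. by case=> _ + _; apply. Qed.

Lemma subalgM A f g : subalg A -> A f -> A g -> A (f * g).
Proof. by case=> _ _; apply. Qed.

Lemma subalgN A f : subalg A -> A f -> A (- f).
Proof.
move=> sA Af; rewrite -mulN1r -(rmorph1 iota) -rmorphN.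
by apply: subalgM => //; case: sA => + _ _; apply.
Qed.

Lemma subalgB A f g : subalg A -> A f -> A g -> A (f - g).
Proof. by move=> sA Af Ag; apply: subalgD => //; apply: subalgN. Qed.

Lemma subalgX A f n : subalg A -> A f -> A (f ^+ n).
Proof.
move=> sA Af; elim: n => [|n IHn]; first by rewrite expr0; apply: subalg1.
by rewrite exprS; apply: subalgM.
Qed.

Lemma subalg_sum A (T : Type) (r : seq T) (P : pred T) (F : T -> K) :
  subalg A -> (forall i, P i -> A (F i)) -> A (\sum_(i <- r | P i) F i).
Proof.
move=> sA AF; elim/big_ind: _ => //; first exact: subalg0.
by move=> f g; apply: subalgD.
Qed.

Lemma subalg_prod A (T : Type) (r : seq T) (P : pred T) (F : T -> K) :
  subalg A -> (forall i, P i -> A (F i)) -> A (\prod_(i <- r | P i) F i).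
Proof.
move=> sA AF; elim/big_ind: _ => //; first exact: subalg1.
by move=> f g; apply: subalgM.
Qed.

Lemma subalg_nat A n : subalg A -> A n%:R.
Proof.
by move=> sA; elim: n => [|n IHn];
  [exact: subalg0 | rewrite -natr1; apply: subalgD => //; apply: subalg1].
Qed.

Lemma coefs_in0 A : subalg A -> coefs_in A 0.
Proof. by move=> sA i; rewrite coef0; apply: subalg0. Qed.

Lemma coefs_inC A f : subalg A -> A f -> coefs_in A f%:P.
Proof. by move=> sA Af i; rewrite coefC; case: eqP => // _; apply: subalg0. Qed.

Lemma coefs_inX A : subalg A -> coefs_in A 'X.
Proof. by move=> sA i; rewrite coefX; apply: subalg_nat. Qed.

Lemma coefs_inD A p q : subalg A ->
  coefs_in A p -> coefs_in A q -> coefs_in A (p + q).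
Proof. by move=> sA Ap Aq i; rewrite coefD; apply: subalgD. Qed.

Lemma coefs_inN A p : subalg A -> coefs_in A p -> coefs_in A (- p).
Proof. by move=> sA Ap i; rewrite coefN; apply: subalgN. Qed.

Lemma coefs_inM A p q : subalg A ->
  coefs_in A p -> coefs_in A q -> coefs_in A (p * q).
Proof.
move=> sA Ap Aq i; rewrite coefM; apply: subalg_sum => // j _.
exact: subalgM.
Qed.

Lemma coefs_in_deriv A p : subalg A -> coefs_in A p -> coefs_in A p^`().
Proof.
move=> sA Ap i; rewrite coef_deriv -mulr_natr; apply: subalgM => //.
exact: subalg_nat.
Qed.

Lemma coefs_in_horner A p f : subalg A -> coefs_in A p -> A f -> A p.[f].
Proof.
move=> sA Ap Af; rewrite horner_coef; apply: subalg_sum => // i _.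
by apply: subalgM => //; apply: subalgX.
Qed.

Lemma alg_gen_subalg G : subalg (gen G).
Proof.
split => [c A [sA _]|f g Gf Gg A AG|f g Gf Gg A AG].
- by case: sA.
- by case: (AG) => sA _; apply: subalgD => //; [apply: Gf|apply: Gg].
- by case: (AG) => sA _; apply: subalgM => //; [apply: Gf|apply: Gg].
Qed.
Hint Resolve alg_gen_subalg : core.

Lemma alg_gen_min G A : subalg A -> G `<=` A -> gen G `<=` A.
Proof. by move=> sA GA f; apply. Qed.

Lemma alg_gen_in G f : G f -> gen G f.
Proof. by move=> Gf A [_]; apply. Qed.

Lemma alg_gen_sub G G' : G `<=` G' -> gen G `<=` gen G'.
Proof. by move=> GG'; apply: alg_gen_min => // f /GG'; apply: alg_gen_in. Qed.

Lemma subalg_horners A x : subalg A ->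
  subalg [set f | exists2 p, coefs_in A p & f = p.[x]].
Proof.
move=> sA; split=> [c|_ _ [p Ap ->] [q Aq ->]|_ _ [p Ap ->] [q Aq ->]].
- by exists (iota c)%:P; [apply: coefs_inC => //; case: sA|rewrite hornerC].
- by exists (p + q); [apply: coefs_inD|rewrite hornerD].
- by exists (p * q); [apply: coefs_inM|rewrite hornerM].
Qed.

(** Turns inductions on a list of generators into arguments on polynomials in one variable over the
    algebra of the remaining ones. *)
Lemma alg_gen_cons x s f :
  gen [set` x :: s] f <-> exists2 p, coefs_in (gen [set` s]) p & f = p.[x].
Proof.
split=> [|[p sp ->]].
  move: f; apply: (alg_gen_min (subalg_horners x (alg_gen_subalg _))).
  move=> f /=; rewrite inE => /orP[/eqP ->|sf].
    by exists 'X; [apply: coefs_inX|rewrite hornerX].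
  by exists f%:P; [apply: coefs_inC => //; apply: alg_gen_in|rewrite hornerC].
apply: (coefs_in_horner (alg_gen_subalg _)); last by apply: alg_gen_in => /=; rewrite mem_head.
move=> i; apply: alg_gen_sub (sp i) => g /=; rewrite inE => ->.
exact: orbT.
Qed.

Lemma alg_gen_cons_head x s : gen [set` x :: s] x.
Proof. by apply: alg_gen_in => /=; rewrite mem_head. Qed.

Lemma alg_gen_cons_tail x s : gen [set` s] `<=` gen [set` x :: s].
Proof. by apply: alg_gen_sub => f /=; rewrite inE orbC => ->. Qed.

Lemma alg_gen_nil f : gen [set` ([::] : seq K)] f -> exists c, f = iota c.
Proof.
move: f; apply: alg_gen_min => //; split=> [c|_ _ [c ->] [d ->]|_ _ [c ->] [d ->]].
- by exists c.
- by exists (c + d); rewrite rmorphD.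
- by exists (c * d); rewrite rmorphM.
Qed.

End Subalgebras.
#[global] Hint Resolve alg_gen_subalg : core.

Section Derivations.
Variables (k : closedFieldType) (K : fieldType) (iota : {rmorphism k -> K}).
Hypothesis char0 : [pchar K] =i pred0.
Implicit Types (A B : set K) (f g : K) (p q : {poly K}) (d : K -> K).
Local Notation subalg := (subalgebra iota).
Local Notation gen := (alg_gen iota).

Lemma char0_natr_neq0 n : (n.+1%:R : K) != 0.
Proof. by rewrite ((pcharf0P K).1 char0). Qed.

Lemma size_deriv_lt p : p != 0 -> (size p^`() < size p)%N.
Proof. exact: lt_size_deriv. Qed.

Lemma deriv_eq0 p : p^`() = 0 -> (size p <= 1)%N.
Proof.
move=> p'0; apply/leq_sizeP => -[|j] // _.
move/polyP/(_ j): p'0; rewrite coef_deriv coef0 -mulr_natr => /eqP.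
by rewrite mulf_eq0 (negPf (char0_natr_neq0 j)) orbF => /eqP.
Qed.

Definition derivation d := [/\ forall c, d (iota c) = 0,
  forall f g, d (f + g) = d f + d g & forall f g, d (f * g) = f * d g + g * d f].

Lemma der0 d : derivation d -> d 0 = 0.
Proof. by case=> + _ _ => /(_ 0); rewrite rmorph0. Qed.

Lemma der1 d : derivation d -> d 1 = 0.
Proof. by case=> + _ _ => /(_ 1); rewrite rmorph1. Qed.

Lemma derD d f g : derivation d -> d (f + g) = d f + d g.
Proof. by case. Qed.

Lemma derM d f g : derivation d -> d (f * g) = f * d g + g * d f.
Proof. by case. Qed.

Lemma derN d f : derivation d -> d (- f) = - d f.
Proof.
by move=> dd; apply/eqP; rewrite -addr_eq0 -(derD _ _ dd) addNr der0.
Qed.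

Lemma derB d f g : derivation d -> d (f - g) = d f - d g.
Proof. by move=> dd; rewrite derD// derN. Qed.

Lemma der_sum d (T : Type) (r : seq T) (P : pred T) (F : T -> K) :
  derivation d -> d (\sum_(i <- r | P i) F i) = \sum_(i <- r | P i) d (F i).
Proof.
move=> dd; elim/big_rec2: _ => [|i f g _ <-]; first exact: der0.
exact: derD.
Qed.

Lemma der_div d f g : derivation d -> g != 0 ->
  d (f / g) = (g * d f - f * d g) / g ^+ 2.
Proof.
move=> dd g0; have := derM (f / g) g dd; rewrite divfK// => E.
by rewrite E; field.
Qed.

Lemma derXn d f n : derivation d -> d (f ^+ n) = f ^+ n.-1 *+ n * d f.
Proof.
move=> dd; elim: n => [|[|n] IHn]; first by rewrite expr0 der1// mul0r.
  by rewrite expr1 expr0 mul1r.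
by rewrite exprS derM// IHn /= -mulr_natr -[in RHS]mulr_natr exprS; ring.
Qed.

Lemma der_horner d p f : derivation d ->
  d p.[f] = (map_poly d p).[f] + p^`().[f] * d f.
Proof.
move=> dd; rewrite horner_coef der_sum//.
rewrite [in (map_poly d p).[f]](@horner_coef_wide _ (size p)); last exact: size_poly.
have -> : p^`().[f] = \sum_(i < size p) p`_i * (f ^+ i.-1 *+ i).
  rewrite (@horner_coef_wide _ (size p)); last first.
    by have [->|/size_deriv_lt/ltnW//] := eqVneq p 0; rewrite derivC.
  case sp: (size p) => [|n]; first by rewrite !big_ord0.
  rewrite big_ord_recr big_ord_recl /= mulr0n mulr0 add0r.
  have -> : p^`()`_n = 0 by rewrite coef_deriv nth_default ?mul0rn// sp.
  rewrite mul0r addr0.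
  by apply: eq_bigr => i _; rewrite coef_deriv /bump /= add1n add0n mulrnAl mulrnAr.
rewrite mulr_suml -big_split; apply: eq_bigr => i _ /=.
by rewrite derM// derXn// coef_map_id0 ?der0//; ring.
Qed.

Lemma der_horner_const d A p f : derivation d -> (forall a, A a -> d a = 0) ->
  coefs_in A p -> d p.[f] = p^`().[f] * d f.
Proof.
move=> dd dA Ap; rewrite der_horner//.
suff -> : map_poly d p = 0 by rewrite horner0 add0r.
by apply/polyP => i; rewrite coef_map_id0 ?der0// dA// coef0.
Qed.

Lemma der_alg_gen d G f : derivation d -> (forall g, G g -> d g = 0) ->
  gen G f -> d f = 0.
Proof.
move=> dd dG; move: f; apply: alg_gen_min => //.
split=> [c|f g /= df dg|f g /= df dg]; first by case: dd.
- by rewrite derD// df dg addr0.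
- by rewrite derM// df dg !mulr0 addr0.
Qed.

Lemma der_lincomb (I : finType) (c : I -> K) (D : I -> K -> K) :
  (forall i, derivation (D i)) -> derivation (fun f => \sum_i c i * D i f).
Proof.
move=> dD; split=> [a|f g|f g].
- by apply: big1 => i _; have [-> _ _] := dD i; rewrite mulr0.
- by rewrite -big_split; apply: eq_bigr => i _; rewrite derD// mulrDr.
- rewrite !mulr_sumr -big_split; apply: eq_bigr => i _; rewrite derM//=; ring.
Qed.

End Derivations.

Lemma size_sub_lt (R : nzRingType) (p q : {poly R}) : p != 0 ->
  (size q <= size p)%N -> q`_(size p).-1 = lead_coef p ->
  (size (p - q)%R < size p)%N.
Proof.
move=> p0 sq lq; rewrite -[X in (_ < X)%N]prednK ?size_poly_gt0// ltnS.
apply/leq_sizeP => j; rewrite leq_eqVlt coefB => /orP[/eqP <-|lj].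
  by rewrite lq subrr.
have sj : (size p <= j)%N by rewrite -[size p]prednK ?size_poly_gt0.
by rewrite !nth_default ?subrr// (leq_trans sq).
Qed.

Lemma size_sub_lead (R : nzRingType) (p q : {poly R}) : p != 0 ->
  size q = size p -> lead_coef q = lead_coef p -> (size (p - q)%R < size p)%N.
Proof.
by move=> p0 sq lq; apply: size_sub_lt; rewrite ?sq// -lq lead_coefE sq.
Qed.

Section DerivationExtension.
Variables (k : closedFieldType) (K : fieldType) (iota : {rmorphism k -> K}).
Hypothesis char0 : [pchar K] =i pred0.
Implicit Types (f g z w : K) (p q : {poly K}) (G : set (K * K)).

(* A partial derivation is encoded by its graph {(f, f')}, viewed as a subring
   of the dual numbers K[eps] meeting K eps trivially. *)
Definition der_graph G := [/\ forall c, G (iota c, 0),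
  forall f f' g g', G (f, f') -> G (g, g') -> G (f + g, f' + g'),
  forall f f' g g', G (f, f') -> G (g, g') -> G (f * g, f * g' + g * f')
  & forall f', G (0, f') -> f' = 0].

Section Graph.
Variable G : set (K * K).
Hypothesis GG : der_graph G.

Let GC c : G (iota c, 0). Proof. by case: GG. Qed.
Let GD f f' g g' : G (f, f') -> G (g, g') -> G (f + g, f' + g').
Proof. by case: GG => _ + _ _; apply. Qed.
Let GM f f' g g' : G (f, f') -> G (g, g') -> G (f * g, f * g' + g * f').
Proof. by case: GG => _ _ + _; apply. Qed.
Let G0 : G (0, 0). Proof. by rewrite -{1}(rmorph0 iota). Qed.

Lemma der_graphN f f' : G (f, f') -> G (- f, - f').
Proof.
move=> Gf; have := GM (GC (- 1)) Gf.
by rewrite rmorphN rmorph1 !mulN1r mulr0 addr0.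
Qed.

Lemma der_graph_fun f f' f'' : G (f, f') -> G (f, f'') -> f' = f''.
Proof.
move=> Gf' /der_graphN Gf''; have := GD Gf' Gf''; rewrite subrr => G0'.
by apply/eqP; rewrite -subr_eq0; apply/eqP; case: GG => _ _ _; apply.
Qed.

Definition graph_coefs p p' := forall i, G (p`_i, p'`_i).

Lemma graph_coefsD p p' q q' :
  graph_coefs p p' -> graph_coefs q q' -> graph_coefs (p + q) (p' + q').
Proof. by move=> Gp Gq i; rewrite !coefD; apply: GD. Qed.

Lemma graph_coefsN p p' : graph_coefs p p' -> graph_coefs (- p) (- p').
Proof. by move=> Gp i; rewrite !coefN; apply: der_graphN. Qed.

Lemma graph_coefsM p p' q q' : graph_coefs p p' -> graph_coefs q q' ->
  graph_coefs (p * q) (p * q' + q * p').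
Proof.
move=> Gp Gq i; rewrite coefD coefM [q * p']mulrC !coefM -big_split /=.
elim/big_rec2: _ => [|j f f' _ Gf] //; apply: GD => //.
rewrite [p'`_j * _]mulrC; exact: GM.
Qed.

Lemma graph_coefsC f f' : G (f, f') -> graph_coefs f%:P f'%:P.
Proof. by move=> Gf i; rewrite !coefC; case: eqP. Qed.

Lemma graph_coefsXn n : graph_coefs 'X^n 0.
Proof.
move=> i; rewrite coefXn coef0; case: eqP => // _.
by have := GC 1; rewrite rmorph1.
Qed.

Lemma graph_coefs_deriv p p' : graph_coefs p p' -> graph_coefs p^`() p'^`().
Proof.
move=> Gp i; rewrite !coef_deriv; elim: {2 4}i.+1 => [|n IHn].
  by rewrite !mulr0n.
by rewrite !mulrSr; apply: GD.
Qed.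

(** The pair is the value of p + eps p' at z + eps w in the dual numbers; the hypothesis on [w] is
    what keeps the enlarged subring from meeting K eps. *)
Lemma der_graph_adjoin z w :
  (forall p p', graph_coefs p p' -> p.[z] = 0 ->
     p'.[z] + p^`().[z] * w = 0) ->
  der_graph [set u | exists p p', graph_coefs p p' /\
     u = (p.[z], p'.[z] + p^`().[z] * w)].
Proof.
move=> zw; split=> [c|f f' g g'|f f' g g'|f'].
- exists (iota c)%:P, 0%:P; split; first exact: graph_coefsC.
  by rewrite !hornerC derivC horner0 mul0r addr0.
- move=> [p [p' [Gp [-> ->]]]] [q [q' [Gq [-> ->]]]].
  exists (p + q), (p' + q'); split; first exact: graph_coefsD.
  by rewrite derivD !hornerD; congr pair; ring.
- move=> [p [p' [Gp [-> ->]]]] [q [q' [Gq [-> ->]]]].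
  exists (p * q), (p * q' + q * p'); split; first exact: graph_coefsM.
  by rewrite derivM !(hornerD, hornerM); congr pair; ring.
- by move=> [p [p' [Gp [/esym p0 ->]]]]; apply: zw.
Qed.

Lemma der_graph_frac : der_graph [set u | exists f f' g g',
  [/\ G (f, f'), G (g, g'), g != 0 & u = (f / g, (g * f' - f * g') / g ^+ 2)]].
Proof.
split=> [c|_ _ _ _ [f [f' [g [g' [Gf Gg g0 [-> ->]]]]]]
  [h [h' [e [e' [Gh Ge e0 [-> ->]]]]]]|_ _ _ _
  [f [f' [g [g' [Gf Gg g0 [-> ->]]]]]] [h [h' [e [e' [Gh Ge e0 [-> ->]]]]]]|
  h' [f [f' [g [g' [Gf Gg g0 [/esym f0 ->]]]]]]].
- exists (iota c), 0, (iota 1), 0; split => //; first by rewrite rmorph1 oner_eq0.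
  by rewrite rmorph1 divr1 !mulr0 subrr mul0r.
- exists (f * e + h * g), ((f * e' + e * f') + (h * g' + g * h')), (g * e),
    (g * e' + e * g'); split; [exact: GD (GM _ _) (GM _ _)|exact: GM| |].
    by rewrite mulf_neq0.
  by congr pair; field; rewrite g0 e0.
- exists (f * h), (f * h' + h * f'), (g * e), (g * e' + e * g').
  split; [exact: GM|exact: GM|by rewrite mulf_neq0|].
  by congr pair; field; rewrite g0 e0.
- move: f0 => /eqP; rewrite mulf_eq0 invr_eq0 (negPf g0) orbF => /eqP f0.
  move: Gf; rewrite f0 => Gf; have -> : f' = 0 by case: GG => _ _ _; apply.
  by rewrite mulr0 mul0r subrr mul0r.
Qed.

End Graph.

Lemma der_graph_maximal G : der_graph G -> exists G', [/\ der_graph G', G `<=` G'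
  & forall H, der_graph H -> G' `<=` H -> H `<=` G'].
Proof.
(* Zorn's lemma is applied to the sets [S] to be added to [G], not to the graphs above [G], so that
   the union of the empty chain, [set0], also satisfies [P]. *)
move=> GG; pose P S := der_graph (G `|` S).
have [F FP Ftot|A [PA Amax]] := @Zorn_bigcup _ P.
  pose U := G `|` \bigcup_(S in F) S.
  have chain u v : U u -> U v -> exists2 S, P S &
      S `<=` \bigcup_(S in F) S /\ ((G `|` S) u /\ (G `|` S) v).
    have P0 : P set0 by rewrite /P setU0.
    move=> [Gu|[S FS Su]] [Gv|[T FT Tv]].
    - by exists set0 => //; split; [exact: sub0set|split; left].
    - by exists T; [exact: FP|split; [exact: bigcup_sup|split; [left|right]]].
    - by exists S; [exact: FP|split; [exact: bigcup_sup|split; [right|left]]].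
    - have [ST|TS] := Ftot _ _ FS FT.
        exists T; [exact: FP|split; [exact: bigcup_sup|]].
        by split; right => //; apply: ST.
      exists S; [exact: FP|split; [exact: bigcup_sup|]].
      by split; right => //; apply: TS.
  have sU S : S `<=` \bigcup_(S in F) S -> G `|` S `<=` U.
    by move=> SF; apply: setUS.
  split=> [c|f f' g g' Uf Ug|f f' g g' Uf Ug|f' Uf].
  - by left; case: GG.
  - have [S [_ SD _ _] [SF [Sf Sg]]] := chain _ _ Uf Ug.
    by apply: (sU S) => //; apply: SD.
  - have [S [_ _ SM _] [SF [Sf Sg]]] := chain _ _ Uf Ug.
    by apply: (sU S) => //; apply: SM.
  - by have [S [_ _ _ S0] [SF [Sf Sg]]] := chain _ _ Uf Uf; apply: S0.
exists (G `|` A); split=> // H HH GAH.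
have [GH AH] : G `<=` H /\ A `<=` H by split=> u ?; apply: GAH; [left|right].
have [HA|nHA] := pselect (H `<=` A); first by apply: subset_trans HA _; right.
by case: (Amax H); [split|rewrite /P; have /setUidPr -> := GH].
Qed.

(** By the quotient rule the domain of a maximal graph is a field. Over it a transcendental [z] may
    be sent to 0, while for an algebraic [z] with equation p of least degree the value
    -p'(z)/p^[(z) is forced, p^](z) being nonzero in characteristic zero. *)
Lemma der_graph_total G :
  der_graph G -> (forall H, der_graph H -> G `<=` H -> H `<=` G) ->
  forall z, exists w, G (z, w).
Proof.
move=> GG Gmax z; have [_ GD GM G0] := GG.
have Gdiv f f' g g' : G (f, f') -> G (g, g') -> g != 0 ->
    G (f / g, (g * f' - f * g') / g ^+ 2).
  move=> Gf Gg g0; apply: (Gmax _ (der_graph_frac GG)); last first.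
    by exists f, f', g, g'.
  move=> [h h'] Gh; exists h, h', 1, 0; split=> //.
  - by have [+ _ _ _] := GG => /(_ 1); rewrite rmorph1.
  - exact: oner_neq0.
  - by rewrite divr1 mulr0 subr0 mul1r expr1n divr1.
suff [w zw] : exists w, forall p p', graph_coefs G p p' -> p.[z] = 0 ->
     p'.[z] + p^`().[z] * w = 0.
  exists w; apply: (Gmax _ (der_graph_adjoin GG zw)) => [[f f'] Gf|].
    exists f%:P, f'%:P; split; first exact: graph_coefsC.
    by rewrite derivC !hornerC mul0r addr0.
  exists 'X, 0; split; first exact: (graph_coefsXn GG 1).
  by rewrite derivX !hornerE.
have [[p0 [p0n0 [p0' Gp0] p0z]]|trans] := pselect (exists p,
    [/\ p != 0, exists p', graph_coefs G p p' & p.[z] = 0]); last first.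
  exists 0 => p p' Gp pz; have p0 : p = 0.
    by apply/eqP/negPn/negP => p0; apply: trans; exists p; split=> //; exists p'.
  have -> : p' = 0.
    by apply/polyP => i; rewrite coef0; apply: G0; have := Gp i; rewrite p0 coef0.
  by rewrite mulr0 horner0 addr0.
pose root_size n := `[< exists p p', [/\ p != 0, graph_coefs G p p', p.[z] = 0
  & size p = n] >].
have ex : exists n, root_size n by exists (size p0); apply/asboolP; exists p0, p0'.
case: (ex_minnP ex) => n /asboolP[p [p' [pn0 Gp pz sp]]] pmin.
have sp1 : (1 < size p)%N.
  rewrite ltnNge; apply/negP => /size1_polyC pC; move: pn0 pz.
  by rewrite pC hornerC polyC_eq0 => /eqP.
have dp0 : p^`().[z] != 0.
  apply/eqP => dpz; have := size_deriv_lt pn0; rewrite ltnNge sp; apply/negP/negPn.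
  apply: pmin; apply/asboolP; exists p^`(), p'^`(); split=> //; last first.
    exact: graph_coefs_deriv.
  by apply/eqP => /(deriv_eq0 char0); rewrite leqNgt sp1.
exists (- p'.[z] / p^`().[z]); set w := _ / _.
have pw : p'.[z] + p^`().[z] * w = 0 by rewrite mulrC divfK// subrr.
(* Division by p: subtracting the multiple r p with the leading term of q lowers the size, and the
   condition for q - r p gives that for q, because p(z) = 0 and [pw] holds. *)
move=> q; have [m] := ubnP (size q); elim: m q => // m IHm q sqm q' Gq qz.
have [q0|q0] := eqVneq q 0.
  have -> : q' = 0.
    by apply/polyP => i; rewrite coef0; apply: G0; have := Gq i; rewrite q0 coef0.
  by rewrite q0 derivC !horner0 mul0r addr0.
have spq : (size p <= size q)%N.
  by rewrite sp; apply: pmin; apply/asboolP; exists q, q'.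
have lp0 : lead_coef p != 0 by rewrite lead_coef_eq0.
have := Gdiv _ _ _ _ (Gq (size q).-1) (Gp (size p).-1) lp0.
rewrite -/(lead_coef _) -/(lead_coef _); set c := _ / _; set c' := _ / _ => Gc.
pose e := (size q - size p)%N; pose r : {poly K} := c%:P * 'X^e.
have Gr := graph_coefsM GG (graph_coefsC GG Gc) (graph_coefsXn GG e).
have Gs := graph_coefsD GG Gq (graph_coefsN GG (graph_coefsM GG Gr Gp)).
have ss : (size (q - r * p)%R < m)%N.
  apply: leq_trans (_ : size q <= m)%N; last by rewrite -ltnS.
  have srp : size (r * p) = size q.
    rewrite /r -mulrA mul_polyC size_scale.
      by rewrite mulrC size_mulXn// subnK.
    by rewrite mulf_neq0 ?invr_eq0// lead_coef_eq0.
  apply: size_sub_lead => //.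
  by rewrite /r !lead_coefM lead_coefC lead_coefXn mulr1 divfK.
have rz : (q - r * p).[z] = 0 by rewrite hornerD hornerN hornerM pz qz mulr0 subr0.
have := IHm _ ss _ Gs rz; rewrite -/r {IHm Gs Gr}; clearbody r w.
rewrite derivB derivM !(hornerD, hornerN, hornerM, hornerC) pz => E.
apply: etrans (etrans (congr2 (fun u v => u + r.[z] * v) E pw) _) => /=; first by ring.
by rewrite mulr0 addr0.
Qed.

(** On A[z] formal differentiation in z is well defined, as z satisfies no equation over A; a
    maximal graph above it is total. *)
Lemma derivation_of_transcendental (A : set K) z :
  subalgebra iota A -> ~ algebraic_over A z ->
  exists d, [/\ derivation iota d, forall a, A a -> d a = 0 & d z = 1].
Proof.
move=> sA trz.
pose G := [set u | exists p, coefs_in A p /\ u = (p.[z], p^`().[z])].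
have GG : der_graph G.
  split=> [c|f f' g g'|f f' g g'|f'].
  - exists (iota c)%:P; split; last by rewrite derivC !hornerE.
    by apply: coefs_inC => //; case: sA.
  - move=> [p [Ap [-> ->]]] [q [Aq [-> ->]]]; exists (p + q).
    by split; [apply: (coefs_inD sA)|rewrite derivD !hornerD].
  - move=> [p [Ap [-> ->]]] [q [Aq [-> ->]]]; exists (p * q).
    split; [exact: (coefs_inM sA)|rewrite derivM !(hornerD, hornerM)].
    by congr pair; ring.
  - move=> [p [Ap [/esym pz ->]]]; suff -> : p = 0 by rewrite derivC horner0.
    by apply/eqP/negPn/negP => p0; apply: trz; exists p.
have [H [HH GH Hmax]] := der_graph_maximal GG.
have /choice[d Hd] := der_graph_total HH Hmax.
have dE f f' : H (f, f') -> d f = f' by move=> ?; apply: (der_graph_fun HH).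
have [HC HD HM _] := HH.
exists d; split=> [|a Aa|].
- split=> [c|f g|f g]; apply: dE; [exact: HC|exact: HD|exact: HM].
- apply/dE/GH; exists a%:P; split; first exact: (coefs_inC sA).
  by rewrite derivC !hornerE.
- apply/dE/GH; exists 'X; split; first exact: (coefs_inX sA).
  by rewrite derivX !hornerE.
Qed.

End DerivationExtension.

(** * Valuations and their residue fields *)

Section TranscendentalSequences.
Variables (k : closedFieldType) (K : fieldType) (iota : {rmorphism k -> K}).
Hypothesis char0 : [pchar K] =i pred0.
Implicit Types (f g z w : K) (p q : {poly K}) (s : seq K).
Local Notation gen := (alg_gen iota).

Fixpoint transcendental_seq s := if s is x :: s' then
  transcendental_seq s' /\ ~ algebraic_over (gen [set` s']) x else True.

(** The head of the list is transcendental over its tail, so some derivation kills the tail and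
    takes the value 1 at the head. Nothing is claimed about earlier entries, whence a triangular
    rather than a diagonal Jacobian. *)
Lemma triangular_derivations s : transcendental_seq s ->
  exists d : 'I_(size s) -> K -> K, [/\ forall i, derivation iota (d i),
    forall i : 'I_(size s), d i s`_i = 1
    & forall i j : 'I_(size s), (i < j)%N -> d i s`_j = 0].
Proof.
move=> ts; suff H i : (i < size s)%N -> exists d, [/\ derivation iota d, d s`_i = 1
    & forall j, (i < j < size s)%N -> d s`_j = 0].
  have /choice[d dP] := fun i : 'I_(size s) => H i (ltn_ord i).
  exists d; split=> [i|i|i j ij]; have [// d1 d2 d3] := dP i.
  by rewrite d3// ij /=.
elim: s ts i => // x s IHs [/IHs{}IHs tx] [|i] /= si.
  have [d [dd dA dx]] := derivation_of_transcendental char0 (alg_gen_subalg _ _) tx.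
  exists d; split=> // -[|j] // /andP[_ js].
  by apply: dA; apply: alg_gen_in; exact: mem_nth.
have [d [dd di dj]] := IHs i si.
by exists d; split=> // -[|j] // ij; apply: dj.
Qed.

(** The unitriangular Jacobian factors through a space of dimension n. This bounds transcendence
    degrees without a theory of transcendence bases. *)
Lemma transcendental_seq_leq n (D : 'I_n -> K -> K) s :
  (forall d, derivation iota d ->
     exists a : 'I_n -> K, forall f, d f = \sum_i a i * D i f) ->
  transcendental_seq s -> (size s <= n)%N.
Proof.
move=> Dspan ts; have [d [dd d1 d0]] := triangular_derivations ts.
have /choice[a aE] := fun i => Dspan _ (dd i).
pose M := \matrix_(i < size s, j < size s) d i s`_j.
have ME : M = (\matrix_(i < size s, l < n) a i l) *m (\matrix_(l < n, j < size s) D l s`_j).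
  by apply/matrixP => i j; rewrite !mxE aE; apply: eq_bigr => l _; rewrite !mxE.
have /det_trig detM : is_trig_mx M by apply/is_trig_mxP => i j ij; rewrite mxE d0.
have uM : M \in unitmx.
  by rewrite unitmxE detM big1 ?unitr1// => i _; rewrite mxE d1.
by rewrite -(mxrank_unit uM) ME (leq_trans (mxrankM_maxr _ _))// rank_leq_row.
Qed.

End TranscendentalSequences.

Section IntegerValuations.
Variables (k : closedFieldType) (K : fieldType) (iota : {rmorphism k -> K}).
Implicit Types (f g z : K) (p q : {poly K}) (s : seq K).
Local Notation gen := (alg_gen iota).

(* The value at 0 is irrelevant. *)
Definition int_valuation (w : K -> int) := [/\
  forall f g, f != 0 -> g != 0 -> w (f * g) = w f + w g,
  forall f g, f != 0 -> g != 0 -> f + g != 0 ->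
    Num.min (w f) (w g) <= w (f + g)
  & forall c, c != 0 -> w (iota c) = 0].

Definition val_ge (w : K -> int) (n : int) : set K :=
  [set f | f = 0 \/ n <= w f].

Variable w : K -> int.
Hypothesis wV : int_valuation w.

Lemma valM f g : f != 0 -> g != 0 -> w (f * g) = w f + w g.
Proof. by case: wV => + _ _; apply. Qed.

Lemma valC c : c != 0 -> w (iota c) = 0. Proof. by case: wV => _ _; apply. Qed.

Lemma val1 : w 1 = 0. Proof. by rewrite -(rmorph1 iota) valC ?oner_eq0. Qed.

Lemma valV f : f != 0 -> w f^-1 = - w f.
Proof.
move=> f0; have := valM f0 (invr_neq0 f0); rewrite divff// val1 => /esym/eqP.
by rewrite addrC addr_eq0 => /eqP.
Qed.

Lemma val_div f g : f != 0 -> g != 0 -> w (f / g) = w f - w g.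
Proof. by move=> f0 g0; rewrite valM ?invr_neq0// valV. Qed.

Lemma valXn f n : f != 0 -> w (f ^+ n) = w f * n%:Z.
Proof.
move=> f0; elim: n => [|n IHn]; first by rewrite expr0 val1 mulr0.
by rewrite exprS valM ?expf_neq0// IHn; lia.
Qed.

Lemma valN f : f != 0 -> w (- f) = w f.
Proof.
move=> f0; rewrite -mulN1r valM ?oppr_eq0 ?oner_eq0//.
by rewrite -(rmorph1 iota) -rmorphN valC ?add0r// oppr_eq0 oner_eq0.
Qed.

Lemma val_geE n f : f != 0 -> val_ge w n f <-> n <= w f.
Proof. by move=> f0; split=> [[/eqP|//]|]; [rewrite (negPf f0)|right]. Qed.

Lemma val_ge0 n : val_ge w n 0. Proof. by left. Qed.
Hint Resolve val_ge0 : core.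

Lemma val_geW m n f : m <= n -> val_ge w n f -> val_ge w m f.
Proof. by move=> mn [->|nf]; [left|right; apply: le_trans nf]. Qed.

Lemma val_geD n f g : val_ge w n f -> val_ge w n g -> val_ge w n (f + g).
Proof.
have [->|f0] := eqVneq f 0; first by rewrite add0r.
have [->|g0] := eqVneq g 0; first by rewrite addr0.
move=> /(val_geE _ f0) nf /(val_geE _ g0) ng; have [->|fg0] := eqVneq (f + g) 0; first by left.
right; case: wV => _ + _ => /(_ _ _ f0 g0 fg0); apply: le_trans.
by rewrite le_min nf.
Qed.

Lemma val_geM m n f g : val_ge w m f -> val_ge w n g -> val_ge w (m + n) (f * g).
Proof.
have [->|f0] := eqVneq f 0; first by rewrite mul0r.
have [->|g0] := eqVneq g 0; first by rewrite mulr0.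
by rewrite !val_geE ?mulf_neq0// valM//; lia.
Qed.

Lemma val_geN n f : val_ge w n f -> val_ge w n (- f).
Proof.
have [->|f0] := eqVneq f 0; first by rewrite oppr0.
by rewrite !val_geE ?oppr_eq0// valN.
Qed.

Lemma val_ge_sum n (T : Type) (r : seq T) (P : pred T) (F : T -> K) :
  (forall i, P i -> val_ge w n (F i)) -> val_ge w n (\sum_(i <- r | P i) F i).
Proof. by move=> nF; elim/big_ind: _ => // f g; apply: val_geD. Qed.

Lemma val_ge_scalar c : val_ge w 0 (iota c).
Proof.
by have [->|c0] := eqVneq c 0; [rewrite rmorph0|right; rewrite valC].
Qed.

Lemma val_ring_subalg : subalgebra iota (val_ge w 0).
Proof.
split=> [c|f g|f g]; [exact: val_ge_scalar|exact: val_geD|].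
by move=> ? ?; rewrite -[0](addr0 0); apply: val_geM.
Qed.
Hint Resolve val_ring_subalg : core.

Lemma val_add_gt f g : f != 0 -> val_ge w (w f + 1) g ->
  f + g != 0 /\ w (f + g) = w f.
Proof.
move=> f0 fg; have [g0|g0] := eqVneq g 0; first by rewrite g0 addr0.
move: fg; rewrite val_geE// => fg.
have fg0 : f + g != 0.
  apply: contraPneq fg => /eqP; rewrite addr_eq0 => /eqP ->.
  by rewrite valN//; lia.
split=> //; apply/eqP; rewrite eq_le; apply/andP; split.
  have : val_ge w (Num.min (w (f + g)) (w g)) f.
    rewrite -{2}(addrK g f); apply: val_geD; first by right; rewrite ge_min lexx.
    by apply: val_geN; right; rewrite ge_min lexx orbT.
  by rewrite val_geE// ge_min => /orP[//|]; lia.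
have [_ /(_ _ _ f0 g0 fg0) + _] := wV; apply: le_trans.
by rewrite le_min lexx /=; lia.
Qed.

Lemma val_bounded (I : finType) (a : I -> K) :
  exists m : nat, forall i, val_ge w (- m%:Z) (a i).
Proof.
exists (\sum_i `|w (a i)|%N)%N => i.
have [->|ai] := eqVneq (a i) 0; first by left.
by right; rewrite (bigD1 i) //=; lia.
Qed.

Lemma val_unit_part p z : coefs_in (val_ge w 0) p -> val_ge w 1 z ->
  p`_0 != 0 -> w p`_0 = 0 -> p.[z] != 0 /\ w p.[z] = 0.
Proof.
move=> Dp z1 p00 wp0; have -> : p.[z] = p`_0 + (drop_poly 1 p).[z] * z.
  rewrite -{1}(poly_take_drop 1 p) hornerD hornerM hornerXn expr1; congr (_ + _).
  by rewrite (size1_polyC (size_take_poly 1 p)) coef_take_poly hornerC.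
rewrite -wp0; apply: val_add_gt => //; rewrite wp0.
apply: val_geM => //; apply: (coefs_in_horner val_ring_subalg).
  by move=> i; rewrite coef_drop_poly.
exact: val_geW z1.
Qed.

(** Algebraic independence over k of the residues of [s], stated without a residue field: nonzero
    polynomial expressions in the lifts have value exactly 0. *)
Fixpoint residually_independent s := if s is x :: s' then
  [/\ residually_independent s', val_ge w 0 x &
    forall p, coefs_in (gen [set` s']) p -> p != 0 ->
      p.[x] != 0 /\ w p.[x] = 0] else True.

Lemma residually_independent_val s f : residually_independent s ->
  gen [set` s] f -> f != 0 -> w f = 0.
Proof.
case: s => [_ /alg_gen_nil[c ->] c0|x s [_ _ sx] /alg_gen_cons[p sp -> px0]].
  by rewrite valC//; apply: contraNneq c0 => ->; rewrite rmorph0.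
by apply: (sx _ sp _).2; apply: contraNneq px0 => ->; rewrite horner0.
Qed.

Lemma residually_independent_sub s : residually_independent s ->
  gen [set` s] `<=` val_ge w 0.
Proof.
move=> rs; apply: alg_gen_min => // f /=.
elim: s rs => // x s IHs [rs x0 _]; rewrite inE => /orP[/eqP -> //|].
exact: IHs.
Qed.

Lemma residually_independent_trans s :
  residually_independent s -> transcendental_seq iota s.
Proof.
elim: s => // x s IHs [/IHs ts _ sx]; split=> // -[p [p0 sp px]].
by have [] := sx p sp p0; rewrite px eqxx.
Qed.

End IntegerValuations.

Section ResidueField.
Variables (k : closedFieldType) (K : fieldType) (iota : {rmorphism k -> K}).
Hypothesis char0 : [pchar K] =i pred0.
Implicit Types (f g z : K) (p q : {poly K}) (s : seq K).
Local Notation gen := (alg_gen iota).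
Variables (w : K -> int) (n : nat) (D : 'I_n -> K -> K) (c : int).
Hypothesis wV : int_valuation iota w.
Hypothesis Dspan : forall d, derivation iota d ->
  exists a : 'I_n -> K, forall f, d f = \sum_i a i * D i f.
Hypothesis Dval : forall i f, f != 0 -> val_ge w (w f - c) (D i f).

Lemma residual_basis : exists2 s, residually_independent iota w s &
  forall h, val_ge w 0 h -> exists p, [/\ coefs_in (gen [set` s]) p,
    val_ge w 1 p.[h], p^`().[h] != 0 & w p^`().[h] = 0].
Proof.
pose P m := `[< exists2 s, residually_independent iota w s & size s = m >].
have P0 : exists m, P m by exists 0%N; apply/asboolP; exists [::].
have Pn m : P m -> (m <= n)%N.
  move=> /asboolP[s /residually_independent_trans ts <-].
  exact: (transcendental_seq_leq char0 Dspan ts).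
case: (ex_maxnP P0 Pn) => m /asboolP[s rs sm] mmax; exists s => // h h0.
have sD := residually_independent_sub wV rs.
pose Q j := `[< exists p, [/\ p != 0, coefs_in (gen [set` s]) p,
  val_ge w 1 p.[h] & size p = j] >].
have exQ : exists j, Q j.
  apply: contrapT => noQ; suff : (m.+1 <= m)%N by rewrite ltnn.
  apply: mmax; apply/asboolP; exists (h :: s); last by rewrite /= sm.
  split=> // p sp p0; apply: contrapT => ph; apply: noQ; exists (size p).
  apply/asboolP; exists p; split=> //.
  have [->|ph0] := eqVneq p.[h] 0; first by left.
  have [/eqP|] : val_ge w 0 p.[h].
  - apply: (coefs_in_horner (val_ring_subalg wV)) => // i; exact: sD.
  - by rewrite (negPf ph0).
  rewrite le_eqVlt => /orP[/eqP ph1|]; first by case: ph.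
  by right; lia.
case: (ex_minnP exQ) => j /asboolP[p [p0 sp ph sj]] jmin.
have dp0 : p^`() != 0.
  apply: contraTneq isT => /(deriv_eq0 char0) /size1_polyC pC.
  have p00 : p`_0 != 0 by apply: contraNneq p0 => p00; rewrite pC p00.
  move: ph; rewrite pC hornerC val_geE// => /=.
  by rewrite (residually_independent_val wV rs (sp 0%N)).
exists p; split=> //.
  apply/eqP => dp1; have := size_deriv_lt p0; rewrite ltnNge sj.
  move/negP; apply; apply: jmin; apply/asboolP; exists p^`(); split=> //.
    exact: (coefs_in_deriv (alg_gen_subalg _ _)).
  by rewrite dp1; left.
apply/eqP/negPn/negP => dp1; have := size_deriv_lt p0; rewrite ltnNge sj.
move/negP; apply; apply: jmin; apply/asboolP; exists p^`(); split=> //.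
  exact: (coefs_in_deriv (alg_gen_subalg _ _)).
have [->|dp2] : val_ge w 0 p^`().[h]; last by right; lia.
  apply: (coefs_in_horner (val_ring_subalg wV)) => // i; apply: sD.
  exact: (coefs_in_deriv (alg_gen_subalg iota _) sp).
by left.
Qed.

(* If z is transcendental over k[u, s], some nonzero derivation d kills k[u, s].
   Its values w (d h), for h integral, are bounded below; but if p reduces to an
   equation of the residue of h then p(h) = u h' with
   w (d h') = w (d h) - w u. *)
Lemma algebraic_over_residual_basis s u :
  residually_independent iota w s ->
  (forall h, val_ge w 0 h -> exists p, [/\ coefs_in (gen [set` s]) p,
    val_ge w 1 p.[h], p^`().[h] != 0 & w p^`().[h] = 0]) ->
  u != 0 -> w u = 1 -> forall z, algebraic_over (gen [set` u :: s]) z.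
Proof.
move=> rs sres u0 wu z; apply: contrapT => tz.
have [d [dd dA dz]] := derivation_of_transcendental char0 (alg_gen_subalg _ _) tz.
have du : d u = 0 by apply: dA; apply: alg_gen_cons_head.
have [a aE] := Dspan dd; have [m ma] := val_bounded w a.
have dval f : val_ge w 0 f -> val_ge w (- (m%:Z + c)) (d f).
  have [-> _|f0] := eqVneq f 0; first by rewrite (der0 dd); left.
  rewrite val_geE// => wf; rewrite aE; apply: (val_ge_sum wV) => i _.
  apply: (@val_geW _ _ _ (- m%:Z + (w f - c))); first by lia.
  by apply: (val_geM wV) => //; apply: Dval.
(* The shift by [m%:Z + c] turns the lower bound [dval] into non-negativity, so that a least value
   of [d h] can be chosen. *)
pose Q j := `[< exists h, [/\ val_ge w 0 h, d h != 0
  & w (d h) = j%:Z - (m%:Z + c)] >].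
have QE h : val_ge w 0 h -> d h != 0 ->
    exists2 j : nat, Q j & w (d h) = j%:Z - (m%:Z + c).
  move=> h0 dh; have := dval h h0; rewrite val_geE// => wdh.
  have E : w (d h) = (absz (w (d h) + (m%:Z + c)))%:Z - (m%:Z + c) by lia.
  by exists (absz (w (d h) + (m%:Z + c))) => //; apply/asboolP; exists h.
have dX i : d (u ^+ i) = 0 by rewrite (derXn _ _ dd) du mulr0.
have exQ : exists j, Q j.
  have z0 : z != 0.
    by apply: contra_eq_neq dz => ->; rewrite (der0 dd) eq_sym oner_eq0.
  (* The power of [u], a constant for [d], makes [z] integral without killing its derivative. *)
  have dzu : d (u ^+ `|w z|%N * z) = u ^+ `|w z|%N.
    by rewrite (derM _ _ dd) dX mulr0 addr0 dz mulr1.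
  have [||j Qj _] := QE (u ^+ `|w z|%N * z); last by exists j.
    by right; rewrite (valM wV) ?expf_neq0// (valXn wV)// wu; lia.
  by rewrite dzu expf_neq0.
case: (ex_minnP exQ) => j /asboolP[h [h0 dh wdh]] jmin.
have [p [sp ph dp0 wdp]] := sres h h0.
pose h' := p.[h] / u.
have phE : p.[h] = u * h' by rewrite mulrC divfK.
have dE : u * d h' = p^`().[h] * d h.
  rewrite -(der_horner_const _ dd _ sp).
    by rewrite phE (derM _ _ dd) du mulr0 addr0.
  by move=> f sf; apply: dA; apply: alg_gen_cons_tail.
have h'0 : val_ge w 0 h'.
  rewrite /h' -(subrr 1); apply: (val_geM wV) => //.
  by right; rewrite (valV wV) ?wu.
have dh' : d h' != 0.
  by apply/eqP => dh'; move/eqP: dE; rewrite dh' mulr0 eq_sym mulf_eq0 (negPf dh)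
    (negPf dp0).
have [j' /jmin jj' wdh'] := QE _ h'0 dh'.
have := congr1 w dE; rewrite !(valM wV)// wu wdp wdh wdh'.
by lia.
Qed.

End ResidueField.

(** * Finite type of divisorial valuation rings *)

Section FractionFields.
Variables (k : closedFieldType) (K : fieldType) (iota : {rmorphism k -> K}).
Implicit Types (f g x : K) (p q : {poly K}) (A F : set K).
Local Notation subalg := (subalgebra iota).

Definition fractions A :=
  [set f : K | exists a b, [/\ A a, A b, b != 0 & f = a / b]].

Lemma fractions_subalg A : subalg A -> subalg (fractions A).
Proof.
move=> sA; split=> [c|_ _ [a [b [Aa Ab b0 ->]]] [a' [b' [Aa' Ab' b'0 ->]]]|
  _ _ [a [b [Aa Ab b0 ->]]] [a' [b' [Aa' Ab' b'0 ->]]]].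
- exists (iota c), 1; split; [by case: sA|exact: (subalg1 sA)|exact: oner_neq0|].
  by rewrite divr1.
- exists (a * b' + a' * b), (b * b'); split; last by field; rewrite b0 b'0.
  + by apply: (subalgD sA); apply: (subalgM sA).
  + exact: (subalgM sA).
  + by rewrite mulf_neq0.
- exists (a * a'), (b * b'); split; last by field; rewrite b0 b'0.
  + exact: (subalgM sA).
  + exact: (subalgM sA).
  + by rewrite mulf_neq0.
Qed.

Lemma fractionsV A f : subalg A -> fractions A f -> fractions A f^-1.
Proof.
move=> sA [a [b [Aa Ab b0 ->]]]; have [->|a0] := eqVneq a 0.
  by rewrite mul0r invr0; apply: (subalg0 (fractions_subalg sA)).
by exists b, a; split=> //; rewrite invf_div.
Qed.

Lemma sub_fractions A : subalg A -> A `<=` fractions A.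
Proof.
move=> sA f Af; exists f, 1; split; rewrite ?divr1 ?oner_neq0//.
exact: (subalg1 sA).
Qed.

Lemma algebraic_overW A B x : A `<=` B -> algebraic_over A x -> algebraic_over B x.
Proof. by move=> AB [p [p0 Ap px]]; exists p; split=> // i; apply: AB. Qed.

(** An equation p(f) f + c = 0 with c nonzero gives f^-1 = -p(f)/c, a polynomial in f; factors of f
    are cancelled first. *)
Lemma inv_in_subalg A F f : subalg A -> F `<=` A -> (forall a, F a -> F a^-1) ->
  A f -> algebraic_over F f -> A f^-1.
Proof.
move=> sA FA FV Af [p [p0 Fp pf]]; have [->|f0] := eqVneq f 0.
  by rewrite invr0; apply: (subalg0 sA).
elim/poly_ind: p p0 Fp pf => [|p c IHp]; first by rewrite eqxx.
have [->|c0] := eqVneq c 0.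
  rewrite addr0 => p0 Fp; rewrite hornerMX => /eqP; rewrite mulf_eq0 (negPf f0) orbF.
  move=> /eqP pf; apply: IHp => //.
    by apply: contraNneq p0 => ->; rewrite mul0r.
  by move=> i; have := Fp i.+1; rewrite coefMX.
move=> _ Fp /eqP; rewrite hornerD hornerMX hornerC addr_eq0 => /eqP pf.
have -> : f^-1 = - p.[f] * c^-1.
  apply: (mulIf f0); rewrite mulVf// mulrAC mulNr pf opprK divff//.
apply: (subalgM sA).
  apply/(subalgN sA)/(coefs_in_horner sA) => // i; apply: FA.
  by have := Fp i.+1; rewrite coefD coefMX coefC addr0.
by apply/FA/FV; have := Fp 0%N; rewrite coefD coefMX coefC add0r.
Qed.

Lemma common_denominator A (E : seq K) : subalg A ->
  (forall f, fractions A f) ->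
  exists b, [/\ A b, b != 0 & forall f, f \in E -> A (f * b)].
Proof.
move=> sA aK; elim: E => [|f E [b [Ab b0 bE]]].
  by exists 1; split=> //; [exact: (subalg1 sA)|exact: oner_neq0].
have [c [d [Ac Ad d0 ->]]] := aK f; exists (b * d); split.
- exact: (subalgM sA).
- by rewrite mulf_neq0.
move=> h; rewrite inE => /orP[/eqP->|/bE Ahb].
  have -> : c / d * (b * d) = c * b by field.
  exact: (subalgM sA).
by rewrite mulrA; apply: (subalgM sA).
Qed.

End FractionFields.

Section FiniteExtensions.
Variables (k : closedFieldType) (K : fieldType) (iota : {rmorphism k -> K}).
Variable F : set K.
Hypotheses (sF : subalgebra iota F) (FV : forall a, F a -> F a^-1).
Implicit Types (f g x : K) (p q : {poly K}) (I : finType).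

Definition lin_span I (e : I -> K) :=
  [set f | exists c : I -> K, (forall i, F (c i)) /\ f = \sum_i c i * e i].

Lemma lin_spanD I (e : I -> K) f g :
  lin_span e f -> lin_span e g -> lin_span e (f + g).
Proof.
move=> [c [Fc ->]] [d [Fd ->]]; exists (fun i => c i + d i).
split=> [i|]; first exact: (subalgD sF).
by rewrite -big_split; apply: eq_bigr => i _; rewrite mulrDl.
Qed.

Lemma lin_spanZ I (e : I -> K) a f : F a -> lin_span e f -> lin_span e (a * f).
Proof.
move=> Fa [c [Fc ->]]; exists (fun i => a * c i).
split=> [i|]; first exact: (subalgM sF).
by rewrite mulr_sumr; apply: eq_bigr => i _; rewrite mulrA.
Qed.

Lemma lin_span0 I (e : I -> K) : lin_span e 0.
Proof.
exists (fun=> 0); split=> [i|]; first exact: (subalg0 sF).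
by rewrite big1// => i _; rewrite mul0r.
Qed.

Lemma lin_span_gen I (e : I -> K) i : lin_span e (e i).
Proof.
exists (fun j => (j == i)%:R); split=> [j|]; first exact: (subalg_nat _ sF).
by rewrite (bigD1 i)//= eqxx mul1r big1 ?addr0// => j /negPf->; rewrite mul0r.
Qed.

Lemma lin_span_sub (I J : finType) (e : I -> K) (e' : J -> K) :
  (forall i, lin_span e' (e i)) -> lin_span e `<=` lin_span e'.
Proof.
move=> ee' f [c [Fc ->]]; elim/big_ind: _ => [|x y|i _].
- exact: lin_span0.
- exact: lin_spanD.
- exact: lin_spanZ.
Qed.

(** The products of the e_i with the powers of x below the degree of an equation of x span: higher
    powers are removed by division, which works because the leading coefficient is invertible in
    [F]. *)
Lemma lin_span_adjoin I (e : I -> K) x :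
  subalgebra iota (lin_span e) -> F `<=` lin_span e -> algebraic_over F x ->
  exists (J : finType) (e' : J -> K), [/\ subalgebra iota (lin_span e'),
    lin_span e `<=` lin_span e' & lin_span e' x].
Proof.
move=> sV FVe [p [p0 Fp px]]; set V := lin_span e in sV FVe.
pose m := (size p).-1; pose e' (ij : I * 'I_m) := e ij.1 * x ^+ ij.2.
pose H := [set f | exists2 q, coefs_in V q & f = q.[x]].
have sH : subalgebra iota H by apply: subalg_horners.
have VH : V `<=` H.
  by move=> f Vf; exists f%:P; [apply: (coefs_inC sV)|rewrite hornerC].
have Hx : H x by exists 'X; [apply: (coefs_inX sV)|rewrite hornerX].
exists (I * 'I_m)%type, e'.
suff -> : lin_span e' = H by split.
have small q : coefs_in V q -> (size q <= m)%N -> lin_span e' q.[x].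
  move=> Vq qm; rewrite (horner_coef_wide _ qm).
  elim/big_ind: _ => [|y z|j _]; [exact: lin_span0|exact: lin_spanD|].
  have [c [Fc ->]] := Vq j; rewrite mulr_suml.
  elim/big_ind: _ => [|y z|i _]; [exact: lin_span0|exact: lin_spanD|].
  by rewrite -mulrA; apply: lin_spanZ => //; apply: (lin_span_gen e' (i, j)).
apply/seteqP; split=> [f [c [Fc ->]]|_ [q Vq ->]].
  apply: (@subalg_sum _ _ iota H _ _ _ _ sH) => -[i j] _; apply: (subalgM sH); first exact/VH/FVe.
  apply: (subalgM sH); last exact: (subalgX _ sH).
  exact/VH/lin_span_gen.
have [r] := ubnP (size q); elim: r q Vq => // r IHr q Vq qr.
have [qm|mq] := leqP (size q) m; first exact: small.
have lp0 : lead_coef p != 0 by rewrite lead_coef_eq0.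
have pq : (size p <= size q)%N by move: mq; rewrite /m; case: (size p).
have q0 : q != 0 by rewrite -size_poly_gt0 (leq_ltn_trans _ mq).
pose c := lead_coef q / lead_coef p.
pose q' := c%:P * (p * 'X^(size q - size p)).
have q'x : q'.[x] = 0 by rewrite !hornerM px mul0r mulr0.
rewrite -[q.[x]]subr0 -q'x -hornerN -hornerD; apply: IHr.
  apply: (coefs_inD sV) => //; apply/(coefs_inN sV)/(coefs_inM sV).
    apply: (coefs_inC sV); apply: (subalgM sV); first exact: Vq.
    exact/FVe/FV/Fp.
  move=> i; rewrite coefMXn; case: ifP => _; first exact: (subalg0 sV).
  exact/FVe/Fp.
apply: leq_trans (_ : size q <= r)%N; last by rewrite -ltnS.
have lq' : lead_coef q' = lead_coef q.
  by rewrite !lead_coefM lead_coefC lead_coefXn mulr1 divfK.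
apply: size_sub_lead => //.
rewrite /q' mul_polyC size_scale; first by rewrite size_mulXn// subnK.
by rewrite mulf_neq0 ?invr_eq0// lead_coef_eq0.
Qed.

Lemma finite_lin_span (t : seq K) : (forall x, x \in t -> algebraic_over F x) ->
  exists (I : finType) (e : I -> K), [/\ subalgebra iota (lin_span e), F `<=` lin_span e
    & [set` t] `<=` lin_span e].
Proof.
elim: t => [_|x t IHt talg].
  exists unit, (fun=> 1); have -> : lin_span (fun _ : unit => 1) = F.
    apply/seteqP; split=> [f [c [Fc ->]]|f Ff].
      by apply: (@subalg_sum _ _ iota F _ _ _ _ sF) => i _; rewrite mulr1.
    by exists (fun=> f); split=> //; rewrite big_const card_unit /= mulr1 addr0.
  by split.
have [I [e [sV FVe tV]]] := IHt (fun y yt => talg y (@mem_behead _ (x :: t) y yt)).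
have [J [e' [sV' VV' V'x]]] := lin_span_adjoin sV FVe (talg x (mem_head _ _)).
exists J, e'; split=> //; first exact: subset_trans FVe VV'.
by move=> y /=; rewrite inE => /orP[/eqP->|/tV/VV'].
Qed.

Lemma finite_extension_basis (t : seq K) :
  (forall x, algebraic_over F x) ->
  (forall f, fractions (alg_gen iota [set` t]) f) ->
  exists n (e : 'I_n -> K), (forall f, lin_span e f) /\
    forall c : 'I_n -> K, (forall i, F (c i)) -> \sum_i c i * e i = 0 ->
      forall i, c i = 0.
Proof.
move=> Falg tK; have [I [e [sV FVe tV]]] := @finite_lin_span t (fun x _ => Falg x).
have eK f : lin_span e f.
  have [a [b [ta tb b0 ->]]] := tK f; have tV' := alg_gen_min sV tV.
  by apply: (subalgM sV); [exact: tV'|exact: (inv_in_subalg sV FVe FV (tV' _ tb) (Falg b))].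
pose P n := `[< exists e : 'I_n -> K, forall f, lin_span e f >].
have exP : exists n, P n.
  exists #|I|; apply/asboolP; exists (e \o enum_val) => f.
  apply: lin_span_sub (eK f) => i.
  by have := lin_span_gen (e \o enum_val) (enum_rank i); rewrite /= enum_rankK.
case: (ex_minnP exP) => n /asboolP[{eK}b bK] nmin; exists n, b; split=> // c Fc cb j.
apply/eqP/negPn/negP => cj; case: n b bK nmin c Fc cb j cj => [|n] b bK nmin c Fc cb j cj.
  by case: j {cj}.
suff : P n by move/nmin; rewrite ltnn.
(* A relation with c_j nonzero expresses b_j through the others, so a spanning family of least size
   is free. *)
apply/asboolP; exists (b \o lift j) => f; apply: lin_span_sub (bK f) => i.
have [i' -> {i}|-> {i}] := unliftP j i; first exact: (lin_span_gen (b \o lift j)).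
exists (fun i => - (c (lift j i) / c j)); split=> [i|].
  by apply/(subalgN sF)/(subalgM sF) => //; apply: FV.
move: cb; rewrite (bigD1_ord j)//= => /eqP; rewrite addr_eq0 => /eqP cb.
apply: (mulfI cj); rewrite cb mulr_sumr -sumrN; apply: eq_bigr => i _.
by rewrite mulNr mulrN mulrA mulrCA divff// mulr1.
Qed.

End FiniteExtensions.

Section Lattices.
Variables (k : closedFieldType) (K : fieldType) (iota : {rmorphism k -> K}).
Variables (w : K -> int) (F : set K).
Hypotheses (wV : int_valuation iota w) (sF : subalgebra iota F).
Hypothesis FV : forall a, F a -> F a^-1.

Definition val_subring : set K := [set f | F f /\ val_ge w 0 f].

Lemma val_subring_subalg : subalgebra iota val_subring.
Proof.
have sV := val_ring_subalg wV; split=> [c|f g [Ff f0] [Fg g0]|f g [Ff f0] [Fg g0]].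
- by split; [case: sF|case: sV].
- by split; [apply: (subalgD sF)|apply: (subalgD sV)].
- by split; [apply: (subalgM sF)|apply: (subalgM sV)].
Qed.

Lemma val_subring_div f g : F f -> F g -> g != 0 -> val_ge w (w g) f ->
  val_subring (f / g).
Proof.
move=> Ff Fg g0 fg; split; first by apply: (subalgM sF) => //; apply: FV.
rewrite -(subrr (w g)); apply: (val_geM wV) => //.
by right; rewrite (valV wV).
Qed.

(** Bounded submodules of a vector space over a discretely valued field have n generators: among the
    first coordinates one of least value divides all others, which reduces to vectors with first
    coordinate 0. The bound -m ensures that a least value exists. If all first coordinates vanish,
    the row chosen is 0, so [G] may be singular. *)
Lemma lattice_basis n (P : set 'rV[K]_n) (m : nat) :
  P 0 -> (forall c d, P c -> P d -> P (c + d)) ->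
  (forall a c, val_subring a -> P c -> P (a *: c)) ->
  (forall c i, P c -> F (c 0 i) /\ val_ge w (- m%:Z) (c 0 i)) ->
  exists G : 'M[K]_n, (forall i, P (row i G)) /\
    forall c, P c -> exists d : 'rV_n, (forall i, val_subring (d 0 i)) /\ c = d *m G.
Proof.
elim: n P => [|n IHn] P.
  move=> P0 PD PZ Pm; exists 0; split=> [[]//|c _]; exists 0; split=> [[]//|].
  by apply/rowP => -[].
move: P; rewrite -[n.+1]/(1 + n)%N => P P0 PD PZ Pm.
have sD := val_subring_subalg.
have [g [Pg gmin]] : exists g : 'rV_(1 + n), P g /\ forall c, P c ->
    exists2 a, val_subring a & (c - a *: g) 0 0 = 0.
  have [[c0 [Pc0 c00]]|no] := pselect (exists c, P c /\ c 0 0 != 0); last first.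
    exists 0; split=> // c Pc; exists 0; first exact: (subalg0 sD).
    rewrite scale0r subr0; apply/eqP/negPn/negP => c0; apply: no.
    by exists c.
  pose Q j := `[< exists c, [/\ P c, c 0 0 != 0 & w (c 0 0) = j%:Z - m%:Z] >].
  have QE c : P c -> c 0 0 != 0 -> exists2 j, Q j & w (c 0 0) = j%:Z - m%:Z.
    move=> Pc cn0; have [_] := Pm c 0 Pc; rewrite val_geE// => wc.
    have E : w (c 0 0) = (absz (w (c 0 0) + m%:Z))%:Z - m%:Z by lia.
    by exists (absz (w (c 0 0) + m%:Z)) => //; apply/asboolP; exists c.
  have exQ : exists j, Q j by have [j Qj _] := QE _ Pc0 c00; exists j.
  case: (ex_minnP exQ) => j /asboolP[g [Pg g0 wg]] jmin; exists g; split=> // c Pc.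
  exists (c 0 0 / g 0 0); last by rewrite !mxE divfK// subrr.
  apply: val_subring_div => //; [exact: (Pm c 0 Pc).1|exact: (Pm g 0 Pg).1|].
  have [->|cn0] := eqVneq (c 0 0) 0; first by left.
  by right; have [l /jmin jl ->] := QE _ Pc cn0; rewrite wg; lia.
pose P' := [set c : 'rV[K]_n | P (row_mx (0 : 'M[K]_(1, 1)) c)].
have [|c d Pc Pd|a c Da Pc|c i Pc|G [PG Gspan]] := IHn P'.
- by rewrite /P' /= row_mx0.
- by rewrite /P' /= -[0]addr0 -add_row_mx; apply: PD.
- by rewrite /P' /= -(scaler0 _ a) -scale_row_mx; apply: PZ.
- by rewrite -(row_mxEr (0 : 'M[K]_(1, 1)) c 0 i); exact: (Pm _ (rshift 1 i) Pc).
exists (col_mx g (row_mx 0 G)); split=> [i|c Pc].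
  have [j ->|j ->] := @split_ordP 1 n i.
    by rewrite rowKu; have -> : row j g = g by apply/rowP => l; rewrite mxE ord1.
  by rewrite rowKd row_row_mx row0; apply: PG.
have [a Da ca] := gmin c Pc.
have E : c - a *: g = row_mx 0 (rsubmx (c - a *: g)).
  rewrite -{1}[c - a *: g]hsubmxK; congr row_mx; apply/matrixP => i j.
  by rewrite !ord1 mxE [RHS]mxE -[RHS]ca; congr (_ _ _); apply/val_inj.
have Pca : P (c - a *: g).
  apply: PD => //; rewrite -scaleNr; apply: PZ => //; exact: (subalgN sD).
have [|d [Dd dE]] := Gspan (rsubmx (c - a *: g)); first by rewrite /P' /= -E.
exists (row_mx a%:M d); split=> [i|].
  by have [j ->|j ->] := @split_ordP 1 n i; rewrite ?row_mxEl ?row_mxEr ?mxE ?ord1 ?mulr1n.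
rewrite mul_row_col mul_scalar_mx mul_mx_row mulmx0 -dE -E addrC subrK//.
Qed.

End Lattices.

Section TraceBound.
Variables (k : closedFieldType) (K : fieldType) (iota : {rmorphism k -> K}).
Hypothesis char0 : [pchar K] =i pred0.
Variables (w : K -> int) (F : set K).
Hypotheses (wV : int_valuation iota w) (sF : subalgebra iota F).
Hypothesis FV : forall a, F a -> F a^-1.
Variables (n : nat) (e : 'I_n -> K).
Hypothesis e_span : forall f, lin_span F e f.
Hypothesis e_free : forall c : 'I_n -> K, (forall i, F (c i)) ->
  \sum_i c i * e i = 0 -> forall i, c i = 0.
Implicit Types (f g y z : K) (c d : 'rV[K]_n).
Local Notation D0 := (val_subring w F).

Let vec c := \sum_i c 0 i * e i.

Lemma coordinates_subproof : exists co : K -> 'rV[K]_n,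
  forall f, (forall i, F (co f 0 i)) /\ vec (co f) = f.
Proof.
have /choice[co coP] : forall f, exists c : 'rV[K]_n,
    (forall i, F (c 0 i)) /\ vec c = f.
  move=> f; have [c [Fc ->]] := e_span f; exists (\row_i c i).
  by split=> [i|]; [rewrite mxE|apply: eq_bigr => i _; rewrite mxE].
by exists co.
Qed.

Definition coordinates : K -> 'rV[K]_n := sval (cid coordinates_subproof).
Local Notation co := coordinates.

Lemma coordinatesP f i : F (co f 0 i).
Proof. by rewrite /co; case: cid => co' /= /(_ f)[]. Qed.
Hint Resolve coordinatesP : core.

Lemma vecK f : vec (co f) = f.
Proof. by rewrite /co; case: cid => co' /= /(_ f)[]. Qed.

Lemma vec_inj c d : (forall i, F (c 0 i)) -> (forall i, F (d 0 i)) ->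
  vec c = vec d -> c = d.
Proof.
move=> Fc Fd /eqP; rewrite -subr_eq0 -sumrB => /eqP cd.
apply/rowP => i; apply/eqP; rewrite -subr_eq0; apply/eqP.
apply: (e_free (c := fun i => c 0 i - d 0 i)) => [j|].
  exact: (subalgB sF).
by rewrite -[RHS]cd; apply: eq_bigr => j _; rewrite mulrBl.
Qed.

Lemma coordinates_vec c : (forall i, F (c 0 i)) -> co (vec c) = c.
Proof. by move=> Fc; apply: vec_inj => //; rewrite vecK. Qed.

Lemma vecD c d : vec (c + d) = vec c + vec d.
Proof. by rewrite -big_split; apply: eq_bigr => i _; rewrite mxE mulrDl. Qed.

Lemma vecZ a c : vec (a *: c) = a * vec c.
Proof. by rewrite mulr_sumr; apply: eq_bigr => i _; rewrite mxE mulrA. Qed.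

Lemma coordinatesD f g : co (f + g) = co f + co g.
Proof.
rewrite -{1}(vecK f) -{1}(vecK g) -vecD coordinates_vec// => i.
by rewrite mxE; apply: (subalgD sF).
Qed.

Lemma coordinatesZ a f : F a -> co (a * f) = a *: co f.
Proof.
move=> Fa; rewrite -{1}(vecK f) -vecZ coordinates_vec// => i.
by rewrite mxE; apply: (subalgM sF).
Qed.

Lemma coordinates0 : co 0 = 0.
Proof. by apply: (addrI (co 0)); rewrite -coordinatesD !addr0. Qed.

Lemma coordinates_sum (I : finType) (f : I -> K) :
  co (\sum_i f i) = \sum_i co (f i).
Proof. by elim/big_rec2: _ => [|i c g _ <-]; rewrite ?coordinates0 ?coordinatesD. Qed.

Definition mulmatrix z : 'M[K]_n := \matrix_i co (e i * z).
Local Notation M := mulmatrix.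

Lemma coordinatesM y z : co (y * z) = co y *m M z.
Proof.
rewrite -{1}(vecK y) mulr_suml coordinates_sum; apply/rowP => j.
rewrite summxE mxE; apply: eq_bigr => i _.
by rewrite -mulrA coordinatesZ// !mxE.
Qed.

Lemma mulmatrixD y z : M (y + z) = M y + M z.
Proof.
by apply/matrixP => i j; rewrite !mxE mulrDr coordinatesD mxE.
Qed.

Lemma mulmatrixZ a z : F a -> M (a * z) = a *: M z.
Proof.
by move=> Fa; apply/matrixP => i j; rewrite !mxE mulrCA (coordinatesZ _ Fa) mxE.
Qed.

Lemma mulmatrix1 : M 1 = 1%:M.
Proof.
apply/row_matrixP => i; rewrite rowK mulr1 row1.
have -> : e i = vec (delta_mx 0 i).
  rewrite /vec (bigD1 i)//= mxE !eqxx mul1r big1 ?addr0// => j /negPf ji.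
  by rewrite mxE ji andbF mul0r.
by rewrite coordinates_vec// => j; rewrite mxE; apply: (subalg_nat _ sF).
Qed.

Definition field_trace z := \tr (M z).
Local Notation tr := field_trace.

Lemma field_traceD y z : tr (y + z) = tr y + tr z.
Proof. by rewrite /tr mulmatrixD linearD. Qed.

Lemma field_traceZ a z : F a -> tr (a * z) = a * tr z.
Proof. by move=> Fa; rewrite /tr mulmatrixZ// linearZ. Qed.

Lemma field_trace_in z : F (tr z).
Proof.
rewrite /tr /mxtrace; elim/big_ind: _ => [|x y|i _].
- exact: (subalg0 sF).
- exact: (subalgD sF).
- by rewrite mxE.
Qed.

Lemma field_trace_coordinates y z : tr (y * z) = \sum_i co y 0 i * tr (e i * z).
Proof.
rewrite -{1}(vecK y) mulr_suml; have tr0 : tr 0 = 0.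
  by rewrite -(mul0r 0) field_traceZ ?mul0r//; apply: (subalg0 sF).
rewrite (big_morph _ field_traceD tr0); apply: eq_bigr => i _.
by rewrite -mulrA field_traceZ.
Qed.

(** Replaces integrality over the valuation ring of [F]; products of such elements are handled by
    the bilinearity of multiplication alone. *)
Definition power_bounded z := exists m : nat, forall l i,
  val_ge w (- m%:Z) (co (z ^+ l) 0 i).

Lemma coordinatesM_bound : exists m : nat, forall y z a b,
  (forall i, val_ge w a (co y 0 i)) -> (forall i, val_ge w b (co z 0 i)) ->
  forall i, val_ge w (a + b - m%:Z) (co (y * z) 0 i).
Proof.
have [m mE] := val_bounded w
  (fun ijl : 'I_n * 'I_n * 'I_n => M (e ijl.1.1) ijl.1.2 ijl.2).
exists m => y z a b ya zb i; rewrite coordinatesM mxE.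
apply: (val_ge_sum wV) => j _; rewrite -addrA; apply: (val_geM wV) => //.
rewrite mxE mulrC coordinatesM mxE; apply: (val_ge_sum wV) => l _.
by apply: (val_geM wV) => //; apply: (mE (j, l, i)).
Qed.

Lemma power_boundedM y z :
  power_bounded y -> power_bounded z -> power_bounded (y * z).
Proof.
move=> [a ya] [b zb]; have [m mE] := coordinatesM_bound.
exists (a + b + m)%N => l i; rewrite exprMn.
by have := mE _ _ _ _ (ya l) (zb l) i; apply: val_geW; lia.
Qed.

Variable u : K.
Hypotheses (u0 : u != 0) (Fu : F u) (wu : w u = 1).

Let FX m : F (u ^+ m). Proof. exact: (subalgX _ sF). Qed.

(* M z preserves a lattice. *)
Lemma field_trace_power_bounded z : power_bounded z -> val_ge w 0 (tr z).
Proof.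
move=> [b zb]; have [m0 m0E] := coordinatesM_bound.
have [m1 m1E] := val_bounded w (fun ij : 'I_n * 'I_n => co (e ij.1) 0 ij.2).
(* This module is stable under multiplication by z, since multiplying by z merely shifts the
   exponent l. *)
pose P := [set c : 'rV[K]_n | (forall i, F (c 0 i)) /\
  forall l i, val_ge w (- b%:Z) (co (vec c * z ^+ l) 0 i)].
have sD := val_subring_subalg wV sF.
have vec0 : vec 0 = 0 by rewrite /vec big1// => i _; rewrite mxE mul0r.
have [|c d [Fc Pc] [Fd Pd]|a c [Fa a0] [Fc Pc]|c i [Fc Pc]|G [PG Gspan]] :=
    @lattice_basis _ _ _ _ _ wV sF FV n P b.
- split=> [i|l i]; first by rewrite mxE; apply: (subalg0 sF).
  by rewrite vec0 mul0r coordinates0 mxE; left.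
- split=> [i|l i]; first by rewrite mxE; apply: (subalgD sF).
  by rewrite vecD mulrDl coordinatesD mxE; apply: (val_geD wV).
- split=> [i|l i]; first by rewrite mxE; apply: (subalgM sF).
  rewrite vecZ -mulrA coordinatesZ// mxE -[- b%:Z]add0r.
  exact: (val_geM wV).
- split=> //; have := Pc 0%N i; rewrite expr0 mulr1 coordinates_vec//.
(* [m1] bounds the denominators of the coordinates of the e_i and [m0] the loss in a product, so u^m
   e_i lies in the module for every i. Hence the module has full rank and [G] is invertible. *)
pose m := (m0 + m1)%N.
have Pum i : P (row i (u ^+ m)%:M).
  have rE : row i (u ^+ m)%:M = u ^+ m *: (co (e i) : 'rV_n).
    rewrite -[e i]mulr1 coordinatesM mulmatrix1 mulmx1.
    have -> : co (e i) = row i 1%:M by rewrite -mulmatrix1 rowK mulr1.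
    by apply/rowP => j; rewrite !mxE mulr_natr.
  rewrite rE; split=> [j|l j]; first by rewrite mxE; apply: (subalgM sF).
  rewrite vecZ vecK -mulrA coordinatesZ// mxE.
  apply: (@val_geW _ _ _ (m%:Z + (- m1%:Z - b%:Z - m0%:Z))); first by lia.
  apply: (val_geM wV).
    by right; rewrite (valXn wV)// wu mul1r.
  by apply: m0E => // j'; apply: (m1E (i, j')).
have /choice[H HE] := fun i => Gspan _ (Pum i).
have GU : G \in unitmx.
  rewrite unitmxE unitfE; apply/eqP => G0.
  have : \det ((u ^+ m)%:M : 'M[K]_n) = \det ((\matrix_i H i) *m G).
    congr (\det _); apply/row_matrixP => i.
    by rewrite row_mul rowK -(HE i).2.
  rewrite det_mulmx G0 mulr0 det_scalar => /eqP.
  by rewrite !expf_eq0 (negPf u0) !andbF.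
have PM i : P (row i (G *m M z)).
  have [FG PGi] := PG i.
  rewrite row_mul -(coordinates_vec FG) -coordinatesM; split=> // l j.
  by rewrite vecK -mulrA -exprS.
have /choice[D DE] := fun i => Gspan _ (PM i).
have GM : G *m M z = (\matrix_i D i) *m G.
  by apply/row_matrixP => i; rewrite [RHS]row_mul rowK -(DE i).2.
(* In the basis [G] multiplication by z has the integral matrix [D], and the trace does not depend
   on the basis. *)
rewrite /tr -[M z]mul1mx -(mulVmx GU) -mulmxA GM mxtrace_mulC -mulmxA mulmxV//.
rewrite mulmx1; apply: (val_ge_sum wV) => i _.
by have [_] := (DE i).1 i; rewrite !mxE.
Qed.

Let T : 'M[K]_n := \matrix_(i, j) tr (e i * e j).

(** A kernel vector with coefficients in F would give z nonzero with tr(z y) = 0 for all y; but y =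
    z^-1 has trace n, which is nonzero in characteristic zero. *)
Lemma trace_form_unit : T \in unitmx.
Proof.
rewrite unitmxE unitfE; apply/negP => /det0P[v v0 vT].
have [i0 vi0] : exists i, v 0 i != 0.
  apply: contrapT => no; case/eqP: v0; apply/rowP => i; rewrite mxE.
  by apply/eqP/negPn/negP => vi; apply: no; exists i.
have [l0 vl0] : exists l, co (v 0 i0) 0 l != 0.
  apply: contrapT => no; case/eqP: vi0; rewrite -(vecK (v 0 i0)) /vec big1// => l _.
  apply/eqP; rewrite mulf_eq0; apply/orP; left.
  by apply/negPn/negP => vl; apply: no; exists l.
(* The kernel vector [v] has entries in K. As T has entries in F, taking one fixed F-coordinate of
   each entry gives a kernel vector over F. *)
pose c := \row_i co (v 0 i) 0 l0; pose z := vec c.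
have Fc i : F (c 0 i) by rewrite mxE.
have zc : co z = c by rewrite coordinates_vec.
have z0 : z != 0.
  by apply: contraNneq vl0 => z0; move/rowP/(_ i0): zc; rewrite z0 coordinates0 !mxE => <-.
have zT j : tr (z * e j) = 0.
  rewrite field_trace_coordinates zc.
  pose b l := \sum_i co (v 0 i) 0 l * T i j.
  suff b0 : forall l, b l = 0.
    by rewrite -[RHS](b0 l0); apply: eq_bigr => i _; rewrite !mxE.
  apply: e_free => [l|].
    apply: (@subalg_sum _ _ iota F _ _ _ _ sF) => i _; apply: (subalgM sF) => //.
    by rewrite mxE; apply: field_trace_in.
  have := congr1 (fun A : 'rV_n => A 0 j) vT; rewrite !mxE => v0E; rewrite -[RHS]v0E.
  under eq_bigr do rewrite mulr_suml.
  rewrite exchange_big; apply: eq_bigr => i _ /=.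
  rewrite -{2}(vecK (v 0 i)) mulr_suml; apply: eq_bigr => l _.
  by rewrite mulrAC.
have : tr (z^-1 * z) = 0.
  rewrite field_trace_coordinates big1// => i _.
  by rewrite [e i * z]mulrC zT mulr0.
rewrite mulVf// /tr mulmatrix1 mxtrace1 => /eqP.
by rewrite ((pcharf0P K).1 char0); case: n i0 {v v0 vT vi0 c z Fc zc z0 zT vl0} => [[]|].
Qed.

(** The coordinates of z are recovered from the traces tr(z e_j) by the inverse of T. Once e_j is
    scaled by a_j the traces are integral, so the denominators depend only on T and the a_j. *)
Lemma power_bounded_coordinates :
  (forall i, exists a, [/\ F a, a != 0 & power_bounded (a * e i)]) ->
  exists m : nat, forall z, power_bounded z ->
    forall i, val_ge w (- m%:Z) (co z 0 i).
Proof.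
move=> /choice[a aP].
have [m mE] := val_bounded w (fun ij : 'I_n * 'I_n => invmx T ij.1 ij.2).
exists (\sum_i `|w (a i)| + m)%N => z zb i.
have -> : co z = (\row_j tr (z * e j)) *m invmx T.
  rewrite -[LHS]mulmx1 -(mulmxV trace_form_unit) mulmxA; congr (_ *m _).
  apply/rowP => j; rewrite !mxE field_trace_coordinates.
  by apply: eq_bigr => l _; rewrite mxE.
rewrite mxE; apply: (val_ge_sum wV) => j _; rewrite PoszD opprD.
apply: (val_geM wV); last exact: (mE (j, i)).
have [Fa a0 ab] := aP j; rewrite mxE.
have : val_ge w 0 (a j * tr (z * e j)).
  rewrite -field_traceZ// mulrCA; apply: field_trace_power_bounded.
  exact: power_boundedM.
have [->|t0] := eqVneq (tr (z * e j)) 0; first by left.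
rewrite !val_geE ?mulf_neq0// (valM wV)// (bigD1 j)//=.
by lia.
Qed.

End TraceBound.

Section IntegralElements.
Variables (k : closedFieldType) (K : fieldType) (iota : {rmorphism k -> K}).
Variable A : set K.
Hypothesis sA : subalgebra iota A.
Implicit Types (f y z : K) (p q : {poly K}) (m : nat).

(* y stabilizes the module spanned over A by 1, f, ..., f^(m-1). *)
Definition stabilizes f m y := forall q, coefs_in A q -> (size q <= m)%N ->
  exists q', [/\ coefs_in A q', (size q' <= m)%N & y * q.[f] = q'.[f]].

Lemma stabilizesD f m y z :
  stabilizes f m y -> stabilizes f m z -> stabilizes f m (y + z).
Proof.
move=> fy fz q Aq qm; have [q1 [Aq1 q1m q1E]] := fy q Aq qm.
have [q2 [Aq2 q2m q2E]] := fz q Aq qm; exists (q1 + q2); split.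
- exact: (coefs_inD sA).
- by rewrite (leq_trans (size_polyD _ _))// geq_max q1m.
- by rewrite mulrDl q1E q2E hornerD.
Qed.

Lemma stabilizesC f m a : A a -> stabilizes f m a.
Proof.
move=> Aa q Aq qm; exists (a%:P * q); split.
- by apply: (coefs_inM sA) => //; apply: (coefs_inC sA).
- by rewrite mul_polyC (leq_trans (size_scale_leq _ _)).
- by rewrite hornerM hornerC.
Qed.

(** Let b be the Horner tail sum_(i >= j) p_i f^(i-j). Products of b with powers of f below j stay
    within the degree bound, and on higher powers b f^j is replaced by minus the lower part of p(f)
    = 0. *)
Lemma stabilizes_drop f p j : coefs_in A p -> p.[f] = 0 ->
  (j <= (size p).-1)%N -> stabilizes f (size p).-1 (drop_poly j p).[f].
Proof.
move=> Ap pf; set m := (size p).-1 => jm q Aq qm.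
have Atake r : coefs_in A r -> coefs_in A (take_poly j r).
  by move=> Ar i; rewrite coef_take_poly; case: ifP => // _; apply: (subalg0 sA).
have Adrop r : coefs_in A r -> coefs_in A (drop_poly j r).
  by move=> Ar i; rewrite coef_drop_poly.
have pE : (drop_poly j p).[f] * f ^+ j = - (take_poly j p).[f].
  apply/eqP; rewrite -subr_eq0 opprK addrC -hornerXn -hornerM -hornerD.
  by rewrite poly_take_drop pf.
exists (drop_poly j p * take_poly j q - drop_poly j q * take_poly j p); split.
- by apply: (coefs_inD sA); [|apply: (coefs_inN sA)]; apply: (coefs_inM sA); auto.
- rewrite (leq_trans (size_polyD _ _))// size_polyN geq_max.
  have [tq tp] := (size_take_poly j q, size_take_poly j p).
  have arith (a b c : nat) : (j <= c -> a <= j -> b <= c -> (b - j + a).-1 <= c)%N.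
    by lia.
  apply/andP; split; apply: leq_trans (size_polyMleq _ _) _;
    rewrite size_drop_poly; last exact: arith.
  by move: jm tq; rewrite /m; case: (size p) => [|r]; lia.
- rewrite -{1}(poly_take_drop j q) !(hornerD, hornerM, hornerN, hornerXn) mulrDr.
  by rewrite [_ * (_ * _)]mulrCA pE mulrN.
Qed.

Lemma drop_polyS (p : {poly K}) j f :
  (drop_poly j p).[f] = (drop_poly j.+1 p).[f] * f + p`_j.
Proof.
rewrite -hornerMXaddC; congr _.[f]; apply/polyP => i.
by rewrite coefD coefMX coefC !coef_drop_poly; case: i => [|i] /=;
  rewrite ?add0r ?addr0 ?addSnnS.
Qed.

End IntegralElements.

Section EssentiallyFiniteType.
Variables (k : closedFieldType) (K : fieldType) (iota : {rmorphism k -> K}).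
Hypothesis char0 : [pchar K] =i pred0.
Variables (w : K -> int) (s t : seq K) (u : K).
Local Notation gen := (alg_gen iota).
Local Notation R := (gen [set` u :: s]).
Local Notation F := (fractions R).
Local Notation D0 := (val_subring w F).
Hypotheses (wV : int_valuation iota w) (rs : residually_independent iota w s).
Hypotheses (u0 : u != 0) (wu : w u = 1).
Hypothesis Ralg : forall z, algebraic_over R z.
Hypothesis tK : forall f, fractions (gen [set` t]) f.
Implicit Types (f g z : K) (p q : {poly K}).

Let sV : subalgebra iota (val_ge w 0). Proof. exact: (val_ring_subalg wV). Qed.
Let sR : subalgebra iota R. Proof. exact: alg_gen_subalg. Qed.
Let sF : subalgebra iota F. Proof. exact: (fractions_subalg sR). Qed.
Let FV f : F f -> F f^-1. Proof. exact: (fractionsV sR). Qed.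
Let sD : subalgebra iota D0. Proof. exact: (val_subring_subalg wV sF). Qed.
Let Ru : R u. Proof. exact: alg_gen_cons_head. Qed.

(** On k[s][u] the valuation is the u-adic one: once the largest power of u is taken out, the
    constant coefficient is a nonzero element of k[s], hence a unit. *)
Lemma residual_ring_factor f : R f -> f != 0 ->
  exists l g, [/\ R g, g != 0, w g = 0 & f = u ^+ l * g].
Proof.
move=> /alg_gen_cons[p sp ->] {f}.
have sDD := residually_independent_sub wV rs.
elim/poly_ind: p sp => [|p c IHp] sp; first by rewrite horner0 eqxx.
have sp' : coefs_in (gen [set` s]) p.
  by move=> i; have := sp i.+1; rewrite coefD coefMX coefC addr0.
have sc : gen [set` s] c.
  by have := sp 0%N; rewrite coefD coefMX coefC add0r.
have [->|c0] := eqVneq c 0.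
  rewrite addr0 hornerMX mulf_eq0 negb_or => /andP[pu0 _].
  have [l [g [Rg g0 wg ->]]] := IHp sp' pu0; exists l.+1, g; split=> //.
  by rewrite exprSr; ring.
move=> _; exists 0%N, (p * 'X + c%:P).[u].
have [] := @val_unit_part _ _ _ _ wV (p * 'X + c%:P) u.
- by move=> i; apply: sDD.
- by right; rewrite wu.
- by rewrite coefD coefMX coefC add0r.
- rewrite coefD coefMX coefC add0r; exact: (residually_independent_val wV rs sc).
move=> ? ?; split=> //; last by rewrite expr0 mul1r.
by apply/alg_gen_cons; exists (p * 'X + c%:P).
Qed.

Lemma residual_ring_val f : R f -> val_ge w 0 f.
Proof.
apply: alg_gen_min => // x /=; rewrite inE => /orP[/eqP->|xs].
  by right; rewrite wu.
by apply: (residually_independent_sub wV rs); apply: alg_gen_in.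
Qed.

Lemma val_subring_frac f : D0 f ->
  exists a b, [/\ R a, R b, b != 0, w b = 0 & f = a / b].
Proof.
move=> [[a [b [Ra Rb b0 ->]]]]; have [->|a0] := eqVneq a 0.
  move=> _; exists 0, 1; split; rewrite ?mul0r ?oner_eq0//.
  - exact: (subalg0 sR).
  - exact: (subalg1 sR).
  - exact: (val1 wV).
have [l [a' [Ra' a'0 wa' ->]]] := residual_ring_factor Ra a0.
have [m [b' [Rb' b'0 wb' ->]]] := residual_ring_factor Rb b0.
have u1 j : u ^+ j != 0 by rewrite expf_neq0.
rewrite val_geE ?mulf_neq0 ?invr_neq0 ?mulf_neq0// (val_div wV) ?mulf_neq0//.
rewrite !(valM wV)// !(valXn wV)// wu wa' wb' => lm.
exists (u ^+ (l - m) * a'), b'; split=> //.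
  by apply: (subalgM sR) => //; apply: (subalgX _ sR).
have -> : u ^+ l = u ^+ (l - m) * u ^+ m by rewrite -exprD subnK//; lia.
by field; rewrite b'0 u1.
Qed.

Lemma sub_val_subring : R `<=` D0.
Proof.
by move=> f Rf; split; [apply: (sub_fractions sR)|apply: residual_ring_val].
Qed.

(** For an equation of degree m with leading coefficient a, the product a f is the Horner tail of
    index m-1 minus a coefficient, and both stabilize the module. *)
Lemma integral_multiple f : exists m y a,
  [/\ (0 < m)%N, D0 a, a != 0, stabilizes D0 f m y & y = a * f].
Proof.
have [p [p0 Rp pf]] := Ralg f.
have Dp : coefs_in D0 p by move=> i; apply: sub_val_subring.
pose m := (size p).-1; have m0 : (0 < m)%N.
  rewrite lt0n; apply: contraNneq p0 => m0.
  have /size1_polyC pC : (size p <= 1)%N by move: m0; rewrite /m; lia.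
  by move: pf; rewrite pC hornerC => ->.
exists m, (lead_coef p * f), (lead_coef p).
split=> //; [exact: Dp|by rewrite lead_coef_eq0|].
have -> : lead_coef p * f = (drop_poly m.-1 p).[f] - p`_m.-1.
  rewrite drop_polyS prednK// addrK drop_polyS mulrDl.
  rewrite (drop_poly_eq0 (_ : size p <= m.+1)%N) ?horner0 ?mul0r ?add0r//.
  by rewrite /m; lia.
apply: (stabilizesD sD) => //; first by apply: (stabilizes_drop sD) => //; exact: leq_pred.
exact/(stabilizesC sD)/(subalgN sD).
Qed.

(* Divide an equation of f over R by a coefficient of minimal value, and let j
   be the largest index of a unit coefficient: the part above degree j,
   divided by f^j, is a unit y such that y and y f are integral. *)
Lemma integral_fraction f : val_ge w 0 f -> exists m y,
  [/\ (0 < m)%N, y != 0, w y = 0, stabilizes D0 f m y & stabilizes D0 f m (y * f)].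
Proof.
move=> f0; have [p [p0 Dp pf [i [pi0 wpi]]]] : exists p, [/\ p != 0,
    coefs_in D0 p, p.[f] = 0 & exists i, p`_i != 0 /\ w p`_i = 0].
  have [p [p0 Rp pf]] := Ralg f.
  pose Q j := `[< exists i, p`_i != 0 /\ w p`_i = j%:Z >].
  have QE i : p`_i != 0 -> exists2 j, Q j & w p`_i = j%:Z.
    move=> pi0; have := residual_ring_val (Rp i); rewrite val_geE// => wpi.
    by exists (absz (w p`_i)); [apply/asboolP; exists i; split=> //|]; lia.
  have exQ : exists j, Q j.
    by have [|j Qj _] := QE (size p).-1; [rewrite -lead_coefE lead_coef_eq0|exists j].
  case: (ex_minnP exQ) => j /asboolP[i [pi0 wpi]] jmin.
  have Fp l : F p`_l by apply: (sub_fractions sR).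
  exists ((p`_i)^-1 *: p); split.
  - by rewrite scaler_eq0 negb_or invr_eq0 pi0.
  - move=> l; rewrite coefZ mulrC; apply: (val_subring_div wV) => //.
    have [->|pl0] := eqVneq p`_l 0; first by left.
    by right; have [r /jmin jr ->] := QE _ pl0; rewrite wpi; lia.
  - by rewrite hornerZ pf mulr0.
  - by exists i; rewrite coefZ mulVf// (val1 wV) oner_neq0.
pose Q j := (p`_j != 0) && (w p`_j == 0).
have exQ : exists j, Q j by exists i; rewrite /Q pi0 wpi eqxx.
have Qm j : Q j -> (j <= (size p).-1)%N.
  case/andP=> pj _; have : (j < size p)%N.
    by rewrite ltnNge; apply: contra pj => /(nth_default 0)->.
  lia.
case: (ex_maxnP exQ Qm) => j Qj jmax; have jm := Qm j Qj.
case/andP: Qj => pj0 /eqP wpj; set y := (drop_poly j p).[f].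
(* The coefficients of index above j have positive value by the choice of j, so y is p_j plus an
   element of positive value. *)
have [y0 wy] : y != 0 /\ w y = 0.
  rewrite /y drop_polyS addrC -wpj; apply: (val_add_gt wV) => //.
  rewrite wpj add0r -[X in val_ge w X]addr0; apply: (val_geM wV) => //.
  rewrite horner_coef; apply: (val_ge_sum wV) => l _; rewrite -[X in val_ge w X]addr0.
  apply: (val_geM wV); last exact: (subalgX _ sV).
  rewrite coef_drop_poly; have [_] := Dp (l + j.+1)%N.
  have [->|pl0] := eqVneq p`_(l + j.+1) 0; first by left.
  rewrite !val_geE// le_eqVlt => /orP[/eqP wl|]; last by rewrite gtz0_ge1.
  have /jmax : Q (l + j.+1)%N by rewrite /Q pl0 -wl eqxx.
  by rewrite addnS ltnNge leq_addl.
(* The index is positive, as for index 0 the unit y would be p(f) = 0. The Horner tail of the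
   preceding index then expresses y f. *)
case: j => [|j] in jm y y0 wy jmax pj0 wpj *.
  by move: y0; rewrite /y drop_poly0l pf eqxx.
exists (size p).-1, y; split=> //; first by lia.
  exact: (stabilizes_drop sD).
have -> : y * f = (drop_poly j p).[f] - p`_j by rewrite drop_polyS addrK.
apply: (stabilizesD sD) => //; first by apply: (stabilizes_drop sD) => //; lia.
exact/(stabilizesC sD)/(subalgN sD).
Qed.

(** Power-bounded elements of the valuation ring have coordinates with uniformly bounded
    denominators, so they lie in a module with n generators over the valuation ring of F. Every f in
    the valuation ring is a quotient (y f)/y of two of them with y a unit. *)
Theorem valuation_ring_essentially_finite_type : exists L : seq K,
  (forall x, x \in L -> val_ge w 0 x) /\ forall f, val_ge w 0 f ->
    exists a b, [/\ gen [set` L] a, gen [set` L] b, b != 0, w b = 0 & f = a / b].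
Proof.
have Falg z : algebraic_over F z.
  by apply: algebraic_overW (Ralg z); apply: sub_fractions.
have [n [e [eK efree]]] := finite_extension_basis sF FV Falg tK.
pose co := coordinates eK.
(* All powers of y, applied to the element 1 of the module, are D0-combinations of 1, f, ...,
   f^(m-1), so a bound for these m coordinate vectors serves every power. *)
have stab_pb f m y : (0 < m)%N -> stabilizes D0 f m y ->
    power_bounded w eK y.
  move=> m0 fy; have [b bE] := val_bounded w
    (fun ij : 'I_m * 'I_n => co (f ^+ ij.1) 0 ij.2).
  exists b => l i; have [q [Dq qm ->]] : exists q, [/\ coefs_in D0 q,
      (size q <= m)%N & y ^+ l = q.[f]].
    elim: l => [|l [q [Dq qm qE]]].
      exists 1%:P; rewrite hornerC expr0 size_polyC oner_neq0; split=> //.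
      by apply: (coefs_inC sD); apply: (subalg1 sD).
    by rewrite exprS qE; have [q' []] := fy q Dq qm; exists q'.
  rewrite (horner_coef_wide _ qm) (coordinates_sum sF eK efree) summxE.
  apply: (val_ge_sum wV) => j _; have [Fq q0] := Dq j.
  rewrite (coordinatesZ sF eK efree)// mxE -[- _]add0r; apply: (val_geM wV) => //.
  exact: (bE (j, i)).
have [|m mE] := power_bounded_coordinates char0 wV sF FV (e_span := eK)
    efree u0 (sub_fractions sR Ru) wu.
  move=> i; have [m [y [a [m0 Da a0 fy yE]]]] := integral_multiple (e i).
  by exists a; split=> //; [case: Da|rewrite -yE; apply: stab_pb fy].
pose vec (c : 'rV[K]_n) := \sum_i c 0 i * e i.
pose P := [set c : 'rV[K]_n | (forall i, F (c 0 i) /\ val_ge w (- m%:Z) (c 0 i)) /\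
  val_ge w 0 (vec c)].
have [|c d [Fc Pc] [Fd Pd]|a c [Fa a0] [Fc Pc]|c i [Fc _]|G [PG Gspan]] :=
    @lattice_basis _ _ _ _ _ wV sF FV n P m.
- split=> [i|]; first by rewrite mxE; split; [apply: (subalg0 sF)|left].
  by left; apply: big1 => i _; rewrite mxE mul0r.
- split=> [i|].
    have [Fci mci] := Fc i; have [Fdi mdi] := Fd i.
    by rewrite mxE; split; [apply: (subalgD sF)|apply: (val_geD wV)].
  by rewrite /vec vecD; apply: (val_geD wV).
- split=> [i|].
    have [Fci mci] := Fc i; rewrite mxE; split; first exact: (subalgM sF).
    by rewrite -[- _]add0r; apply: (val_geM wV).
  by rewrite /vec vecZ; apply: (subalgM sV).
- exact: Fc.
(* The generators [u :: s] account for D0 as a ring of fractions, the rows of [G] for the lattice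
   over D0. *)
pose L := (u :: s) ++ [seq vec (row i G) | i <- enum 'I_n].
exists L; split=> [x|f f0].
  rewrite mem_cat => /orP[xs|/mapP[i _ ->]]; last by case: (PG i).
  by apply: residual_ring_val; apply: alg_gen_in.
pose H := [set g | exists a b,
  [/\ gen [set` L] a, gen [set` L] b, b != 0, w b = 0 & g = a / b]].
have sL : subalgebra iota (gen [set` L]) by [].
have sH : subalgebra iota H.
  split=> [c|_ _ [a [b [La Lb b0 wb ->]]] [a' [b' [La' Lb' b'0 wb' ->]]]|
    _ _ [a [b [La Lb b0 wb ->]]] [a' [b' [La' Lb' b'0 wb' ->]]]].
  - exists (iota c), 1; split; rewrite ?divr1 ?oner_eq0//; first by case: sL.
      exact: (subalg1 sL).
    exact: (val1 wV).
  - exists (a * b' + a' * b), (b * b'); split; last by field; rewrite b0 b'0.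
    + by apply: (subalgD sL); apply: (subalgM sL).
    + exact: (subalgM sL).
    + by rewrite mulf_neq0.
    + by rewrite (valM wV)// wb wb' addr0.
  - exists (a * a'), (b * b'); split; last by field; rewrite b0 b'0.
    + exact: (subalgM sL).
    + exact: (subalgM sL).
    + by rewrite mulf_neq0.
    + by rewrite (valM wV)// wb wb' addr0.
have RL : R `<=` gen [set` L].
  by apply: alg_gen_sub => x /= xs; rewrite mem_cat xs.
have DH : D0 `<=` H.
  move=> g /val_subring_frac[a [b [Ra Rb b0 wb ->]]].
  by exists a, b; split=> //; apply: RL.
have int_H z : power_bounded w eK z -> val_ge w 0 z -> H z.
  move=> zb z0; have [|d [Dd dE]] := Gspan (co z).
    split=> [i|]; last by rewrite /vec vecK.
    by split; [apply: coordinatesP|apply: mE].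
  have -> : z = \sum_i d 0 i * vec (row i G).
    rewrite -[LHS](vecK eK) -/co dE.
    under [RHS]eq_bigr do rewrite mulr_sumr; rewrite exchange_big /=.
    apply: eq_bigr => j _; rewrite mxE mulr_suml; apply: eq_bigr => i _.
    by rewrite mxE mulrA.
  elim/big_ind: _ => [|x y|i _]; [exact: (subalg0 sH)|exact: (subalgD sH)|].
  apply: (subalgM sH); first exact/DH.
  exists (vec (row i G)), 1; split; rewrite ?divr1 ?oner_eq0//.
  - apply: alg_gen_in => /=; rewrite mem_cat; apply/orP; right.
    by apply: map_f; rewrite mem_enum.
  - exact: (subalg1 sL).
  - exact: (val1 wV).
have [m' [y [m'0 y0 wy fy fyf]]] := integral_fraction f0.
have yv : val_ge w 0 y by right; rewrite wy.
have [a [b [La Lb b0 wb yE]]] := int_H y (stab_pb _ _ _ m'0 fy) yv.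
have [c [d [Lc Ld d0 wd yfE]]] := int_H _ (stab_pb _ _ _ m'0 fyf) (subalgM sV yv f0).
have a0 : a != 0 by apply: contraNneq y0 => a0; rewrite yE a0 mul0r.
exists (c * b), (d * a); split.
- exact: (subalgM sL).
- exact: (subalgM sL).
- by rewrite mulf_neq0.
- rewrite (valM wV)// wd add0r.
  by move: wy; rewrite yE (val_div wV)// wb subr0.
- have -> : f = (y * f) / y by rewrite mulrAC divff// mul1r.
  by rewrite yfE yE; field; rewrite b0 a0 d0.
Qed.

End EssentiallyFiniteType.

(** * Noetherian subalgebras *)

Section Ideals.
Variables (k : closedFieldType) (K : fieldType) (iota : {rmorphism k -> K}).
Implicit Types (A I G : set K) (f g x : K) (p q : {poly K}).

Lemma ideal_gen_ideal A G : subalgebra iota A -> G `<=` A ->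
  ideal A (ideal_gen A G).
Proof.
move=> sA GA; split=> [f|I [[]]//|f g If Ig J JI|a f Aa If J JI].
- apply; split=> //; split=> //; [exact: (subalg0 sA)|move=> ? ?; exact: (subalgD sA)|].
  by move=> ? ?; apply: (subalgM sA).
- by case: (JI) => -[_ _ JD _] _; apply: JD; [apply: If|apply: Ig].
- by case: (JI) => -[_ _ _ JM] _; apply: JM => //; apply: If.
Qed.

Lemma ideal_gen_in A G f : G f -> ideal_gen A G f.
Proof. by move=> Gf I [_]; apply. Qed.

Lemma ideal_gen_min A G I : ideal A I -> G `<=` I -> ideal_gen A G `<=` I.
Proof. by move=> AI GI f; apply. Qed.

Lemma ideal_gen_sub A G G' : G `<=` G' -> ideal_gen A G `<=` ideal_gen A G'.
Proof. by move=> GG f Gf I [AI G'I]; apply: Gf; split=> // g /GG/G'I. Qed.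

Lemma idealN A I f : subalgebra iota A -> ideal A I -> I f -> I (- f).
Proof.
move=> sA [_ _ _ IM] If; rewrite -mulN1r; apply: IM => //.
by apply: (subalgN sA); apply: (subalg1 sA).
Qed.

Lemma ideal_gen_lincomb A (N : nat) (a : nat -> K) f : subalgebra iota A ->
  (forall i, A (a i)) -> ideal_gen A [set a i | i in [set i | (i < N)%N]] f ->
  exists c : nat -> K, (forall i, A (c i)) /\ f = \sum_(i < N) c i * a i.
Proof.
move=> sA Aa; apply: (ideal_gen_min (I := [set f | exists c : nat -> K,
  (forall i, A (c i)) /\ f = \sum_(i < N) c i * a i])) => [|_ [i /= iN <-]].
  split=> [_ [c [Ac ->]]||_ _ [c [Ac ->]] [d [Ad ->]]|b _ Ab [c [Ac ->]]].
  - by elim/big_ind: _ => [|? ?|? _]; [exact: (subalg0 sA)|exact: (subalgD sA)|exact: (subalgM sA)].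
  - exists (fun=> 0); split=> [i|]; first exact: (subalg0 sA).
    by rewrite big1// => i _; rewrite mul0r.
  - exists (fun i => c i + d i); split=> [i|]; first exact: (subalgD sA).
    by rewrite -big_split; apply: eq_bigr => i _; rewrite mulrDl.
  - exists (fun i => b * c i); split=> [i|]; first exact: (subalgM sA).
    by rewrite mulr_sumr; apply: eq_bigr => i _; rewrite mulrA.
exists (fun j => (j == i)%:R); split=> [j|]; first exact: (subalg_nat _ sA).
rewrite (bigD1 (Ordinal iN))//= eqxx mul1r big1 ?addr0// => j ji.
by have /negPf -> : (j : nat) != i; rewrite ?mul0r.
Qed.

Definition noetherian A := forall I, ideal A I ->
  exists s : seq K, [set` s] `<=` I /\ I `<=` ideal_gen A [set` s].

Lemma noetherian_stationary A (a : nat -> K) : subalgebra iota A ->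
  noetherian A -> (forall i, A (a i)) ->
  exists N, ideal_gen A [set a i | i in [set i | (i < N)%N]] (a N).
Proof.
move=> sA nA Aa; pose J N := ideal_gen A [set a i | i in [set i | (i < N)%N]].
have JA N : ideal A (J N) by apply: ideal_gen_ideal => // _ [i _ <-].
have Jle M N : (M <= N)%N -> J M `<=` J N.
  by move=> MN; apply: ideal_gen_sub => _ [i /= iM <-]; exists i => //=; apply: leq_trans MN.
have [|s [sJ Js]] := nA (\bigcup_N J N).
  split=> [f [N _]||f g [M _ fM] [N _ gN]|b f Ab [N _ fN]].
  - by case: (JA N) => + _ _ _; apply.
  - by exists 0%N => //; case: (JA 0%N).
  - exists (maxn M N) => //; case: (JA (maxn M N)) => _ _ + _; apply.
      by apply: Jle fM; rewrite leq_maxl.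
    by apply: Jle gN; rewrite leq_maxr.
  - by exists N => //; case: (JA N) => _ _ _; apply.
have [N sN] : exists N, [set` s] `<=` J N.
  elim: s sJ {Js} => [|x s IHs] sJ; first by exists 0%N => f.
  have [|M sM] := IHs; first by move=> f /= fs; apply: sJ; rewrite /= inE fs orbT.
  have [|N _ xN] := sJ x; first by rewrite /= mem_head.
  exists (maxn M N) => f /=; rewrite inE => /orP[/eqP->|/sM].
    by apply: Jle xN; rewrite leq_maxr.
  by apply: Jle; rewrite leq_maxl.
exists N; apply: (ideal_gen_min (JA N) sN); apply: Js.
by exists N.+1 => //; apply: ideal_gen_in; exists N => /=.
Qed.

(* Among the polynomials of an ideal I not in the ideal generated by the
   previous ones, choose one of minimal degree; a relation between the leading
   coefficients then contradicts minimality. *)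
Lemma noetherian_adjoin A x : subalgebra iota A -> noetherian A ->
  noetherian [set f | exists2 p, coefs_in A p & f = p.[x]].
Proof.
move=> sA nA I; set B := [set f | _] => BI; apply: contrapT => nofg.
have sB : subalgebra iota B by apply: subalg_horners.
have [IB I0 ID IM] := BI.
pose S p := coefs_in A p /\ I p.[x].
pose ev (l : seq {poly K}) := [set` [seq p.[x] | p <- l]].
have next (l : seq {poly K}) : exists p, (forall q, q \in l -> S q) ->
    [/\ S p, ~ ideal_gen B (ev l) p.[x] & forall q, S q ->
      ~ ideal_gen B (ev l) q.[x] -> (size p <= size q)%N].
  (* The premise is kept under the existential so that [choice] yields a function on all lists;
     lists outside of [S] get the default 0. *)
  have [lS|] := pselect (forall q, q \in l -> S q); last by exists 0.
  pose Q j := `[< exists p, [/\ S p, ~ ideal_gen B (ev l) p.[x] & size p = j] >].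
  have exQ : exists j, Q j.
    apply: contrapT => noQ; apply: nofg; exists [seq p.[x] | p <- l]; split.
      by move=> _ /mapP[p /lS[_ ?] ->].
    move=> f If; have [p Ap fE] := IB _ If; apply: contrapT => nf.
    apply: noQ; exists (size p); apply/asboolP; exists p; split=> //.
      by split=> //; rewrite -fE.
    by rewrite -fE.
  case: (ex_minnP exQ) => j /asboolP[p [Sp np pj]] jmin; exists p => _.
  split=> // q Sq nq; rewrite pj; apply: jmin; apply/asboolP; by exists q.
have /choice[nx nxP] := next.
pose L := fix L n := if n is n'.+1 then nx (L n') :: L n' else [::].
pose P n := nx (L n).
have LS n q : q \in L n -> S q.
  elim: n q => // n IHn q; rewrite /= inE => /orP[/eqP->|]; last exact: IHn.
  by have [] := nxP (L n) IHn.
have PP n := nxP (L n) (LS n).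
have LP n i : (i < n)%N -> P i \in L n.
  elim: n => // n IHn; rewrite ltnS leq_eqVlt /= inE => /orP[/eqP->|/IHn->].
    by rewrite eqxx.
  by rewrite orbT.
have Lsub m n : (m <= n)%N -> ev (L m) `<=` ev (L n).
  move=> mn; elim: n mn => [|n IHn]; first by rewrite leqn0 => /eqP ->.
  rewrite leq_eqVlt ltnS => /orP[/eqP-> //|/IHn mn] f /mn /= fn.
  by rewrite /ev /= inE fn orbT.
have Pmono m n : (m <= n)%N -> (size (P m) <= size (P n))%N.
  move=> mn; have [_ _ mmin] := PP m; have [Sn nn _] := PP n.
  apply: mmin => // mm; apply: nn; apply: ideal_gen_sub mm; exact: Lsub.
have PS i : coefs_in A (P i) by have [[]] := PP i.
have Al i : A (lead_coef (P i)) by apply: PS.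
have [N] := noetherian_stationary sA nA Al.
move=> /(ideal_gen_lincomb sA Al)[c [Ac lE]].
have [[AN IN] nN Nmin] := PP N.
(* T has the leading term of P_N and its value lies in the ideal of the earlier choices, so P_N - T
   would be a smaller admissible choice. *)
pose T := \sum_(i < N) (c i)%:P * (P i * 'X^(size (P N) - size (P i))).
have AT : coefs_in A T.
  rewrite /T; elim/big_ind: _ => [|? ?|i _]; [exact: (coefs_in0 sA)|exact: (coefs_inD sA)|].
  apply: (coefs_inM sA); first exact: (coefs_inC sA).
  move=> j; rewrite coefMXn; case: ifP => _; first exact: (subalg0 sA).
  exact: PS.
have PN0 : P N != 0.
  apply/eqP => PN; apply: nN; rewrite -/(P N) PN horner0.
  by case: (ideal_gen_ideal sB (_ : ev (L N) `<=` B)) => // _ /mapP[p /LS[_ /IB] Bp ->].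
have sT i : (i < N)%N -> size (P i * 'X^(size (P N) - size (P i))) = size (P N).
  move=> iN; have Pi0 : P i != 0.
    apply/eqP => Pi; have [_ + _] := PP i; apply; rewrite -/(P i) Pi horner0.
    by case: (ideal_gen_ideal sB (_ : ev (L i) `<=` B)) => // _ /mapP[p /LS[_ /IB] Bp ->].
  by rewrite size_mulXn// subnK// Pmono// ltnW.
have evB n : ev (L n) `<=` B by move=> _ /mapP[p /LS[_ /IB] Bp ->].
have IT : ideal_gen B (ev (L N)) T.[x].
  have [_ J0 JD JM] := ideal_gen_ideal sB (evB N).
  rewrite horner_sum; elim/big_ind: _ => [||i _]; [exact: J0|exact: JD|].
  rewrite !hornerM hornerXn mulrCA mulrC; apply: JM.
    apply: (subalgM sB).
      exists (c i)%:P; [exact: (coefs_inC sA)|by rewrite hornerC].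
    apply: (subalgX _ sB); exists 'X; [exact: (coefs_inX sA)|by rewrite hornerX].
  by apply: ideal_gen_in; apply: map_f; apply: LP.
have : (size (P N - T)%R < size (P N))%N.
  apply: size_sub_lt => //.
    rewrite /T; elim/big_ind: _ => [|p q sp sq|i _]; first by rewrite size_poly0.
      by rewrite (leq_trans (size_polyD _ _))// geq_max sp.
    by rewrite mul_polyC (leq_trans (size_scale_leq _ _))// sT.
  rewrite lE /T coef_sum; apply: eq_bigr => i _.
  rewrite coefCM coefMXn -(sT i)//; congr (_ * _); rewrite sT//.
  have Pi0 : (0 < size (P i))%N.
    have := sT i (ltn_ord i); case: (eqVneq (P i) 0) => [->|]; last by rewrite size_poly_gt0.
    by rewrite mul0r size_poly0 => /esym/eqP; rewrite size_poly_eq0 (negPf PN0).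
  have PiN := Pmono i N (ltnW (ltn_ord i)).
  rewrite ifF; last by apply/negbTE; rewrite -leqNgt; lia.
  by rewrite lead_coefE; congr (_`_ _); lia.
rewrite ltnNge => /negP; apply; apply: Nmin.
  split; first by apply: (coefs_inD sA) => //; apply: (coefs_inN sA).
  rewrite hornerD hornerN; apply: ID => //; apply: (idealN sB BI).
  by apply: (ideal_gen_min BI) IT => _ /mapP[p /LS[_ Ip] ->].
move=> IPT; apply: nN; rewrite -/(P N) -[(P N).[x]](subrK T.[x]) -hornerN -hornerD.
by have [_ _ JD _] := ideal_gen_ideal sB (evB N); apply: JD.
Qed.

Theorem alg_gen_noetherian (t : seq K) : noetherian (alg_gen iota [set` t]).
Proof.
elim: t => [|x t IHt].
  move=> I AI; have [AI' I0 ID IM] := AI.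
  have [[f [If f0]]|no] := pselect (exists f, I f /\ f != 0); last first.
    exists [::]; split=> // f If; have -> : f = 0.
      by apply/eqP/negPn/negP => f0; apply: no; exists f.
    by move=> J [[]].
  exists [:: f]; split=> [g /=|g Ig]; first by rewrite inE => /eqP ->.
  have [c fE] := alg_gen_nil (AI' _ If).
  have sG := alg_gen_subalg iota [set` ([::] : seq K)].
  have [|_ _ _ JM] := ideal_gen_ideal sG (_ : [set` [:: f]] `<=` _).
    by move=> h /=; rewrite inE => /eqP ->; apply: AI'.
  rewrite -(divfK f0 g); apply: JM; last first.
    by apply: ideal_gen_in => /=; rewrite mem_head.
  apply: (subalgM sG); first exact: AI'.
  by rewrite fE -fmorphV; case: sG.
have <- : [set f | exists2 p, coefs_in (alg_gen iota [set` t]) p & f = p.[x]] =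
    alg_gen iota [set` x :: t].
  by apply/seteqP; split=> f /alg_gen_cons.
exact: noetherian_adjoin.
Qed.

End Ideals.

(** * Regular points *)

Section LocalRings.
Variables (k : closedFieldType) (K : fieldType) (iota : {rmorphism k -> K}).
Implicit Types (A M O : set K) (f g x : K) (p q : {poly K}).

Lemma localize_subalg A M : subalgebra iota A -> prime_ideal A M ->
  subalgebra iota (localize A M).
Proof.
move=> sA [[MA M0 MD MM] M1 Mp].
have s0 s : A s -> ~ M s -> s != 0 by move=> _ Ms; apply: contra_notN Ms => /eqP->.
have ss s t : A s -> ~ M s -> A t -> ~ M t -> ~ M (s * t).
  by move=> As Ms At Mt /(Mp _ _ As At)[].
split=> [c|_ _ [a [s [Aa As Ms ->]]] [b [t [Ab At Mt ->]]]|
  _ _ [a [s [Aa As Ms ->]]] [b [t [Ab At Mt ->]]]].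
- exists (iota c), 1; split; rewrite ?divr1//; first by case: sA.
  exact: (subalg1 sA).
- exists (a * t + b * s), (s * t); split; [|exact: (subalgM sA)|exact: ss|].
    by apply: (subalgD sA); apply: (subalgM sA).
  by field; rewrite !s0.
- exists (a * b), (s * t); split; [exact: (subalgM sA)|exact: (subalgM sA)|exact: ss|].
  by field; rewrite !s0.
Qed.

Lemma sub_localize A M : subalgebra iota A -> ~ M 1 -> A `<=` localize A M.
Proof.
by move=> sA M1 f Af; exists f, 1; split; rewrite ?divr1//; apply: (subalg1 sA).
Qed.

Lemma localizeV A M s : subalgebra iota A -> A s -> ~ M s -> localize A M s^-1.
Proof.
by move=> sA As Ms; exists 1, s; split; rewrite ?div1r//; apply: (subalg1 sA).
Qed.

Lemma maximal_ideal_prime A M : subalgebra iota A -> maximal_ideal A M ->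
  prime_ideal A M.
Proof.
move=> sA [[MA M0 MD MM] M1 Mmax]; split=> // f g Af Ag Mfg.
have [Mf|nMf] := pselect (M f); first by left.
right; pose I := [set h | exists m a, [/\ M m, A a & h = m + a * f]].
have II : ideal A I.
  split=> [_ [m [a [Mm Aa ->]]]||_ _ [m [a [Mm Aa ->]]] [m' [a' [Mm' Aa' ->]]]|
    b _ Ab [m [a [Mm Aa ->]]]].
  - by apply: (subalgD sA); [apply: MA|apply: (subalgM sA)].
  - by exists 0, 0; split; rewrite ?mul0r ?addr0//; apply: (subalg0 sA).
  - exists (m + m'), (a + a'); split; [exact: MD|exact: (subalgD sA)|ring].
  - exists (b * m), (b * a); split; [exact: MM|exact: (subalgM sA)|ring].
have [[m [a [Mm Aa E]]]|nI1] := pselect (I 1).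
  have -> : g = g * m + a * (f * g) by rewrite -[LHS]mulr1 E; ring.
  by apply: MD; apply: MM.
case: nMf; rewrite -(Mmax I II nI1).
  by exists 0, 1; split; rewrite ?mul1r ?add0r//; apply: (subalg1 sA).
by move=> m Mm; exists m, 0; split; rewrite ?mul0r ?addr0//; apply: (subalg0 sA).
Qed.

(** The reduction of O onto its residue field k, as a total function on K whose values outside of O
    carry no meaning. *)
Definition residue_map O (ev : K -> k) := [/\ forall c, ev (iota c) = c,
  forall f g, O f -> O g -> ev (f + g) = ev f + ev g
  & forall f g, O f -> O g -> ev (f * g) = ev f * ev g].

Section ResidueMap.
Variables (O : set K) (ev : K -> k).
Hypotheses (sO : subalgebra iota O) (evO : residue_map O ev).

Lemma residueC c : ev (iota c) = c. Proof. by case: evO. Qed.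
Lemma residue0 : ev 0 = 0. Proof. by rewrite -(rmorph0 iota) residueC. Qed.
Lemma residue1 : ev 1 = 1. Proof. by rewrite -(rmorph1 iota) residueC. Qed.
Lemma residueD f g : O f -> O g -> ev (f + g) = ev f + ev g.
Proof. by case: evO => _ + _; apply. Qed.
Lemma residueM f g : O f -> O g -> ev (f * g) = ev f * ev g.
Proof. by case: evO => _ _; apply. Qed.

Lemma residueN f : O f -> ev (- f) = - ev f.
Proof.
move=> Of; apply/eqP; rewrite -addr_eq0 -residueD ?addNr ?residue0//.
exact: (subalgN sO).
Qed.

Lemma residue_sum (I : Type) (r : seq I) (P : pred I) (F : I -> K) :
  (forall i, O (F i)) -> ev (\sum_(i <- r | P i) F i) = \sum_(i <- r | P i) ev (F i).
Proof.
move=> OF; suff [] : O (\sum_(i <- r | P i) F i) /\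
  ev (\sum_(i <- r | P i) F i) = \sum_(i <- r | P i) ev (F i) by [].
elim/big_rec2: _ => [|i c f _ [Of <-]].
  by split; [exact: (subalg0 sO)|exact: residue0].
by split; [exact: (subalgD sO)|exact: residueD].
Qed.

Lemma residue_prod (I : Type) (r : seq I) (P : pred I) (F : I -> K) :
  (forall i, O (F i)) -> ev (\prod_(i <- r | P i) F i) = \prod_(i <- r | P i) ev (F i).
Proof.
move=> OF; suff [] : O (\prod_(i <- r | P i) F i) /\
  ev (\prod_(i <- r | P i) F i) = \prod_(i <- r | P i) ev (F i) by [].
elim/big_rec2: _ => [|i c f _ [Of <-]].
  by split; [exact: (subalg1 sO)|exact: residue1].
by split; [exact: (subalgM sO)|exact: residueM].
Qed.

Lemma subalg_det n (X : 'M[K]_n) : (forall i j, O (X i j)) -> O (\det X).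
Proof.
move=> OX; rewrite /determinant.
apply: (@subalg_sum _ _ iota O _ _ _ _ sO) => s _; apply: (subalgM sO).
  by apply/(subalgX _ sO)/(subalgN sO)/(subalg1 sO).
exact: (@subalg_prod _ _ iota O _ _ _ _ sO).
Qed.

Lemma residue_det n (X : 'M[K]_n) : (forall i j, O (X i j)) ->
  ev (\det X) = \det (map_mx ev X).
Proof.
move=> OX; have Osgn (b : bool) : O ((-1) ^+ b).
  by apply/(subalgX _ sO)/(subalgN sO)/(subalg1 sO).
have evsgn (b : bool) : ev ((-1) ^+ b) = (-1) ^+ b.
  case: b; rewrite ?expr0 ?expr1 ?residue1// residueN ?residue1//.
  exact: (subalg1 sO).
have Oprod (s : {perm 'I_n}) : O (\prod_i X i (s i)).
  exact: (@subalg_prod _ _ iota O _ _ _ _ sO).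
rewrite /determinant residue_sum; last by move=> s; apply: (subalgM sO).
apply: eq_bigr => s _; rewrite residueM// residue_prod// evsgn; congr (_ * _).
by apply: eq_bigr => i _; rewrite mxE.
Qed.

Lemma residue_unit f : nonunits O = [set f | O f /\ ev f = 0] -> O f ->
  ev f != 0 -> f != 0 /\ O f^-1.
Proof.
move=> mO Of evf; have f0 : f != 0.
  by apply: contraNneq evf => ->; rewrite residue0.
split=> //; have [[g Og fg]|nu] := pselect (exists2 g, O g & f * g = 1).
  by have -> : f^-1 = g by rewrite -[RHS]mul1r -(mulVf f0) -mulrA fg mulr1.
have : nonunits O f by split.
by rewrite mO => -[_ /eqP]; rewrite (negPf evf).
Qed.

End ResidueMap.

(** Elements outside of M become units, so they have nonzero residue. Conversely, if f in M had
    residue c nonzero, then c - f would have residue 0 and lie in M, and so would the unit c. *)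
Lemma localize_residue A M ev : subalgebra iota A -> prime_ideal A M ->
  residue_map (localize A M) ev ->
  M = [set f | A f /\ ev f = 0] /\
  nonunits (localize A M) = [set f | localize A M f /\ ev f = 0].
Proof.
move=> sA PM evO; set O := localize A M in evO *.
have [[MA M0 MD MM] M1 Mp] := PM.
have sO : subalgebra iota O by apply: localize_subalg.
have AO : A `<=` O by apply: sub_localize.
have unit_ev f : O f -> O f^-1 -> f != 0 -> ev f != 0.
  move=> Of Ofi f0; have := residueM evO Of Ofi.
  rewrite divff// (residue1 evO) => /eqP; apply: contraTneq => ->.
  by rewrite mul0r oner_eq0.
have notM s : A s -> ~ M s -> ev s != 0.
  move=> As Ms; apply: unit_ev; [exact: AO|exact: localizeV|].
  by apply: contra_notN Ms => /eqP->.
have ME : M = [set f | A f /\ ev f = 0].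
  apply/seteqP; split=> [f Mf|f [Af evf]]; last first.
    by apply: contrapT => /(notM _ Af); rewrite evf eqxx.
  have Af := MA _ Mf; split=> //; apply/eqP/negPn/negP => evf.
  apply: M1; suff : M (iota (ev f)).
    move/(MM (iota (ev f)^-1)); rewrite -rmorphM mulVf// rmorph1; apply.
    by case: sA.
  have Ac : A (iota (ev f)) by case: sA.
  have Of := AO _ Af; have Oc := AO _ Ac.
  have : ev (iota (ev f) - f) = 0.
    rewrite (residueD evO)//; last exact: (subalgN sO).
    by rewrite (residueN sO evO)// (residueC evO) subrr.
  have Acf : A (iota (ev f) - f) by apply: (subalgB sA).
  move=> evcf; rewrite -(subrK f (iota _)); apply: MD => //.
  by apply: contrapT => /(notM _ Acf); rewrite evcf eqxx.
split=> //; apply/seteqP; split=> [f [Of nu]|f [Of evf]].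
  split=> //; have [a [s [Aa As Ms fE]]] := Of.
  have s0 : s != 0 by apply: contra_notN Ms => /eqP->.
  have [Ma|Ma] := pselect (M a); last first.
    case: nu; have a0 : a != 0 by apply: contra_notN Ma => /eqP->.
    exists (s / a); first by exists s, a.
    by rewrite fE; field; rewrite s0 a0.
  have : ev (f * s) = 0 by rewrite fE divfK//; move: Ma; rewrite {1}ME => -[].
  rewrite (residueM evO)//; last exact: AO.
  by move/eqP; rewrite mulf_eq0 (negPf (notM _ As Ms)) orbF => /eqP.
split=> // -[g Og fg]; have := residueM evO Of Og.
by rewrite fg (residue1 evO) evf mul0r => /eqP; rewrite oner_eq0.
Qed.

End LocalRings.

Section RegularPoints.
Variables (k : closedFieldType) (K : fieldType) (iota : {rmorphism k -> K}).
Hypothesis char0 : [pchar K] =i pred0.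
Variables (a : seq K) (M : set K) (ev : K -> k) (n : nat) (x : 'I_n -> K).
Local Notation gen := (alg_gen iota).
Local Notation A := (gen [set` a]).
Local Notation O := (localize A M).
Local Notation r := (size a).
Hypotheses (aK : forall f, fractions A f) (PM : prime_ideal A M).
Hypotheses (evO : residue_map iota O ev) (xO : nonunits O = ideal_gen O (range x)).
Implicit Types (f g : K) (p q : {poly K}) (d : K -> K).

Let sA : subalgebra iota A. Proof. exact: alg_gen_subalg. Qed.
Let sO : subalgebra iota O. Proof. exact: localize_subalg. Qed.
Let AO : A `<=` O. Proof. by apply: (sub_localize sA); case: PM. Qed.
Let mO : nonunits O = [set f | O f /\ ev f = 0].
Proof. by have [] := localize_residue sA PM evO. Qed.

Lemma regular_parameterP i : O (x i) /\ ev (x i) = 0.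
Proof.
have : nonunits O (x i) by rewrite xO; apply: ideal_gen_in; exists i.
by rewrite mO.
Qed.
Let Ox i : O (x i). Proof. by have [] := regular_parameterP i. Qed.

Lemma regular_parameters_span f : O f -> ev f = 0 ->
  exists c : 'I_n -> K, (forall i, O (c i)) /\ f = \sum_i c i * x i.
Proof.
move=> Of evf; have : nonunits O f by rewrite mO.
rewrite xO; apply: (ideal_gen_min (I := [set f | exists c : 'I_n -> K,
  (forall i, O (c i)) /\ f = \sum_i c i * x i])) => [|_ [i _ <-]].
  split=> [_ [c [Oc ->]]||_ _ [c [Oc ->]] [c' [Oc' ->]]|b _ Ob [c [Oc ->]]].
  - by apply: (@subalg_sum _ _ iota O _ _ _ _ sO) => i _; apply: (subalgM sO).
  - exists (fun=> 0); split=> [i|]; first exact: (subalg0 sO).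
    by rewrite big1// => i _; rewrite mul0r.
  - exists (fun i => c i + c' i); split=> [i|]; first exact: (subalgD sO).
    by rewrite -big_split; apply: eq_bigr => i _; rewrite mulrDl.
  - exists (fun i => b * c i); split=> [i|]; first exact: (subalgM sO).
    by rewrite mulr_sumr; apply: eq_bigr => i _; rewrite mulrA.
exists (fun j => (j == i)%:R); split=> [j|]; first exact: (subalg_nat _ sO).
by rewrite (bigD1 i)//= eqxx mul1r big1 ?addr0// => j /negPf->; rewrite mul0r.
Qed.

(** The coefficients are chosen before d: they express the differential of f through those of the
    generators of A. *)
Lemma derivation_generators f : O f -> exists e : 'I_r -> K,
  (forall l, O (e l)) /\ forall d, derivation iota d ->
    d f = \sum_l e l * d a`_l.
Proof.
pose H := [set f | A f /\ exists e : 'I_r -> K, (forall l, A (e l)) /\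
  forall d, derivation iota d -> d f = \sum_l e l * d a`_l].
have AH : A `<=` H.
  apply: alg_gen_min => [|g /= ga].
    split=> [c|f1 g [Af [e [Ae eE]]] [Ag [e' [Ae' e'E]]]|
        f1 g [Af [e [Ae eE]]] [Ag [e' [Ae' e'E]]]].
    - split; first by case: sA.
      exists (fun=> 0); split=> [l|d [-> _ _]]; first exact: (subalg0 sA).
      by rewrite big1// => l _; rewrite mul0r.
    - split; first exact: (subalgD sA).
      exists (fun l => e l + e' l); split=> [l|d dd]; first exact: (subalgD sA).
      rewrite (derD _ _ dd) eE// e'E// -big_split.
      by apply: eq_bigr => l _; rewrite mulrDl.
    - split; first exact: (subalgM sA).
      exists (fun l => f1 * e' l + g * e l); split=> [l|d dd].
        by apply: (subalgD sA); apply: (subalgM sA).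
      rewrite (derM _ _ dd) eE// e'E// !mulr_sumr -big_split.
      by apply: eq_bigr => l _; rewrite mulrDl !mulrA.
  split; first exact: alg_gen_in.
  have gr : (index g a < r)%N by rewrite index_mem.
  exists (fun l => (l == Ordinal gr)%:R); split=> [l|d dd].
    exact: (subalg_nat _ sA).
  rewrite (bigD1 (Ordinal gr))//= eqxx mul1r nth_index// big1 ?addr0// => l.
  by move/negPf->; rewrite mul0r.
move=> [b [s [/AH[Ab [e [Ae eE]]] /AH[As [e' [Ae' e'E]]] Ms ->]]].
have s0 : s != 0 by apply: contra_notN Ms => /eqP->; case: PM => -[].
have Os := localizeV sA As Ms.
exists (fun l => s^-1 * e l - (b / s * s^-1) * e' l); split=> [l|d dd].
  apply: (subalgB sO); first by apply: (subalgM sO) => //; apply: AO.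
  apply: (subalgM sO); last exact: AO.
  by do 2![apply: (subalgM sO) => //]; apply: AO.
rewrite (der_div _ dd s0) eE// e'E//.
under [RHS]eq_bigr do rewrite mulrBl -!mulrA.
by rewrite sumrB -!mulr_sumr; field.
Qed.

(* Modulo the square of the maximal ideal, the differentials of the generators
   a of A are combinations of those of the x_i; this is Nakayama's lemma. *)
Lemma regular_differentials : exists B : 'M[K]_(r, n), (forall i j, O (B i j)) /\
  forall d, derivation iota d ->
    \col_(l < r) d a`_l = B *m \col_i d (x i).
Proof.
have cP (l : 'I_r) : exists c : 'I_n -> K, (forall i, O (c i)) /\
    a`_l - iota (ev a`_l) = \sum_i c i * x i.
  have Aa : A a`_l by apply: alg_gen_in => /=; apply: mem_nth.
  have Ac : O (iota (ev a`_l)) by case: sO.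
  apply: regular_parameters_span; first by apply: (subalgB sO) => //; apply: AO.
  rewrite (residueD evO) ?(residueN sO evO) ?(residueC evO) ?subrr//.
    exact: AO.
  exact: (subalgN sO).
have /choice[c cE] := cP.
have /choice[e eE] : forall li : 'I_r * 'I_n, exists e : 'I_r -> K,
    (forall l, O (e l)) /\ forall d, derivation iota d ->
      d (c li.1 li.2) = \sum_l e l * d a`_l.
  by move=> [l i]; apply: derivation_generators; apply: (cE l).1.
pose C := \matrix_(l < r, i < n) c l i.
pose E := \matrix_(l < r, j < r) \sum_i x i * e (l, i) j.
have OE l j : O (E l j) /\ ev (E l j) = 0.
  rewrite mxE; have Ot i : O (x i * e (l, i) j).
    by apply: (subalgM sO) => //; apply: (eE (l, i)).1.
  split; first exact: (@subalg_sum _ _ iota O _ _ _ _ sO).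
  rewrite (residue_sum sO evO)// big1// => i _.
  rewrite (residueM evO)//; last exact: (eE (l, i)).1.
  by rewrite (regular_parameterP i).2 mul0r.
(* The Leibniz rule applied to sum_i c_li x_i gives da = E da + C dx with E over the maximal ideal,
   so det(1 - E) has residue 1 and is invertible in O. *)
pose N : 'M[K]_r := 1%:M - E.
have O1 i j : O ((1%:M : 'M[K]_r) i j) by rewrite mxE; apply: (subalg_nat _ sO).
have ON i j : O (N i j).
  by rewrite mxE [X in _ + X]mxE; apply: (subalgB sO) => //; case: (OE i j).
have evN : ev (\det N) = 1.
  rewrite (residue_det sO evO)// -[RHS](det1 _ r); congr (\det _).
  apply/matrixP => i j; rewrite mxE mxE [X in _ + X]mxE.
  have [Oij evij] := OE i j.
  rewrite (residueD evO)//; last exact: (subalgN sO).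
  rewrite (residueN sO evO)// evij subr0 !mxE.
  by case: eqP; rewrite ?(residue1 evO) ?(residue0 evO).
have [dN0 ONi] : \det N != 0 /\ O (\det N)^-1.
  apply: (residue_unit evO mO); first exact: (subalg_det sO).
  by rewrite evN oner_eq0.
have NU : N \in unitmx by rewrite unitmxE unitfE.
exists (invmx N *m C); split=> [i j|d dd].
  rewrite mxE; apply: (@subalg_sum _ _ iota O _ _ _ _ sO) => l _.
  apply: (subalgM sO); last by rewrite mxE; apply: (cE l).1.
  rewrite /invmx NU mxE; apply: (subalgM sO) => //.
  rewrite mxE /cofactor; apply: (subalgM sO).
    by apply/(subalgX _ sO)/(subalgN sO)/(subalg1 sO).
  by apply: (subalg_det sO) => i' j'; rewrite !mxE;
    have := ON (lift l i') (lift i j'); rewrite !mxE.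
suff ND : N *m \col_(l < r) d a`_l = C *m \col_i d (x i).
  by rewrite -mulmxA -ND mulmxA mulVmx// mul1mx.
rewrite mulmxBl mul1mx; apply/matrixP => l j; rewrite !mxE.
have -> : d a`_l = d (a`_l - iota (ev a`_l)).
  by rewrite (derB _ _ dd); case: (dd) => -> _ _; rewrite subr0.
rewrite (cE l).2 (der_sum _ _ _ dd).
under eq_bigr do rewrite (derM _ _ dd).
rewrite big_split /= -addrA; apply/eqP; rewrite -subr_eq0; apply/eqP.
set S := \sum_i c l i * _; set S' := \sum_i C l i * _.
have -> : S' = S by apply: eq_bigr => i _; rewrite !mxE.
rewrite [S + _]addrC addrK; apply/eqP; rewrite subr_eq0; apply/eqP.
under [RHS]eq_bigr do rewrite !mxE mulr_suml.
rewrite exchange_big; apply: eq_bigr => i _ /=.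
rewrite (eE (l, i)).2// mulr_sumr; apply: eq_bigr => j' _.
by rewrite mulrA.
Qed.

(** Take y_i in P_(i+1) but not in P_i and add them from the top down; the invariant is that
    k[y_i, ..., y_(n-1)] meets P_i only in 0. If p(y_i) is in P_i, its constant coefficient lies in
    P_(i+1), hence vanishes, and the factor y_i can be cancelled as it is not in P_i. *)
Lemma prime_chain_transcendental : prime_chain O n ->
  exists2 s, size s = n & transcendental_seq iota s.
Proof.
move=> [P [PP Plt]].
have /choice[y yP] i : exists y, (i < n)%N -> P i.+1 y /\ ~ P i y.
  have [ni|] := ltnP i n; last by exists 0.
  have [_ nP] := Plt i ni; apply: contrapT => no; apply: nP => z Pz.
  by apply: contrapT => nz; apply: no; exists z.
pose s (m : nat) := [seq y i | i <- seq.iota (n - m) m].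
suff H m : (m <= n)%N -> transcendental_seq iota (s m) /\
    forall f, gen [set` s m] f -> P (n - m)%N f -> f = 0.
  by exists (s n); [rewrite size_map size_iota|have [] := H n (leqnn n)].
elim: m => [_|m IHm mn].
  split=> // f; rewrite /s /= => /alg_gen_nil[c ->]; rewrite subn0 => Pc.
  have [[_ _ _ PZ] P1 _] := PP n (leqnn n); apply/eqP/negPn/negP => c0.
  apply: P1; have := PZ (iota c^-1) _ _ Pc; rewrite -rmorphM mulVf.
    by rewrite rmorph1; apply; case: sO.
  by apply: contraNneq c0 => ->; rewrite rmorph0.
have [ts sP] := IHm (ltnW mn).
pose i := (n - m.+1)%N; have i1 : (n - m)%N = i.+1 by rewrite /i; lia.
have iin : (i < n)%N by rewrite /i; lia.
have sE : s m.+1 = y i :: s m by rewrite /s /= -/i i1.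
have [y1 y0] := yP i iin.
have PPi := PP i (ltnW iin); have [[PO P0 PD PZ] P1 Pp] := PPi.
have [[PO' P0' PD' PZ'] _ _] := PP i.+1 iin.
have Pi1 : P i `<=` P i.+1 by have [] := Plt i iin.
have Os l : (l <= n)%N -> gen [set` s l] `<=` O.
  move=> ln; apply: alg_gen_min => // z /mapP[j]; rewrite mem_iota => /andP[j1 j2] ->.
  have jn : (j < n)%N by lia.
  by have [[+ _ _ _] _ _] := PP j.+1 jn; apply; have [] := yP j jn.
have key p : coefs_in (gen [set` s m]) p -> p != 0 -> ~ P i p.[y i].
  elim/poly_ind: p => [|p c IHp] sp; first by rewrite eqxx.
  have sp' : coefs_in (gen [set` s m]) p.
    by move=> l; have := sp l.+1; rewrite coefD coefMX coefC addr0.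
  have sc : gen [set` s m] c.
    by have := sp 0%N; rewrite coefD coefMX coefC add0r.
  have Op : O p.[y i].
    apply: (coefs_in_horner sO); last exact: PO'.
    by move=> l; apply: (Os m (ltnW mn)).
  have [->|c0 _] := eqVneq c 0.
    rewrite addr0 => p0; rewrite hornerMX => /Pp[//|//| |//]; first exact: PO'.
    by apply: IHp => //; apply: contraNneq p0 => ->; rewrite mul0r.
  rewrite hornerMXaddC => /Pi1 Pc; case/eqP: c0; apply: sP => //.
  rewrite i1 -(addKr (p.[y i] * y i) c); apply: PD' => //.
  by rewrite -mulNr; apply: PZ' => //; apply: (subalgN sO).
rewrite sE; split.
  split=> // -[p [p0 sp py]]; apply: (key p sp p0); by rewrite py.
move=> f /alg_gen_cons[p sp ->]; rewrite -/i => Pp'.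
have [->|p0] := eqVneq p 0; first by rewrite horner0.
by case: (key p sp p0).
Qed.

(** A chain of n+1 primes supplies n independent derivations, and a derivation killing the n
    parameters is zero by [regular_differentials]. So the matrix of their values at the parameters
    is invertible, and its inverse produces the dual derivations. *)
Theorem regular_derivations : prime_chain O n -> exists D : 'I_n -> K -> K,
  [/\ forall i, derivation iota (D i), forall i f, O f -> O (D i f),
    forall i j, D i (x j) = (i == j)%:R &
    forall d, derivation iota d -> forall f, d f = \sum_i d (x i) * D i f].
Proof.
move=> /prime_chain_transcendental[s sn ts].
have [d0 [dd d1 d0E]] : exists d : 'I_n -> K -> K, [/\ forall i, derivation iota (d i),
    forall i : 'I_n, d i s`_i = 1
    & forall i j : 'I_n, (i < j)%N -> d i s`_j = 0].
  by rewrite -sn; exact: triangular_derivations.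
have [B [OB BE]] := regular_differentials.
have der_eq0 d : derivation iota d -> (forall i, d (x i) = 0) -> forall f, d f = 0.
  move=> dD dx f; have dA g : A g -> d g = 0.
    apply: (der_alg_gen dD) => h /= ha.
    have hr : (index h a < r)%N by rewrite index_mem.
    have := BE d dD; have -> : \col_i d (x i) = 0.
      by apply/matrixP => i j; rewrite !mxE.
    rewrite mulmx0 => /matrixP/(_ (Ordinal hr) 0); rewrite !mxE /=.
    by rewrite nth_index.
  have [g [h [Ag Ah h0 ->]]] := aK f.
  by rewrite (der_div _ dD h0) !dA// !mulr0 subrr mul0r.
pose X := \matrix_(i < n, j < n) d0 i (x j).
pose T := \matrix_(i < n, j < n) d0 i s`_j.
have /det_trig detT : is_trig_mx T by apply/is_trig_mxP => i j ij; rewrite mxE d0E.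
have TU : T \in unitmx.
  by rewrite unitmxE detT big1 ?unitr1// => i _; rewrite mxE d1.
have XU : X \in unitmx.
  rewrite unitmxE unitfE; apply/negP => /det0P[v v0 vX].
  pose d f := \sum_i v 0 i * d0 i f.
  have dD : derivation iota d by apply: der_lincomb.
  have dx i : d (x i) = 0.
    have := congr1 (fun Y : 'rV_n => Y 0 i) vX; rewrite !mxE => vE.
    by rewrite -[RHS]vE; apply: eq_bigr => j _; rewrite mxE.
  case/eqP: v0; rewrite -[v]mulmx1 -(mulmxV TU) mulmxA.
  have -> : v *m T = 0; last by rewrite mul0mx.
  apply/rowP => j; rewrite !mxE -[RHS](der_eq0 d dD dx s`_j).
  by apply: eq_bigr => i _; rewrite mxE.
pose D i f := \sum_j invmx X i j * d0 j f.
have DD i : derivation iota (D i) by apply: der_lincomb.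
have Dx i j : D i (x j) = (i == j)%:R.
  have := mulVmx XU => /matrixP/(_ i j); rewrite !mxE => <-.
  by apply: eq_bigr => l _; rewrite mxE.
exists D; split=> // [i f Of|d dD f].
  have [e [Oe ->//]] := derivation_generators Of.
  apply: (@subalg_sum _ _ iota O _ _ _ _ sO) => l _; apply: (subalgM sO) => //.
  have := BE (D i) (DD i) => /matrixP/(_ l 0); rewrite !mxE => ->.
  apply: (@subalg_sum _ _ iota O _ _ _ _ sO) => j _; apply: (subalgM sO) => //.
  by rewrite mxE Dx; apply: (subalg_nat _ sO).
pose d' f := d f - \sum_i d (x i) * D i f.
have d'D : derivation iota d'.
  have [SC SD SM] := der_lincomb (fun i => d (x i)) DD; have [dC dD' dM] := dD.
  split=> [c|g h|g h]; rewrite /d' ?dC ?SC ?dD' ?SD ?dM ?SM; [by rewrite subrr| |]; ring.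
apply/eqP; rewrite -subr_eq0; apply/eqP; apply: (der_eq0 d' d'D) => i.
rewrite /d' (bigD1 i)//= Dx eqxx mulr1 big1 ?addr0 ?subrr// => j /negPf ji.
by rewrite Dx ji mulr0.
Qed.

Section StableIdeals.
Variable D : 'I_n -> K -> K.
Hypothesis DD : forall i, derivation iota (D i).
Hypothesis Dx : forall i j, D i (x j) = (i == j)%:R.
Hypothesis Dspan : forall d, derivation iota d ->
  forall f, d f = \sum_i d (x i) * D i f.

(** The D_i act as partial derivatives on k[x_1, ..., x_n], so lowering degrees shows that I meets
    this ring only in 0. A derivation killing all x_i is zero, so K is algebraic over it; the
    constant coefficient of an equation of an element of I would be a nonzero element of the
    intersection. *)
Lemma stable_ideal_trivial I : ideal O I -> ~ I 1 ->
  (forall i f, I f -> I (D i f)) -> forall f, I f -> f = 0.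
Proof.
move=> [IO I0 ID IM] I1 DI.
have gen0 (t : seq 'I_n) : uniq t ->
    forall f, gen [set` [seq x i | i <- t]] f -> I f -> f = 0.
  elim: t => [_ f /alg_gen_nil[c ->] Ic|i t IHt /= /andP[it ut]].
    apply/eqP/negPn/negP => c0; apply: I1.
    have := IM (iota c^-1) _ _ Ic; rewrite -rmorphM mulVf.
      by rewrite rmorph1; apply; case: sO.
    by apply: contraNneq c0 => ->; rewrite rmorph0.
  move=> f /alg_gen_cons[p tp ->] {f}.
  have Dt f : gen [set` [seq x j | j <- t]] f -> D i f = 0.
    apply: (der_alg_gen (DD i)) => _ /mapP[j jt ->]; rewrite Dx.
    by case: eqP jt it => // ->->.
  have [m] := ubnP (size p); elim: m p tp => // m IHm p tp pm Ip.
  have p'0 : p^`().[x i] = 0.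
    have [->|p0] := eqVneq p 0; first by rewrite derivC horner0.
    apply: IHm; first exact: (coefs_in_deriv (alg_gen_subalg iota _)).
      by rewrite (leq_trans (size_deriv_lt p0)).
    have := DI i _ Ip; rewrite (der_horner_const _ (DD i) Dt tp).
    by rewrite Dx eqxx mulr1.
  have [p1|p1] := leqP (size p) 1.
    move: Ip; rewrite (size1_polyC p1) hornerC; apply: IHt => //; exact: tp.
  have trans := der_horner_const (x i) (DD i) Dt.
  have notalg q : coefs_in (gen [set` [seq x j | j <- t]]) q -> q.[x i] = 0 -> q = 0.
    have [l] := ubnP (size q); elim: l q => // l IHl q ql tq qx.
    apply/eqP/negPn/negP => q0.
    have q'0 : q^`() = 0.
      apply: IHl; first by rewrite (leq_trans (size_deriv_lt q0)).
        exact: (coefs_in_deriv (alg_gen_subalg iota _)).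
      have := trans q tq; rewrite qx (der0 (DD i)) Dx eqxx mulr1.
      by move=> <-.
    have /size1_polyC qC := deriv_eq0 char0 q'0.
    by move: qx q0; rewrite qC hornerC => ->; rewrite eqxx.
  have := notalg _ (coefs_in_deriv (alg_gen_subalg iota _) tp) p'0.
  by move/(deriv_eq0 char0); rewrite leqNgt p1.
pose xs := [seq x i | i <- enum 'I_n].
have xs_alg f : algebraic_over (gen [set` xs]) f.
  apply: contrapT => tf.
  have [d [dD dxs df]] := derivation_of_transcendental char0 (alg_gen_subalg _ _) tf.
  have := Dspan dD f; rewrite df big1 => [/eqP|i _]; first by rewrite oner_eq0.
  rewrite dxs ?mul0r//; apply: alg_gen_in => /=.
  by apply: map_f; rewrite mem_enum.
move=> f If; apply/eqP/negPn/negP => f0.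
have [p [p0 xp pf]] := xs_alg f.
have Oxs : gen [set` xs] `<=` O.
  by apply: alg_gen_min => // _ /mapP[i _ ->].
elim/poly_ind: p p0 xp pf => [|p c IHp]; first by rewrite eqxx.
have [->|c0] := eqVneq c 0.
  rewrite addr0 => p0 xp; rewrite hornerMX => /eqP.
  rewrite mulf_eq0 (negPf f0) orbF => /eqP; apply: IHp.
    by apply: contraNneq p0 => ->; rewrite mul0r.
  by move=> i; have := xp i.+1; rewrite coefMX.
move=> _ xp /eqP; rewrite hornerMXaddC addr_eq0 => /eqP pf.
case/eqP: c0; apply: (gen0 (enum 'I_n)); first exact: enum_uniq.
  by have := xp 0%N; rewrite coefD coefMX coefC add0r.
rewrite -[c]opprK -pf -mulNr; apply: IM => //.
apply/(subalgN sO)/(coefs_in_horner sO); last exact: IO.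
by move=> i; apply: Oxs; have := xp i.+1; rewrite coefD coefMX coefC addr0.
Qed.

End StableIdeals.

End RegularPoints.

(** * Arcs and their perturbations *)

Section PowerSeriesCoefficients.
Variable R : comNzRingType.
Implicit Types s u v : pseries R.

Definition ord_ge (n : nat) s := forall i, (i < n)%N -> s i = 0.

Lemma pseries_coefD s u n : (s + u) n = s n + u n. Proof. by []. Qed.
Lemma pseries_coefN s n : (- s) n = - s n. Proof. by []. Qed.
Lemma pseries_coefZ (c : R) s n : (c *: s) n = c * s n. Proof. by []. Qed.
Lemma pseries_coef0 n : (0 : pseries R) n = 0. Proof. by []. Qed.
Lemma pseries_coef1 n : (1 : pseries R) n = (n == 0%N)%:R. Proof. by []. Qed.
Lemma pseries_coefM s u n : (s * u) n = \sum_(i < n.+1) s i * u (n - i)%N.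
Proof. by []. Qed.

Lemma pseries_coef_sum (I : Type) (r : seq I) (P : pred I) (F : I -> pseries R) n :
  (\sum_(i <- r | P i) F i) n = \sum_(i <- r | P i) F i n.
Proof. by elim/big_rec2: _ => // i x y _ <-. Qed.

Lemma ord_geW m n s : (m <= n)%N -> ord_ge n s -> ord_ge m s.
Proof. by move=> mn sn i im; apply: sn; apply: leq_trans mn. Qed.

Lemma ord_geD n s u : ord_ge n s -> ord_ge n u -> ord_ge n (s + u).
Proof. by move=> sn un i il; rewrite pseries_coefD sn// un// addr0. Qed.

Lemma ord_geM m n s u : ord_ge m s -> ord_ge n u -> ord_ge (m + n) (s * u).
Proof.
move=> sm un i imn; rewrite pseries_coefM big1// => j _.
have [jm|mj] := ltnP j m; first by rewrite sm ?mul0r.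
by rewrite un ?mulr0//; have := ltn_ord j; lia.
Qed.

Lemma ord_ge0 s : ord_ge 0 s. Proof. by []. Qed.

Lemma ord_geX n s m : ord_ge n s -> ord_ge (m * n) (s ^+ m).
Proof.
move=> sn; elim: m => [|m IHm]; first by rewrite mul0n.
by rewrite exprS mulSn; apply: ord_geM.
Qed.

Lemma ord_ge_coefM m n s u : ord_ge m s -> ord_ge n u ->
  (s * u) (m + n)%N = s m * u n.
Proof.
move=> sm un; have mlt : (m < (m + n).+1)%N by lia.
rewrite pseries_coefM (bigD1 (Ordinal mlt))//= addKn big1 ?addr0// => i im.
have {}im : (i : nat) != m by [].
have [il|mi] := ltnP i m; first by rewrite sm ?mul0r.
by rewrite un ?mulr0//; have := ltn_ord i; lia.
Qed.

End PowerSeriesCoefficients.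

Section PowerSeriesOrder.
Variable R : idomainType.
Implicit Types s u v : pseries R.

Lemma ord_tE n s : ord_ge n s -> s n != 0 -> ord_t s = n%:Z%:E.
Proof.
move=> sn s0; rewrite /ord_t; case: pselect => [h|[]]; last by exists n.
congr (_%:Z%:E); case: ex_minnP => m sm mmin; apply/eqP; rewrite eqn_leq.
rewrite mmin// leqNgt; apply/negP => mn; move: sm; by rewrite sn ?eqxx.
Qed.

Lemma ord_t0 : ord_t (0 : pseries R) = +oo%E.
Proof. by rewrite /ord_t; case: pselect => // -[n]; rewrite eqxx. Qed.

Variant ord_t_spec s : \bar int -> Prop :=
| OrdTInf of s = 0 : ord_t_spec s +oo%E
| OrdTFin n of ord_ge n s & s n != 0 : ord_t_spec s n%:Z%:E.

Lemma ord_tP s : ord_t_spec s (ord_t s).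
Proof.
rewrite /ord_t; case: pselect => [h|h].
  case: ex_minnP => n sn nmin; constructor=> // i il.
  by apply/eqP/negPn/negP => /nmin; rewrite leqNgt il.
constructor; apply/funext => n; apply/eqP/negPn/negP => sn.
by apply: h; exists n.
Qed.

Lemma ord_t_ge n s : (n%:Z%:E <= ord_t s)%E <-> ord_ge n s.
Proof.
case: ord_tP => [->|m sm s0]; first by split=> // _; rewrite leey.
rewrite lee_fin; split=> [nm|sn]; first by apply: ord_geW sm; lia.
rewrite leNgt; apply/negP => mn; move: s0; rewrite sn ?eqxx//; lia.
Qed.

Lemma ord_t_fin n s : ord_t s = n%:Z%:E -> ord_ge n s /\ s n != 0.
Proof. by case: ord_tP => // m sm s0 [] <-. Qed.

Lemma ord_t_eqy s : ord_t s = +oo%E -> s = 0.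
Proof. by case: ord_tP. Qed.

Lemma ord_tM s u : ord_t (s * u) = (ord_t s + ord_t u)%E.
Proof.
case: (ord_tP s) => [->|m sm s0]; first by rewrite mul0r ord_t0; case: ord_tP.
case: (ord_tP u) => [->|n un u0]; first by rewrite mulr0 ord_t0.
rewrite -EFinD -PoszD; apply: ord_tE; first exact: ord_geM.
by rewrite ord_ge_coefM// mulf_neq0.
Qed.

Lemma ord_tC (c : R) : c != 0 -> ord_t (c%:A : pseries R) = 0%E.
Proof.
move=> c0; rewrite (@ord_tE 0)// pseries_coefZ pseries_coef1 eqxx mulr1//.
Qed.

End PowerSeriesOrder.

Section Substitution.
Variable k : fieldType.
Implicit Types (s u v : pseries k) (G H : pseries (pseries k)).

(* The evaluation at s of a power series over k[[t]], when s has positive order. *)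
Definition eval_pseries s G : pseries k :=
  fun l => (\sum_(j < l.+1) s ^+ j * G j) l.

Lemma eval_pseries_trunc s G n l : ord_ge 1 s -> (l < n)%N ->
  eval_pseries s G l = (trunc_poly n G).[s] l.
Proof.
move=> s1 ln; rewrite horner_poly /eval_pseries !pseries_coef_sum.
rewrite (big_ord_widen n (fun j => (s ^+ j * G j) l) ln) [LHS]big_mkcond.
apply: eq_bigr => j _; rewrite [G j * _]mulrC; case: ltnP => // lj.
have := ord_geM (@ord_geX _ 1 s j s1) (ord_ge0 (G j)); rewrite muln1 addn0.
by move=> /(_ l) ->.
Qed.

Lemma pseries_coefM_congr n s s' u u' : (forall l, (l < n)%N -> s l = s' l) ->
  (forall l, (l < n)%N -> u l = u' l) -> forall l, (l < n)%N -> (s * u) l = (s' * u') l.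
Proof.
move=> ss uu l ln; rewrite !pseries_coefM; apply: eq_bigr => i _.
by rewrite ss ?uu//; have := ltn_ord i; lia.
Qed.

Lemma eval_pseriesM s G H : ord_ge 1 s ->
  eval_pseries s (G * H) = eval_pseries s G * eval_pseries s H.
Proof.
move=> s1; apply/funext => l.
rewrite [RHS](@pseries_coefM_congr l.+1 _ (trunc_poly l.+1 G).[s] _
  (trunc_poly l.+1 H).[s])//; last 2 first.
- by move=> i il; apply: eval_pseries_trunc.
- by move=> i il; apply: eval_pseries_trunc.
rewrite -hornerM (@eval_pseries_trunc _ _ l.+1)//.
pose P := trunc_poly l.+1 G * trunc_poly l.+1 H; rewrite -/P.
have -> : trunc_poly l.+1 (G * H) = take_poly l.+1 P.
  apply/polyP => i; rewrite coef_poly coef_take_poly; case: ltnP => // il.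
  exact: pseries_mulE.
rewrite -{2}(poly_take_drop l.+1 P) hornerD hornerM hornerXn pseries_coefD.
have -> : ((drop_poly l.+1 P).[s] * s ^+ l.+1) l = 0; last by rewrite addr0.
by apply: (ord_geM (ord_ge0 _) (@ord_geX _ 1 s l.+1 s1)); rewrite muln1.
Qed.

Lemma eval_pseriesD s G H :
  eval_pseries s (G + H) = eval_pseries s G + eval_pseries s H.
Proof.
apply/funext => l; rewrite /eval_pseries pseries_coefD -pseries_coefD -big_split.
by congr (_ l); apply: eq_bigr => i _; rewrite [(G + H) i]pseries_coefD mulrDr.
Qed.

End Substitution.

Section Taylor.
Variables (k : closedFieldType) (K : fieldType) (iota : {rmorphism k -> K}).
Hypothesis char0 : [pchar K] =i pred0.
Variable d : K -> K.
Hypothesis dD : derivation iota d.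
Implicit Types (f g : K).

Definition divided_der (j : nat) f := iter j d f / (j`!)%:R.

Let fact0 j : (j`!)%:R != 0 :> K.
Proof. by rewrite ((pcharf0P K).1 char0) -lt0n fact_gt0. Qed.

Lemma der_nat n f : d (f / n%:R) = d f / n%:R.
Proof.
have [->|n0] := eqVneq (n%:R : K) 0; first by rewrite invr0 !mulr0 (der0 dD).
rewrite (der_div _ dD n0); have -> : d n%:R = 0.
  by rewrite -(rmorph_nat iota); case: dD.
by rewrite mulr0 subr0; field.
Qed.

Lemma divided_derS j f : j.+1%:R * divided_der j.+1 f = d (divided_der j f).
Proof.
rewrite /divided_der der_nat iterS factS natrM.
by field; rewrite fact0 ?natr1 ?nat1r (char0_natr_neq0 char0).
Qed.

Lemma divided_der_leibniz j f g :
  divided_der j (f * g) = \sum_(i < j.+1) divided_der i f * divided_der (j - i) g.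
Proof.
elim: j => [|j IHj]; first by rewrite big_ord1 /divided_der /= !divr1.
apply: (mulfI (char0_natr_neq0 char0 j)); rewrite divided_derS IHj (der_sum _ _ _ dD).
under eq_bigr do rewrite (derM _ _ dD) -!divided_derS.
rewrite big_split /= mulr_sumr.
pose F i := divided_der i f * divided_der (j.+1 - i) g.
have -> : \sum_(i < j.+1) divided_der i f *
    ((j - i).+1%:R * divided_der (j - i).+1 g) =
    \sum_(i < j.+2) (j.+1 - i)%:R * F i.
  rewrite [RHS]big_ord_recr /= subnn mul0r addr0; apply: eq_bigr => i _.
  by rewrite /F subSn ?leq_ord// mulrCA.
have -> : \sum_(i < j.+1) divided_der (j - i) g * (i.+1%:R * divided_der i.+1 f) =
    \sum_(i < j.+2) i%:R * F i.
  rewrite [RHS]big_ord_recl /= mul0r add0r; apply: eq_bigr => i _.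
  by rewrite /F /bump /= add1n subSS; ring.
rewrite -big_split; apply: eq_bigr => i _ /=; rewrite -mulrDl -natrD subnK//.
by have := ltn_ord i.
Qed.

Lemma divided_derD j f g : divided_der j (f + g) = divided_der j f + divided_der j g.
Proof.
rewrite /divided_der -mulrDl; congr (_ / _).
by elim: j => //= j ->; rewrite (derD _ _ dD).
Qed.

Lemma divided_derC j c : divided_der j (iota c) = (j == 0%N)%:R * iota c.
Proof.
rewrite /divided_der; case: j => [|j]; first by rewrite mul1r divr1.
rewrite mul0r iterSr; case: dD => -> _ _.
have -> : iter j d 0 = 0 by elim: j => //= j ->; exact: (der0 dD).
by rewrite mul0r.
Qed.

End Taylor.

Section ArcPullbacks.
Variables (k : closedFieldType) (X : variety k).
Local Notation K := (funfield X).
Local Notation sc := (scal X).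
Local Notation gen := (alg_gen sc).
Implicit Types (f : K) (A O M : set K).

Lemma spoint_eq (S : comAlgType k) (g h : spoint X S) :
  center g = center h -> pull g = pull h -> g = h.
Proof.
case: g h => [x phi cP pP] [x' phi' cP' pP'] /= Ex Ephi; subst x' phi'.
by congr SPoint; apply: Prop_irrelevance.
Qed.

Lemma affine_generators A : affine_alg sc A -> exists2 a : seq K,
  A = gen [set` a] & forall f, fractions A f.
Proof.
move=> [[a ->] aK]; exists a => // f; exact: aK.
Qed.

Lemma point_chart O : points X O -> exists A, affine_open A /\ closed_points A O.
Proof.
have [[n [A [Aaff pE]]] _] := pointsP X; rewrite pE => -[i _ AO].
by exists (A i); split=> //; split=> // O' AO'; rewrite pE; exists i.
Qed.

Lemma affine_alg_subalg A : affine_alg sc A -> subalgebra sc A.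
Proof. by move=> /affine_generators[a -> _]; apply: alg_gen_subalg. Qed.

Lemma point_subalg O : points X O -> subalgebra sc O.
Proof.
move=> /point_chart[A [[affA _] [M maxM ->]]]; have sA := affine_alg_subalg affA.
by apply: localize_subalg => //; apply: (maximal_ideal_prime sA).
Qed.

Lemma sub_closed_point A O : subalgebra sc A -> closed_points A O -> A `<=` O.
Proof. by move=> sA [M [_ M1 _] ->]; exact: (sub_localize sA M1). Qed.

Section Arc.
Variable g : arcs X.
Local Notation O := (center g).

Lemma center_subalg : subalgebra sc O. Proof. exact: (point_subalg (centerP g)). Qed.
Hint Resolve center_subalg : core.

Lemma pullC c : pull g (sc c) = c%:A. Proof. by case: (pullP g) => + _ _ _; apply. Qed.

Lemma pullD f h : O f -> O h -> pull g (f + h) = pull g f + pull g h.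
Proof. by case: (pullP g) => _ + _ _; apply. Qed.

Lemma pullM f h : O f -> O h -> pull g (f * h) = pull g f * pull g h.
Proof. by case: (pullP g) => _ _ + _; apply. Qed.

Lemma pull0 : pull g 0 = 0.
Proof. by rewrite -(rmorph0 sc) pullC scale0r. Qed.

Lemma pull1 : pull g 1 = 1.
Proof. by rewrite -(rmorph1 sc) pullC scale1r. Qed.

Lemma pullX f n : O f -> pull g (f ^+ n) = pull g f ^+ n.
Proof.
move=> Of; elim: n => [|n IHn]; first by rewrite !expr0 pull1.
by rewrite !exprS pullM// ?IHn//; apply: (subalgX _ center_subalg).
Qed.

Lemma arc_residue : residue_map sc O (fun f => pull g f 0%N).
Proof.
split=> [c|f h Of Oh|f h Of Oh]; first by rewrite pullC pseries_coefZ mulr1.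
- by rewrite pullD.
- by rewrite pullM// pseries_coefM big_ord1.
Qed.

Lemma arc_nonunits : nonunits O = [set f | O f /\ pull g f 0%N = 0].
Proof.
have [A [[affA _] [M maxM OE]]] := point_chart (centerP g).
have sA := affine_alg_subalg affA.
have := arc_residue; rewrite OE => ev.
by have [_ ->] := localize_residue sA (maximal_ideal_prime sA maxM) ev.
Qed.

Lemma arc_unit f : O f -> pull g f 0%N != 0 -> f != 0 /\ O f^-1.
Proof. exact: (residue_unit arc_residue arc_nonunits). Qed.

(* By separatedness, an arc regular on A is centred at a point of A. *)
Lemma center_localize A : affine_open A -> A `<=` O ->
  exists2 M, maximal_ideal A M & O = localize A M.
Proof.
move=> [affA Apts] AO; have sA := affine_alg_subalg affA.
pose M := [set f | A f /\ pull g f 0%N = 0]; have ev := arc_residue.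
have sO := center_subalg.
have M1 : ~ M 1 by move=> [_]; rewrite pull1 => /eqP; rewrite oner_eq0.
have maxM : maximal_ideal A M.
  split=> // [|I [IA I0 ID IM] I1 MI].
    split=> [f []//||f h [Af f0] [Ah h0]|a f Aa [Af f0]].
    - by split; [exact: (subalg0 sA)|rewrite pull0].
    - by split; [exact: (subalgD sA)|rewrite (residueD ev) ?f0 ?h0 ?addr0//; apply: AO].
    - split; first exact: (subalgM sA).
      by rewrite (residueM ev) ?f0 ?mulr0//; apply: AO.
  apply/seteqP; split=> // f If; split; first exact: IA.
  apply/eqP/negPn/negP => f0; apply: I1; set c := pull g f 0%N in f0.
  have Af := IA _ If; have Ac e : A (sc e) by case: sA.
  have Icf : I (sc c - f).
    apply: MI; split; first exact: (subalgB sA).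
    rewrite (residueD ev); [|exact: AO|by apply/(subalgN sO)/AO].
    by rewrite (residueN sO ev) ?(residueC ev) ?subrr//; apply: AO.
  have -> : 1 = sc c^-1 * ((sc c - f) + f).
    by rewrite subrK -rmorphM mulVf// rmorph1.
  by apply: IM => //; apply: ID.
exists M => //; have [_ sep] := pointsP X.
(* Once this inclusion is known to be local, the local ring O dominates both [localize A M] and
   itself, and separatedness identifies the two. *)
have MO : localize A M `<=` O.
  move=> _ [a [s [Aa As Ms ->]]]; apply: (subalgM sO); first exact: AO.
  have [] // := arc_unit (AO _ As); apply/eqP => s0; exact: Ms.
have PM := maximal_ideal_prime sA maxM.
have sL := localize_subalg sA PM.
have evL : residue_map sc (localize A M) (fun f => pull g f 0%N).
  split; first exact: (residueC ev).
    by move=> f h /MO Of /MO Oh; apply: (residueD ev).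
  by move=> f h /MO Of /MO Oh; apply: (residueM ev).
have [_ LE] := localize_residue sA PM evL.
apply: (sep _ _ O); [exact: centerP|by apply: Apts; exists M| | |].
- split=> //; rewrite arc_nonunits; split=> [f []//||f h [Of f0] [Oh h0]|a f Oa [Of f0]].
  + by split; [exact: (subalg0 sO)|rewrite pull0].
  + by split; [exact: (subalgD sO)|rewrite (residueD ev) ?f0 ?h0 ?addr0].
  + by split; [exact: (subalgM sO)|rewrite (residueM ev) ?f0 ?mulr0].
- by split.
- by split=> //; rewrite LE arc_nonunits => f [/MO].
Qed.

End Arc.

Section Topology.
Variable m : nat.

Lemma trunc_coef (s : pseries k) i :
  (trunc m s)`_i = if (i < m.+1)%N then s i else 0.
Proof.
rewrite /trunc /= mk_monic_Xn /= -Pdiv.RingMonic.take_poly_rmodp.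
by rewrite coef_take_poly coef_poly; case: ifP => // ->.
Qed.

Lemma open_basic_open n (P : mpoly.mpoly n k) (h : 'I_n -> K) i :
  open (basic_open P h i : set (jets X m)).
Proof.
exists [set basic_open P h i]; last by rewrite bigcup_set1.
move=> _ ->; apply: (@finI_from1 _ _ _ id); by exists n, P, h, i.
Qed.

Lemma open_psi (U : set (jets X m)) : open U -> open (psi m @^-1` U).
Proof.
move=> oU; exists [set psi m @^-1` U]; last by rewrite bigcup_set1.
by move=> _ ->; apply: (@finI_from1 _ _ _ id); exists m, U.
Qed.

End Topology.

Lemma open_center f : open [set g : arcs X | center g f].
Proof.
have -> : [set g : arcs X | center g f] = psi 0 @^-1`
    (basic_open (mpoly.mpolyC 1 1) (fun=> f) (fun=> 0%N) : set (jets X 0)).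
  apply/seteqP; split=> g /=; last by case=> /(_ ord0).
  by move=> gf; split=> //; rewrite mpoly.mevalC oner_neq0.
exact/open_psi/open_basic_open.
Qed.

Lemma open_pull_coef f l : open [set g : arcs X | center g f /\ pull g f l != 0].
Proof.
have -> : [set g : arcs X | center g f /\ pull g f l != 0] = psi l @^-1`
    (basic_open (mpoly.mpolyX _ (mpoly.mnm1 ord0)) (fun _ : 'I_1 => f) (fun=> l) : set (jets X l)).
  apply/seteqP; split=> g /=; rewrite /basic_open /= mpoly.mevalXU trunc_coef ltnSn.
    by case.
  by case=> /(_ ord0).
exact/open_psi/open_basic_open.
Qed.

End ArcPullbacks.
#[global] Hint Resolve center_subalg : core.

Section Perturbation.
Variables (k : closedFieldType) (X : variety k).
Local Notation K := (funfield X).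
Local Notation sc := (scal X).
Hypothesis char0 : [pchar K] =i pred0.
Variables (g : arcs X) (d : K -> K).
Hypotheses (dD : derivation sc d) (dO : forall f, center g f -> center g (d f)).
Local Notation C := (center g).

Lemma divided_der_center j f : C f -> C (divided_der d j f).
Proof.
move=> Cf; have sC := center_subalg g; apply: (subalgM sC).
  by elim: j => //= j; apply: dO.
by rewrite -(rmorph_nat sc) -fmorphV; case: sC.
Qed.

Variables (N : nat) (c : k).
Let s : pseries k := c *: pseries_t k ^+ N.+1.

Lemma pseries_t_ord n : ord_ge n (pseries_t k ^+ n).
Proof.
have t1 : ord_ge 1 (pseries_t k) by case.
by have := @ord_geX _ 1 _ n t1; rewrite muln1.
Qed.

Lemma pseries_tX_coef n i : (pseries_t k ^+ n) i = (i == n)%:R.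
Proof.
elim: n i => [|n IHn] i; first by rewrite expr0 pseries_coef1.
rewrite exprS pseries_coefM; case: i => [|i].
  by rewrite big_ord1 mul0r.
rewrite big_ord_recl big_ord_recl /= mul0r add0r mul1r big1 ?addr0.
  by rewrite IHn subSS subn0.
by move=> j _; rewrite mul0r.
Qed.

Let s1 : ord_ge N.+1 s.
Proof. by move=> i iN; rewrite /s pseries_coefZ pseries_t_ord ?mulr0. Qed.
Let s1' : ord_ge 1 s. Proof. exact: ord_geW s1. Qed.

(* The arc exp(s d)^* g, where s = c t^(N+1). *)
Definition perturbed_pull (f : K) : pseries k := if `[< C f >] then
  eval_pseries s (fun j => pull g (divided_der d j f)) else 0.

Lemma perturbed_pullE f : C f ->
  perturbed_pull f = eval_pseries s (fun j => pull g (divided_der d j f)).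
Proof. by move=> Cf; rewrite /perturbed_pull; case: asboolP. Qed.

Lemma perturbed_pullP : is_pullback C perturbed_pull.
Proof.
have sC := center_subalg g; split=> [a|f h Cf Ch|f h Cf Ch|f nCf].
- rewrite perturbed_pullE; last by case: sC.
  apply/funext => l; rewrite /eval_pseries big_ord_recl big1 => [|j _].
    by rewrite addr0 expr0 mul1r (divided_derC dD) mul1r pullC.
  by rewrite (divided_derC dD) mul0r pull0 mulr0.
- rewrite !perturbed_pullE//; last exact: (subalgD sC).
  rewrite -eval_pseriesD; congr eval_pseries; apply/funext => j.
  by rewrite pseries_coefD (divided_derD dD) pullD//; apply: divided_der_center.
- rewrite !perturbed_pullE//; last exact: (subalgM sC).
  rewrite -eval_pseriesM//; congr eval_pseries; apply/funext => j.
  have Cj i e : C e -> C (divided_der d i e) by apply: divided_der_center.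
  rewrite (divided_der_leibniz char0 dD) pseries_coefM.
  suff H n (F : 'I_n -> K) : (forall i, C (F i)) ->
      pull g (\sum_i F i) = \sum_i pull g (F i).
    rewrite H => [|i]; last by apply: (subalgM sC); apply: Cj.
    by apply: eq_bigr => i _; rewrite pullM//; apply: Cj.
  move=> CF; suff [] : C (\sum_i F i) /\ pull g (\sum_i F i) = \sum_i pull g (F i).
    by [].
  elim/big_rec2: _ => [|i y x _ [Cx <-]]; first by rewrite pull0; split=> //; apply: (subalg0 sC).
  by rewrite pullD//; split=> //; apply: (subalgD sC).
- by rewrite /perturbed_pull; case: asboolP.
Qed.

Definition perturbed_arc : arcs X := SPoint (centerP g) perturbed_pullP.

(** The terms with j > 0 contain s^j, of order at least N+1, which the truncation does not see. *)
Lemma psi_perturbed_arc : psi N perturbed_arc = psi N g.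
Proof.
apply: spoint_eq => //=; apply/funext => f /=.
have [Cf|nCf] := pselect (C f); last first.
  by case: (perturbed_pullP) (pullP g) => _ _ _ -> // [_ _ _ ->].
rewrite perturbed_pullE// /trunc; congr in_qpoly.
apply/polyP => l; rewrite !coef_poly; case: ltnP => // lN.
rewrite /eval_pseries big_ord_recl expr0 mul1r pseries_coefD.
rewrite /divided_der /= divr1 pseries_coef_sum big1 ?addr0// => j _.
have := ord_geM (@ord_geX _ _ _ (lift ord0 j) s1)
  (ord_ge0 (pull g (divided_der d (lift ord0 j) f))).
by rewrite addn0; apply; rewrite lift0; apply: leq_trans lN _; rewrite mulSn leq_addr.
Qed.

End Perturbation.

Section PerturbationCoefficient.
Variables (k : closedFieldType) (X : variety k).
Local Notation K := (funfield X).
Local Notation sc := (scal X).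
Hypothesis char0 : [pchar K] =i pred0.
Variables (g : arcs X) (d : K -> K).
Hypotheses (dD : derivation sc d) (dO : forall f, center g f -> center g (d f)).

(** The coefficient of t^l in the perturbed pull-back is a polynomial in c whose linear coefficient
    is that of t^(N+1) times the pull-back of d f. Vanishing for all c, it is the zero polynomial
    since k is infinite. *)
Lemma perturbed_arc_coef N f l : center g f ->
  (forall c, pull (perturbed_arc char0 dD dO N c) f l = 0) ->
  (pseries_t k ^+ N.+1 * pull g (d f)) l = 0.
Proof.
(* For l = 0 the evaluation sum stops before its linear term, but there the factor t^(N+1) already
   gives 0. *)
move=> Cf H; case: l H => [|l] H.
  by rewrite pseries_coefM big_ord1 pseries_t_ord// mul0r.
pose q := \poly_(j < l.+2)
  (pseries_t k ^+ N.+1 ^+ j * pull g (divided_der d j f)) l.+1.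
have q0 c : q.[c] = 0.
  rewrite -[RHS](H c) /= perturbed_pullE// horner_poly /eval_pseries.
  rewrite pseries_coef_sum; apply: eq_bigr => j _.
  by rewrite exprZn -scalerAl pseries_coefZ mulrC.
have : q = 0.
  apply/eqP/negPn/negP => qn0.
  pose rs := [seq (i%:R : k) | i <- iota 0 (size q)].
  have rsq : all (root q) rs by apply/allP => _ /mapP[i _ ->]; apply/rootP.
  have inj (i j : nat) : (i <= j)%N -> i%:R = j%:R :> K -> i = j.
    move=> ij; rewrite -(subnK ij) natrD => /eqP.
    rewrite -subr_eq0 opprD addrC subrK oppr_eq0.
    by rewrite ((pcharf0P K).1 char0) => /eqP ->.
  have urs : uniq rs.
    rewrite map_inj_uniq ?iota_uniq// => i j /(congr1 sc); rewrite !rmorph_nat => E.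
    by case/orP: (leq_total i j) => ij; [exact: inj|apply/esym/inj].
  by have := max_poly_roots qn0 rsq urs; rewrite size_map size_iota ltnn.
move/polyP/(_ 1%N); rewrite coef_poly coef0 /= expr1.
by rewrite /divided_der /= divr1.
Qed.

End PerturbationCoefficient.

(** * The valuation of a cylinder *)

Section GenericArcs.
Variables (k : closedFieldType) (X : variety k).
Local Notation K := (funfield X).
Local Notation sc := (scal X).
Local Notation gen := (alg_gen sc).
Variable C : set (arcs X).
Hypothesis irrC : irreducible_set C.
Implicit Types (f : K) (g : arcs X) (P Q : arcs X -> Prop).

Definition generically Q := exists U, [/\ open U, C `&` U !=set0
  & forall g, C g -> U g -> Q g].

Lemma generically_and P Q : generically P -> generically Q ->
  generically (fun g => P g /\ Q g).
Proof.
move=> [U [oU CU PU]] [V [oV CV QV]]; exists (U `&` V); split.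
- exact: openI.
- by case: irrC => _; apply.
- by move=> g Cg [Ug Vg]; split; [apply: PU|apply: QV].
Qed.

Lemma generically_imp P Q : (forall g, C g -> P g -> Q g) ->
  generically P -> generically Q.
Proof. by move=> PQ [U [oU CU PU]]; exists U; split=> // g Cg /PU; auto. Qed.

Lemma generically_ex P : generically P -> exists2 g, C g & P g.
Proof. by move=> [U [oU [g [Cg Ug]] PU]]; exists g => //; apply: PU. Qed.

Lemma generically_open (U : set (arcs X)) g : open U -> C g -> U g -> generically U.
Proof. by move=> oU Cg Ug; exists U; split=> //; exists g. Qed.

Lemma generically_center f g : C g -> center g f -> generically (fun h => center h f).
Proof. by move=> Cg gf; apply: generically_open gf => //; apply: open_center. Qed.

Lemma generically_all (s : seq K) (Q : K -> arcs X -> Prop) :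
  (forall f, f \in s -> generically (Q f)) ->
  generically (fun g => forall f, f \in s -> Q f g).
Proof.
elim: s => [_|f s IHs sQ].
  by exists setT; split=> //; [exact: openT|rewrite setIT; case: irrC].
have sQ' h : h \in s -> generically (Q h).
  by move=> hs; apply: sQ; rewrite inE hs orbT.
have := generically_and (sQ f (mem_head _ _)) (IHs sQ'); apply: generically_imp.
by move=> g _ [Qf Qs] h; rewrite inE => /orP[/eqP->|/Qs].
Qed.

Lemma generically_subalg (a : seq K) g : C g -> gen [set` a] `<=` center g ->
  generically (fun h => gen [set` a] `<=` center h).
Proof.
move=> Cg ag; have : generically (fun h => forall f, f \in a -> center h f).
  apply: generically_all => f fa; apply: generically_center Cg _.
  by apply: ag; apply: alg_gen_in.
by apply: generically_imp => h _ ah; apply: alg_gen_min.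
Qed.

Definition generic_order f (e : \bar int) :=
  generically (fun g => center g f /\ ord_t (pull g f) = e).

Lemma generic_order_inj f e e' : generic_order f e -> generic_order f e' -> e = e'.
Proof. by move=> fe /(generically_and fe)/generically_ex[g _ [[_ <-] [_ <-]]]. Qed.

(** Nonvanishing of the n-th coefficient is an open condition, so the least n for which it occurs on
    C is the order at a general arc; if none occurs, the order is infinite. *)
Lemma generic_order_exists f g : C g -> center g f ->
  exists e, generic_order f e.
Proof.
move=> Cg gf; pose Q n := `[< exists g, [/\ C g, center g f & pull g f n != 0] >].
have [exQ|noQ] := pselect (exists n, Q n); last first.
  exists +oo%E; have := generically_center Cg gf; apply: generically_imp => h Ch hf.
  split=> //; case: ord_tP => // n _ hn; case: noQ; exists n; apply/asboolP.
  by exists h.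
case: (ex_minnP exQ) => n /asboolP[h [Ch hf hn]] nmin; exists n%:Z%:E.
have := generically_open (open_pull_coef f n) Ch (conj hf hn).
apply: generically_imp => h' Ch' [h'f h'n]; split=> //; apply: ord_tE => // i il.
apply/eqP/negPn/negP => h'i; move: il; rewrite ltnNge => /negP; apply.
by apply: nmin; apply/asboolP; exists h'.
Qed.

Lemma generic_order_le f e g : generic_order f e -> C g -> center g f ->
  (e <= ord_t (pull g f))%E.
Proof.
move=> fe Cg gf; case: ord_tP => [_|n gn g0]; first by rewrite leey.
have := generically_open (open_pull_coef f n) Cg (conj gf g0).
move=> /(generically_and fe)/generically_ex[h _ [[_ <-] [_ hn]]].
rewrite leNgt; apply/negP => nh; move: hn; suff -> : pull h f n = 0 by rewrite eqxx.
have : (n.+1%:Z%:E <= ord_t (pull h f))%E.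
  move: nh; case: ord_tP => [_ _|l _ _]; first by rewrite leey.
  by rewrite !(lte_fin, lee_fin); lia.
by move/ord_t_ge; apply.
Qed.

Lemma generic_orderM f h e e' : generic_order f e -> generic_order h e' ->
  generic_order (f * h) (e + e')%E.
Proof.
move=> fe he; have := generically_and fe he; apply: generically_imp.
move=> g _ [[gf <-] [gh <-]]; split; first exact: (subalgM (center_subalg g)).
by rewrite pullM// ord_tM.
Qed.

Lemma generic_order_const c : c != 0 -> generic_order (sc c) 0%E.
Proof.
move=> c0; have [g Cg] := irrC.1; have sg (h : arcs X) := center_subalg h.
have gc (h : arcs X) : center h (sc c) by case: (sg h).
have := generically_center Cg (gc g); apply: generically_imp => h _ hc.
by rewrite pullC ord_tC.
Qed.

End GenericArcs.

Section CylinderValuation.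
Variables (k : closedFieldType) (X : variety k).
Local Notation K := (funfield X).
Local Notation sc := (scal X).
Local Notation gen := (alg_gen sc).
Hypothesis char0 : [pchar K] =i pred0.
Hypothesis smoothX : smooth X.
Variables (C : set (arcs X)) (m : nat).
Hypothesis irrC : irreducible_set C.
Hypothesis Csat : forall g h, C g -> psi m h = psi m g -> C h.
Implicit Types (f : K) (g : arcs X).

Local Notation gord := (generic_order C).

Definition stable_derivation (d : K -> K) :=
  derivation sc d /\ generically C (fun g => forall f, center g f -> center g (d f)).

(** Perturbing g at t^(m+1) stays in C, where f has order at least its generic order e. Hence every
    coefficient of t^(m+1) g^*(d f) below e vanishes. *)
Lemma generic_order_derivation d f e e' : stable_derivation d ->
  gord f e -> gord (d f) e' -> (e <= m.+1%:Z%:E + e')%E.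
Proof.
move=> [dD dst] fe dfe; have := generically_and irrC dst (generically_and irrC fe dfe).
move=> /generically_ex[g Cg [dO [[gf fE] [_ <-]]]].
have -> : m.+1%:Z%:E = ord_t (pseries_t k ^+ m.+1).
  by rewrite (@ord_tE _ m.+1)//; [exact: pseries_t_ord|rewrite pseries_tX_coef eqxx oner_eq0].
rewrite -ord_tM.
have H l : (l.+1%:Z%:E <= e)%E -> (pseries_t k ^+ m.+1 * pull g (d f)) l = 0.
  move=> le; apply: (perturbed_arc_coef (char0 := char0) (dD := dD) (dO := dO)) => // c.
  have Cp : C (perturbed_arc char0 dD dO m c) by apply: Csat Cg _; apply: psi_perturbed_arc.
  have := generic_order_le irrC fe Cp gf; move/(le_trans le)/ord_t_ge; exact.
move: H; rewrite -fE; case: (ord_tP (pull g f)) => [_|n _ _] H.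
  by case: ord_tP => // l _ /eqP[]; apply: H; rewrite leey.
by apply/ord_t_ge => l ln; apply: H; rewrite lee_fin.
Qed.

(** The derivations dual to the parameters at the centre of [g1] preserve the local rings at the
    centres of general arcs: it suffices that their values on the finitely many generators of an
    affine chart are regular there, the general arc being centred on that chart by
    [center_localize]. *)
Lemma cylinder_derivations g1 : C g1 -> exists n (D : 'I_n -> K -> K),
  [/\ forall i, stable_derivation (D i),
      forall i f, center g1 f -> center g1 (D i f),
      forall d, derivation sc d -> exists a : 'I_n -> K,
        forall f, d f = \sum_i a i * D i f
    & forall I, ideal (center g1) I -> ~ I 1 ->
        (forall i f, I f -> I (D i f)) -> forall f, I f -> f = 0].
Proof.
move=> Cg1; have [A [Aopen]] := point_chart (centerP g1).
have [affA _] := Aopen; have [a AE aK] := affine_generators affA.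
subst A; set A := gen [set` a] in Aopen affA aK *.
move=> [M maxM OE]; have sA : subalgebra sc A by exact: alg_gen_subalg.
have PM := maximal_ideal_prime sA maxM.
have ev : residue_map sc (localize A M) (fun f => pull g1 f 0%N).
  by rewrite -OE; apply: arc_residue.
have [n [[chain _] [x xO]]] := smoothX (centerP g1).
rewrite OE in chain xO.
have [D [DD DO Dx Dspan]] := regular_derivations char0 aK PM ev xO chain.
have AO : A `<=` center g1 by rewrite OE; apply: (sub_localize sA); case: maxM.
exists n, D; split=> [i|i f|d dd|I].
- split=> //.
  pose L := [seq D i f | f <- a].
  have L1 : generically C (fun g => forall f, f \in L -> center g f).
    apply: generically_all => // _ /mapP[f fa ->]; apply: (generically_center Cg1).
    by rewrite OE; apply: DO; rewrite -OE; apply: AO; apply: alg_gen_in.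
  have := generically_and irrC L1 (generically_subalg irrC Cg1 AO).
  apply: generically_imp => g _ [gL gA] f gf.
  have sg := center_subalg g.
  have [M' maxM' gE] := center_localize Aopen gA.
  have DA h : A h -> center g (D i h).
    suff : A `<=` [set h | A h /\ center g (D i h)] by move=> H /H[].
    apply: alg_gen_min => [|z za]; last first.
      split; first exact: alg_gen_in.
      by apply: gL; apply: map_f.
    split=> [c|h1 h2 [A1 g1'] [A2 g2']|h1 h2 [A1 g1'] [A2 g2']].
    + split; first by case: sA.
      by case: (DD i) => -> _ _; apply: (subalg0 sg).
    + split; first exact: (subalgD sA).
      by rewrite (derD _ _ (DD i)); apply: (subalgD sg).
    + split; first exact: (subalgM sA).
      rewrite (derM _ _ (DD i)).
      by apply: (subalgD sg); apply: (subalgM sg) => //; apply: gA.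
  move: gf; rewrite {1}gE => -[p [q [Ap Aq Mq ->]]].
  have q0 : q != 0 by apply: contra_notN Mq => /eqP->; case: maxM' => -[].
  have gq : center g q^-1 by rewrite gE; apply: (localizeV sA).
  rewrite (der_div _ (DD i) q0) -exprVn; apply: (subalgM sg).
    apply: (subalgB sg); apply: (subalgM sg); by [apply: gA|apply: DA].
  exact: (subalgX _ sg).
- by rewrite OE; apply: DO.
- by exists (fun i => d (x i)) => f; apply: Dspan.
- rewrite OE => II I1 DI.
  exact: (stable_ideal_trivial char0 PM ev xO DD Dx Dspan II I1 DI).
Qed.

(** Functions of infinite generic order form a proper ideal of the local ring, stable under the
    derivations because these lower orders by at most m+1. *)
Lemma generic_order_finite f g : C g -> center g f -> f != 0 ->
  exists n : nat, gord f n%:Z%:E.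
Proof.
move=> Cg gf f0; have [e fe] := generic_order_exists Cg gf.
have [h _ [hf hE]] := generically_ex fe.
move: fe; rewrite -hE; case: ord_tP => [_ fy|n _ _]; last by exists n.
case/eqP: f0; have [n [D [Dst DO _ triv]]] := cylinder_derivations Cg.
have sg := center_subalg g.
pose I := [set f | center g f /\ gord f +oo%E].
apply: (triv I) => //.
- split=> [z []//||z1 z2 [c1 o1] [c2 o2]|z1 z2 c1 [c2 o2]].
  + split; first exact: (subalg0 sg).
    have := generically_center Cg (subalg0 sg); apply: generically_imp => h' _ h'0.
    by split=> //; rewrite pull0 ord_t0.
  + split; first exact: (subalgD sg).
    have := generically_and irrC o1 o2; apply: generically_imp.
    move=> h' _ [[h1 /ord_t_eqy p1] [h2 /ord_t_eqy p2]].
    split; first exact: (subalgD (center_subalg h')).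
    by rewrite pullD// p1 p2 addr0 ord_t0.
  + split; first exact: (subalgM sg).
    have := generically_and irrC (generically_center Cg c1) o2; apply: generically_imp.
    move=> h' _ [h1 [h2 /ord_t_eqy p2]]; split; first exact: (subalgM (center_subalg h')).
    by rewrite pullM// p2 mulr0 ord_t0.
- move=> [_ /generically_ex[h' _ [_ /ord_t_eqy]]]; rewrite pull1 => /eqP.
  by rewrite oner_eq0.
- move=> i z [gz zy]; split; first exact: DO.
  have [e' De'] := generic_order_exists Cg (DO i z gz).
  have := generic_order_derivation (Dst i) zy De'.
  have [h' _ [_ h'E]] := generically_ex De'.
  by move: De'; rewrite -h'E; case: ord_tP => // l _ _ _; rewrite leye_eq.
Qed.


End CylinderValuation.

Lemma residueX (k : closedFieldType) (K : fieldType) (iota : {rmorphism k -> K})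
    (O : set K) (ev : K -> k) (f : K) n :
  subalgebra iota O -> residue_map iota O ev -> O f -> ev (f ^+ n) = ev f ^+ n.
Proof.
move=> sO evO Of; elim: n => [|n IHn]; first by rewrite !expr0 (residue1 evO).
by rewrite !exprS (residueM evO)// ?IHn//; apply: (subalgX _ sO).
Qed.

Section JetResidue.
Variables (k : closedFieldType) (X : variety k) (m : nat).
Local Notation K := (funfield X).
Local Notation sc := (scal X).
Local Notation Q := {poly %/ 'X^(m.+1) : {poly k}}.

Lemma qpoly_coef0M (a b : Q) : (a * b)`_0 = a`_0 * b`_0.
Proof.
have E (u v : {poly k}) : (Pdiv.Ring.rmodp (u * v) (mk_monic 'X^(m.+1)))`_0 = u`_0 * v`_0.
  rewrite mk_monic_Xn /= -Pdiv.RingMonic.take_poly_rmodp.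
  by rewrite coef_take_poly /= coefM big_ord1 subn0.
exact: E.
Qed.

Lemma qpoly_coef0D (a b : Q) : (a + b)`_0 = a`_0 + b`_0.
Proof. by rewrite /= coefD. Qed.

Lemma qpoly_coef_ge (a : Q) i : (m < i)%N -> a`_i = 0.
Proof.
move=> mi; apply: nth_default; apply: leq_trans (size_npoly a) _.
by rewrite mk_monic_Xn size_polyXn.
Qed.

Lemma jet_residue (x : jets X m) : residue_map sc (center x) (fun f => (pull x f)`_0).
Proof.
have [pC pD pM _] := pullP x; split=> [c|f h xf xh|f h xf xh].
- by rewrite pC -truncC trunc_coef /= pseries_coefZ mulr1.
- by rewrite pD// qpoly_coef0D.
- by rewrite pM// qpoly_coef0M.
Qed.

End JetResidue.

Section BasicOpenPoints.
Variables (k : closedFieldType) (X : variety k).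
Local Notation K := (funfield X).
Local Notation sc := (scal X).

(** On 0-jets the coordinates of index i_j > 0 vanish, so P is the residue of a rational function h,
    and h is nonzero at a point as soon as h^-1 is regular there. This translates open subsets of X
    into conditions on domains of functions. *)
Lemma basic_open_regular n (P : mpoly.mpoly n k) (f : 'I_n -> K) i (x : jets X 0) :
  basic_open P f i x -> exists E : seq K, forall y : jets X 0,
    (forall h, h \in E -> center y h) -> basic_open P f i y.
Proof.
move=> [xf xP]; pose v j := if i j == 0%N then f j else 0.
pose h := \sum_(u <- mpoly.msupp P)
  sc (mpoly.mcoeff u P) * \prod_j v j ^+ mpoly.fun_of_multinom u j.
have hE (y : jets X 0) : (forall j, center y (f j)) -> center y h /\
    (pull y h)`_0 = mpoly.meval (fun j => (pull y (f j))`_(i j)) P.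
  move=> yf; have ev := jet_residue y.
  have sy : subalgebra sc (center y) by apply/point_subalg/centerP.
  have yv j : center y (v j) /\ (pull y (v j))`_0 = (pull y (f j))`_(i j).
    rewrite /v; case: eqP => [->//|/eqP i0]; split; first exact: (subalg0 sy).
    by rewrite (residue0 ev) qpoly_coef_ge// lt0n.
  have yX j l : center y (v j ^+ l) by apply: (subalgX _ sy); case: (yv j).
  have ysc c : center y (sc c) by case: sy.
  have yprod (u : mpoly.multinom n) : center y (\prod_j v j ^+ mpoly.fun_of_multinom u j).
    exact: (@subalg_prod _ _ sc (center y) _ _ _ _ sy).
  split.
    apply: (@subalg_sum _ _ sc (center y) _ _ _ _ sy) => u _.
    exact: (subalgM sy).
  rewrite (residue_sum sy ev) => [|u]; last exact: (subalgM sy).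
  rewrite mpoly.mevalE; apply: eq_bigr => u _; rewrite (residueM ev)// (residueC ev).
  congr (_ * _); rewrite (residue_prod sy ev)//; apply: eq_bigr => j _.
  by rewrite -(yv j).2 (residueX _ sy ev)//; case: (yv j).
have [xh xhE] := hE x xf.
have h0 : h != 0.
  apply: contraNneq xP => h0; rewrite -xhE h0; apply/eqP.
  exact: (residue0 (jet_residue x)).
exists (h^-1 :: [seq f j | j <- enum 'I_n]) => y yE.
have yf j : center y (f j).
  by apply: yE; rewrite inE map_f ?orbT// mem_enum.
have [yh yhE] := hE y yf; split=> //; rewrite -yhE.
have yhi : center y h^-1 by apply: yE; rewrite mem_head.
have := residueM (jet_residue y) yh yhi; rewrite divff// (residue1 (jet_residue y)).
by move/eqP; apply: contraTneq => ->; rewrite mul0r oner_eq0.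
Qed.

Lemma open_regular (U : set (jets X 0)) x : open U -> U x ->
  exists E : seq K, forall y : jets X 0, (forall h, h \in E -> center y h) -> U y.
Proof.
move=> [B sB <-] [V BV Vx]; have [D sD DV] := sB _ BV.
suff [E EV] : exists E : seq K, forall y : jets X 0,
    (forall h, h \in E -> center y h) -> V y.
  by exists E => y /EV Vy; exists V.
have DE W : W \in D -> exists E : seq K, forall y : jets X 0,
    (forall h, h \in E -> center y h) -> W y.
  move=> WD; have /set_mem[n [P [f [i WE]]]] := sD _ WD.
  have : W x by move: Vx; rewrite -DV; apply.
  by rewrite WE; apply: basic_open_regular.
have [E EE] : exists E : seq K, forall W, W \in enum_fset D -> forall y : jets X 0,
    (forall h, h \in E -> center y h) -> W y.
  elim: (enum_fset D) (fun W (H : W \in enum_fset D) => DE W H) => [|W s IHs] sE.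
    by exists [::].
  have [E1 E1W] := sE W (mem_head _ _).
  have [|E2 E2s] := IHs; first by move=> W' W's; apply: sE; rewrite inE W's orbT.
  exists (E1 ++ E2) => W'; rewrite inE => /orP[/eqP->|/E2s W's] y yE.
    by apply: E1W => h hE; apply: yE; rewrite mem_cat hE.
  by apply: W's => h hE; apply: yE; rewrite mem_cat hE orbT.
by exists E => y yE; rewrite -DV => W /= WD; apply: EE yE.
Qed.

End BasicOpenPoints.

Section ValuationOfCylinder.
Variables (k : closedFieldType) (X : variety k).
Local Notation K := (funfield X).
Local Notation sc := (scal X).
Local Notation gen := (alg_gen sc).
Hypothesis char0 : [pchar K] =i pred0.
Hypothesis smoothX : smooth X.
Variables (C : set (arcs X)) (m : nat).
Hypothesis irrC : irreducible_set C.
Hypothesis Csat : forall g h, C g -> psi m h = psi m g -> C h.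
Implicit Types (f : K) (g : arcs X).
Local Notation gord := (generic_order C).

Lemma center_fraction g f : exists a b, [/\ center g a, center g b, b != 0 & f = a / b].
Proof.
have [A [[affA _] Ag]] := point_chart (centerP g).
have sA := affine_alg_subalg affA; have [_ /(_ f)[a [b [Aa Ab b0 ->]]]] := affA.
by exists a, b; split=> //; apply: (sub_closed_point sA Ag).
Qed.

Lemma generic_order_add f h e e' n : f + h != 0 -> gord f e -> gord h e' ->
  gord (f + h) n -> (Order.min e e' <= n)%E.
Proof.
move=> fh0 fe he' fhn.
have /generically_ex[g Cg [[gf fE] [[gh hE] [gfh <-]]]] :=
  generically_and irrC fe (generically_and irrC he' fhn).
rewrite pullD// -fE -hE; case: (ord_tP (pull g f)) => [->|i fi _].
  by rewrite add0r ge_min lexx orbT.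
case: (ord_tP (pull g h)) => [->|j hj _].
  by rewrite addr0 ge_min; apply/orP; left; apply/ord_t_ge.
have [ij|/ltnW ji] := leqP i j.
  rewrite ge_min; apply/orP; left; apply/ord_t_ge; apply: ord_geD => //.
  exact: ord_geW hj.
rewrite ge_min; apply/orP; right; apply/ord_t_ge; apply: ord_geD => //.
exact: ord_geW fi.
Qed.

(** The generic order is a natural number on the nonzero elements of the local ring at one fixed
    centre; [w] extends it to fractions. In the quotient rule the numerator loses m+1 and the
    denominator b^2 accounts for 2 w(b), so the bound for derivations keeps its constant. *)
Lemma cylinder_valuation : exists w : K -> int, [/\ int_valuation sc w,
  (forall f g, C g -> center g f -> f != 0 -> gord f (w f)%:E) &
  exists n (D : 'I_n -> K -> K) (c : int),
    (forall d, derivation sc d -> exists a : 'I_n -> K,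
      forall f, d f = \sum_i a i * D i f) /\
    forall i f, f != 0 -> val_ge w (w f - c) (D i f)].
Proof.
have [g0 Cg0] := irrC.1; have s0 := center_subalg g0; pose O := center g0.
have /choice[w0 w0E] : forall a, exists n : nat, O a -> a != 0 -> gord a n%:Z%:E.
  move=> a; have [Oa|] := pselect (O a); last by exists 0%N.
  have [->|a0] := eqVneq a 0; first by exists 0%N => _ /eqP.
  by have [n] := generic_order_finite char0 smoothX irrC Csat Cg0 Oa a0; exists n.
have w0u a (n : nat) : O a -> a != 0 -> gord a n%:Z%:E -> w0 a = n.
  by move=> Oa a0 /(generic_order_inj irrC (w0E a Oa a0))[].
have w0M a b : O a -> O b -> a != 0 -> b != 0 -> w0 (a * b) = (w0 a + w0 b)%N.
  move=> Oa Ob a0 b0; apply: w0u; [exact: (subalgM s0)|by rewrite mulf_neq0|].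
  by have := generic_orderM irrC (w0E a Oa a0) (w0E b Ob b0); rewrite -EFinD -PoszD.
have w0D a b : O a -> O b -> a != 0 -> b != 0 -> a + b != 0 ->
    (minn (w0 a) (w0 b) <= w0 (a + b)%R)%N.
  move=> Oa Ob a0 b0 ab0; have Oab : O (a + b) by apply: (subalgD s0).
  have := generic_order_add ab0 (w0E a Oa a0) (w0E b Ob b0) (w0E _ Oab ab0).
  by rewrite -EFin_min lee_fin minEge; case: ifP => _; rewrite lez_nat geq_min => ->; rewrite ?orbT.
have /choice[num numE] := center_fraction g0.
have /choice[den denE] : forall f, exists b, [/\ O (num f), O b, b != 0 & f = num f / b].
  by move=> f; have [b] := numE f; exists b.
pose w f : int := (w0 (num f))%:Z - (w0 (den f))%:Z.
have wE a b : O a -> O b -> a != 0 -> b != 0 -> w (a / b) = (w0 a)%:Z - (w0 b)%:Z.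
  move=> Oa Ob a0 b0; have [On Od d0 E] := denE (a / b).
  have n0 : num (a / b) != 0.
    have ab0 : a / b != 0 by rewrite mulf_neq0 ?invr_eq0.
    by apply: contraNneq ab0 => n0; rewrite E n0 mul0r.
  have : a * den (a / b) = num (a / b) * b.
    by apply/eqP; rewrite -eqr_div//; apply/eqP.
  move/(congr1 w0); rewrite !w0M// /w; lia.
have wO a : O a -> a != 0 -> w a = (w0 a)%:Z.
  move=> Oa a0; rewrite -[a in LHS]divr1 wE ?oner_eq0//; last exact: (subalg1 s0).
  suff -> : w0 1 = 0%N by rewrite subr0.
  apply: w0u; rewrite ?oner_eq0//; first exact: (subalg1 s0).
  by have := generic_order_const irrC (oner_neq0 k); rewrite rmorph1.
have frac f : f != 0 -> exists a b, [/\ O a, O b, a != 0, b != 0 & f = a / b].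
  move=> f0; have [a [b [Oa Ob b0 E]]] := center_fraction g0 f; exists a, b.
  by split=> //; apply: contraNneq f0 => a0; rewrite E a0 mul0r.
have wV : int_valuation sc w.
  split=> [f h f0 h0|f h f0 h0 fh0|c c0].
  - have [a [b [Oa Ob a0 b0 ->]]] := frac f f0.
    have [a' [b' [Oa' Ob' a'0 b'0 ->]]] := frac h h0.
    have -> : a / b * (a' / b') = (a * a') / (b * b') by field; rewrite b0 b'0.
    rewrite !wE ?mulf_neq0// ?w0M//; first by lia.
      exact: (subalgM s0).
    exact: (subalgM s0).
  - have [a [b [Oa Ob a0 b0 fE]]] := frac f f0.
    have [a' [b' [Oa' Ob' a'0 b'0 hE]]] := frac h h0.
    have fE' : f = (a * b') / (b * b') by rewrite fE; field; rewrite b0 b'0.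
    have hE' : h = (a' * b) / (b * b') by rewrite hE; field; rewrite b0 b'0.
    have E : f + h = (a * b' + a' * b) / (b * b') by rewrite mulrDl -fE' -hE'.
    have Oab : O (a * b') by apply: (subalgM s0).
    have Oab' : O (a' * b) by apply: (subalgM s0).
    have Obb : O (b * b') by apply: (subalgM s0).
    have bb0 : b * b' != 0 by rewrite mulf_neq0.
    have ab0 : a * b' != 0 by rewrite mulf_neq0.
    have ab'0 : a' * b != 0 by rewrite mulf_neq0.
    have n0 : a * b' + a' * b != 0.
      by apply: contraNneq fh0 => n0; rewrite E n0 mul0r.
    rewrite E {1}fE' {1}hE' !wE//; last exact: (subalgD s0).
    have := w0D _ _ Oab Oab' ab0 ab'0 n0; rewrite geq_min ge_min.
    by rewrite !lerD2r !lez_nat.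
  - have Oc : O (sc c) by case: s0 => + _ _; apply.
    have sc0 : sc c != 0 by rewrite fmorph_eq0.
    by rewrite wO// (w0u _ 0%N)//; apply: generic_order_const.
exists w; split=> // [f g Cg gf f0|].
  have [a [b [Oa Ob a0 b0 fE]]] := frac f f0.
  have := generically_and irrC (generically_center Cg gf)
    (generically_and irrC (w0E a Oa a0) (w0E b Ob b0)).
  apply: generically_imp => h _ [hf [[ha aE] [hb bE]]]; split=> //.
  have : ord_t (pull h f) + ord_t (pull h b) = ord_t (pull h a) :> \bar int.
    by rewrite -ord_tM -pullM// fE divfK.
  rewrite aE bE fE wE//; case: ord_tP => [_|i _ _]; first by rewrite /=.
  by rewrite -EFinD => -[] ij; congr EFin; lia.
have [n [D [Dst DO Dspan _]]] := cylinder_derivations char0 smoothX irrC Cg0.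
exists n, D, m.+1%:Z; split=> // i.
have DDi : derivation sc (D i) by case: (Dst i).
have DvalO a : O a -> a != 0 -> val_ge w (w a - m.+1%:Z) (D i a).
  move=> Oa a0; have [->|Da0] := eqVneq (D i a) 0; first by left.
  have ODa := DO i a Oa; right; rewrite !wO//.
  have := generic_order_derivation char0 irrC Csat (Dst i) (w0E a Oa a0) (w0E _ ODa Da0).
  by rewrite -EFinD lee_fin; lia.
move=> f f0; have [a [b [Oa Ob a0 b0 ->]]] := frac f f0.
rewrite (der_div _ DDi b0).
have -> : w (a / b) - m.+1%:Z = (w b + (w a - m.+1%:Z)) - (w b + w b).
  by rewrite (val_div wV)//; lia.
apply: (val_geM wV); last first.
  by right; rewrite (valV wV) ?expf_neq0// (valXn wV)//; lia.
apply: (val_geD wV).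
  by apply: (val_geM wV); [right|exact: DvalO].
apply: (val_geN wV); have -> : w b + (w a - m.+1%:Z) = w a + (w b - m.+1%:Z) by lia.
by apply: (val_geM wV); [right|exact: DvalO].
Qed.

Lemma center_val_ge0 (w : K -> int) g :
  (forall f g, C g -> center g f -> f != 0 -> gord f (w f)%:E) ->
  C g -> center g `<=` val_ge w 0.
Proof.
move=> wE Cg f gf; have [->|f0] := eqVneq f 0; first by left.
have /generically_ex[h _ [_]] := wE f g Cg gf f0.
by case: ord_tP => // l _ _ [] wl; right; rewrite -wl.
Qed.

(* A nonempty open subset of X missed by C contains all points where some
   finite set E of rational functions is regular; a common denominator of E
   vanishes along C. *)
Lemma not_dominating_positive (w : K -> int) :
  (forall f g, C g -> center g f -> f != 0 -> gord f (w f)%:E) ->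
  ~ dominating C -> exists2 f, f != 0 & 0 < w f.
Proof.
move=> wE ndom.
have [E Emiss] : exists E : seq K, forall g, C g -> ~ forall f, f \in E -> center g f.
  apply: contrapT => noE; apply: ndom => U [x Ux] oU.
  apply: contrapT => UC; have [E EU] := open_regular oU Ux.
  apply: noE; exists E => g Cg gE; apply: UC; exists (psi 0 g).
  by split; [exact: EU|exists g].
have [g0 Cg0] := irrC.1; have s0 := center_subalg g0.
have [A [[affA _] Ag]] := point_chart (centerP g0).
have [a AE aK] := affine_generators affA; subst A; set A := gen [set` a] in affA aK Ag *.
have sA : subalgebra sc A by exact: alg_gen_subalg.
have AO : A `<=` center g0 by apply: sub_closed_point.
have [b [Ab b0 bE]] := common_denominator E sA aK.
exists b => //; have ob := wE b g0 Cg0 (AO _ Ab) b0.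
have /generically_ex[g Cg [gA [gb bo]]] :=
  generically_and irrC (generically_subalg irrC Cg0 AO) ob.
have [pb0|pb0] := eqVneq (pull g b 0%N) 0; last first.
  case: (Emiss g Cg) => f fE; have [_ gbi] := arc_unit gb pb0.
  rewrite -(mulfK b0 f); apply: (subalgM (center_subalg g)) => //.
  by apply: gA; apply: bE.
move: bo pb0; case: ord_tP => [//|n _ bn [nw] pb0]; rewrite -nw.
by case: n bn {nw} => //; rewrite pb0 eqxx.
Qed.

End ValuationOfCylinder.

(** * Blow-ups and contact loci *)

Section NormalizedValuations.
Variables (k : closedFieldType) (K : fieldType) (iota : {rmorphism k -> K}).
Implicit Types (v w : K -> int) (f g u : K).

(** The least positive value generates the value group: a nonzero remainder of a Euclidean division
    by it would be a smaller positive value, attained at f times a power of u. *)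
Lemma normalize_valuation v : int_valuation iota v ->
  (exists2 f, f != 0 & 0 < v f) -> exists (c : nat) w u, [/\ (0 < c)%N,
    int_valuation iota w, forall f, f != 0 -> v f = c%:Z * w f, u != 0 & w u = 1].
Proof.
move=> vV [f0 f00 vf0]; pose Q n := `[< exists f, f != 0 /\ v f = n.+1%:Z >].
have QE f : f != 0 -> 0 < v f -> exists2 n, Q n & v f = n.+1%:Z.
  move=> fn0 vf; have E : v f = (absz (v f)).-1.+1%:Z by lia.
  by exists (absz (v f)).-1 => //; apply/asboolP; exists f.
have exQ : exists n, Q n by have [n Qn _] := QE f0 f00 vf0; exists n.
case: (ex_minnP exQ) => c /asboolP[u [u0 vu]] cmin.
pose q f := (v f %/ c.+1%:Z)%Z.
have vE f : f != 0 -> v f = c.+1%:Z * q f.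
  move=> fn0; have E := divz_eq (v f) c.+1%:Z; rewrite -/(q f) in E.
  have r0 : 0 <= (v f %% c.+1%:Z)%Z by rewrite modz_ge0.
  have rc : (v f %% c.+1%:Z)%Z < c.+1%:Z by rewrite ltz_pmod.
  suff r00 : (v f %% c.+1%:Z)%Z = 0 by rewrite {1}E r00 addr0 mulrC.
  apply/eqP; rewrite eq_le r0 andbT leNgt; apply/negP => rpos.
  move: {r0} (v f %% c.+1%:Z)%Z E rc rpos => r E rc rpos.
  have [h [h0 vh]] : exists h, h != 0 /\ v h = r.
    case: (q f) E => j E.
      exists (f / u ^+ j); split; first by rewrite mulf_neq0 ?invr_eq0 ?expf_neq0.
      by rewrite (val_div vV) ?expf_neq0// (valXn vV)// vu E; lia.
    exists (f * u ^+ j.+1); split; first by rewrite mulf_neq0 ?expf_neq0.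
    by rewrite (valM vV) ?expf_neq0// (valXn vV)// vu E NegzE; lia.
  have [|n Qn vhn] := QE h h0; first by rewrite vh.
  by have := cmin n Qn; move: rc; rewrite -vh vhn; lia.
exists c.+1, q, u; split=> //; last by rewrite /q vu divzz.
have cinj (x y : int) : c.+1%:Z * x = c.+1%:Z * y -> x = y by apply: mulfI.
split=> [f g fn0 gn0|f g fn0 gn0 fgn0|a a0].
- apply: cinj; rewrite -vE ?mulf_neq0// (valM vV)// mulrDr !vE//.
- have cpos : 0 < c.+1%:Z :> int by [].
  rewrite -(ler_pM2l cpos) minr_pMr// -!vE//; first by case: vV => _ + _; apply.
- by apply: cinj; rewrite mulr0 -vE ?(valC vV)// fmorph_eq0.
Qed.

Definition extended_val w (f : K) : \bar int := if f == 0 then +oo%E else (w f)%:E.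

Lemma extended_valE w f : f != 0 -> extended_val w f = (w f)%:E.
Proof. by rewrite /extended_val => /negPf ->. Qed.

Lemma extended_val0 w : extended_val w 0 = +oo%E.
Proof. by rewrite /extended_val eqxx. Qed.

Lemma extended_valuation w : int_valuation iota w -> valuation iota (extended_val w).
Proof.
move=> wV; split=> [f|f|f g|f g|c c0].
- by rewrite /extended_val; case: eqP => f0; split=> // /f0.
- by rewrite /extended_val; case: (f == 0).
- have [->|f0] := eqVneq f 0; first by rewrite mul0r extended_val0 /extended_val; case: eqP.
  have [->|g0] := eqVneq g 0; first by rewrite mulr0 extended_val0 extended_valE.
  by rewrite !extended_valE ?mulf_neq0// (valM wV).
- have [->|f0] := eqVneq f 0; first by rewrite add0r ge_min lexx orbT.
  have [->|g0] := eqVneq g 0; first by rewrite addr0 ge_min lexx.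
  have [->|fg0] := eqVneq (f + g) 0; first by rewrite extended_val0 leey.
  rewrite !extended_valE// -EFin_min lee_fin.
  by case: wV => _ + _; apply.
- by rewrite extended_valE ?fmorph_eq0// (valC wV).
Qed.

Lemma extended_val_ge w n f : (n%:E <= extended_val w f)%E <-> val_ge w n f.
Proof.
have [->|f0] := eqVneq f 0; first by rewrite extended_val0 leey; split=> // _; left.
by rewrite extended_valE// lee_fin val_geE.
Qed.

Lemma val_ge_maximal_prime w (B : set K) : int_valuation iota w ->
  subalgebra iota B -> B `<=` val_ge w 0 ->
  prime_ideal B [set f | B f /\ val_ge w 1 f].
Proof.
move=> wV sB BD; split.
- split=> [f []//||f g [Bf f1] [Bg g1]|a f Ba [Bf f1]].
  + by split; [exact: (subalg0 sB)|left].
  + by split; [exact: (subalgD sB)|exact: (val_geD wV)].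
  + split; first exact: (subalgM sB).
    by rewrite -[1]add0r; apply: (val_geM wV) => //; apply: BD.
- by move=> [_ [/eqP|]]; rewrite ?oner_eq0// (val1 wV).
- move=> f g Bf Bg [_ fg1]; apply: contrapT => /not_orP[nf ng].
  have f0 : f != 0.
    by apply: contra_notN nf => /eqP f0; split; [exact: Bf|left].
  have g0 : g != 0.
    by apply: contra_notN ng => /eqP g0; split; [exact: Bg|left].
  move: fg1; rewrite val_geE ?mulf_neq0// (valM wV)//.
  have wf : ~ 1 <= w f by move=> ?; apply: nf; split=> //; right.
  have wg : ~ 1 <= w g by move=> ?; apply: ng; split=> //; right.
  lia.
Qed.

(** A nonzero prime contains a power of u, hence u and all elements of positive value; a strictly
    larger ideal contains a unit. *)
Lemma valuation_ring_krull_dim w u : int_valuation iota w -> u != 0 -> w u = 1 ->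
  krull_dim (val_ge w 0) 1.
Proof.
move=> wV u0 wu; have sD := val_ring_subalg wV; set D := val_ge w 0 in sD *.
have Du : D u by right; rewrite wu.
have D1 : [set f | D f /\ val_ge w 1 f] = val_ge w 1.
  by apply/seteqP; split=> f; [case|move=> f1; split=> //; apply: val_geW f1].
have unit f : D f -> ~ val_ge w 1 f -> f != 0 /\ D f^-1.
  move=> Df f1; have f0 : f != 0 by apply: contra_notN f1 => /eqP ->; left.
  split=> //; right; rewrite (valV wV)//; move: Df; rewrite /D val_geE// => wf.
  have : ~ 1 <= w f by move=> ?; apply: f1; right.
  lia.
split.
  exists (fun i => if i == 0%N then [set 0] else val_ge w 1); split.
    move=> [|i] _ /=; last by rewrite -D1; apply: val_ge_maximal_prime.
    split; [split=> [_ ->|//|_ _ -> ->|a _ _ ->]|move/eqP|move=> f g _ _ /eqP].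
    - exact: (subalg0 sD).
    - by rewrite addr0.
    - by rewrite mulr0.
    - by rewrite oner_eq0.
    - by rewrite mulf_eq0 => /orP[/eqP->|/eqP->]; [left|right].
  move=> [|//] _ /=; split=> [_ ->|/(_ u)]; first by left.
  by move=> /(_ (or_intror _)); rewrite wu => /(_ (lexx _))/eqP; apply/negP.
move=> [P [PP Plt]].
have [x P1x x0] : exists2 x, P 1%N x & x != 0.
  have [_ nP] := Plt 0%N isT; apply: contrapT => no; apply: nP => x P1x.
  have [->|x0] := eqVneq x 0; last by case: no; exists x.
  by have [[_ + _ _] _ _] := PP 0%N isT; apply.
have [[P1D _ _ P1M] P11 P1p] := PP 1%N isT.
have [[P2D _ _ P2M] P21 _] := PP 2%N isT.
have P1u : P 1%N u.
  have Dx := P1D _ P1x; have wx : 0 <= w x by move: Dx; rewrite /D val_geE.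
  have P1un : P 1%N (u ^+ `|w x|%N).
    rewrite -(divfK x0 (u ^+ _)); apply: P1M => //; right.
    by rewrite (val_div wV) ?expf_neq0// (valXn wV)// wu; lia.
  elim: `|w x|%N P1un => [|n IHn]; first by rewrite expr0.
  by rewrite exprS => /P1p[//||//|/IHn//]; exact: (subalgX _ sD).
have [_ nP] := Plt 1%N isT; apply: nP => y P2y.
have Dy := P2D _ P2y; have [y1|ny1] := pselect (val_ge w 1 y).
  rewrite -(divfK u0 y); apply: P1M => //.
  rewrite /D -(subrr 1); apply: (val_geM wV) => //.
  by right; rewrite (valV wV)// wu.
have [y0 Dyi] := unit y Dy ny1; case: P21.
by rewrite -(mulVf y0); apply: P2M.
Qed.

End NormalizedValuations.

Section IrreducibleComponents.
Variable T : topologicalType.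
Implicit Types A W : set T.

(** Holds in any space by Zorn's lemma: irreducibility concerns two points at a time, and two points
    of the union of a chain lie in a common member. *)
Lemma irreducible_component_exists A W : irreducible_set W -> W `<=` A ->
  exists2 Z, irreducible_component A Z & W `<=` Z.
Proof.
move=> irrW WA; pose P S := irreducible_set (W `|` S) /\ W `|` S `<=` A.
have [F FP Ftot|S [[irrS SA] Smax]] := @Zorn_bigcup _ P.
  have P0 : P set0 by rewrite /P setU0.
  split; last first.
    move=> x [/WA//|[S FS Sx]]; have [_ SA] := FP _ FS.
    by apply: SA; right.
  split; first by have [x Wx] := irrW.1; exists x; left.
  move=> U V oU oV [x [Wx Ux]] [y [Wy Vy]].
  have [S PS [SF [Sx Sy]]] : exists2 S, P S & S `<=` \bigcup_(S in F) S /\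
      ((W `|` S) x /\ (W `|` S) y).
    case: Wx Wy => [Wx|[S FS Sx]] [Wy|[S' FS' Sy]].
    - by exists set0 => //; split; [exact: sub0set|split; left].
    - by exists S'; [exact: FP|split; [exact: bigcup_sup|split; [left|right]]].
    - by exists S; [exact: FP|split; [exact: bigcup_sup|split; [right|left]]].
    - have [SS|SS] := Ftot _ _ FS FS'.
        exists S'; [exact: FP|split; [exact: bigcup_sup|]].
        by split; right => //; apply: SS.
      exists S; [exact: FP|split; [exact: bigcup_sup|]].
      by split; right => //; apply: SS.
  have [[_ +] _] := PS => /(_ U V oU oV)[||z [Wz UVz]].
  - by exists x.
  - by exists y.
  - exists z; split=> //; case: Wz => [|/SF]; [by left|by right].
exists (W `|` S); last by move=> x; left.
split=> // Z irrZ ZA WSZ; apply/seteqP; split=> //.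
have [WZ SZ] : W `<=` Z /\ S `<=` Z by split=> x ?; apply: WSZ; [left|right].
have [ZS|nZS] := pselect (Z `<=` S); first by move=> x /ZS; right.
by case: (Smax Z); [split|rewrite /P; have /setUidPr -> := WZ].
Qed.

End IrreducibleComponents.

Section ContactOrder.
Variable k : closedFieldType.
Implicit Types s e : pseries k.

Lemma pseries_inv e : e 0%N != 0 -> exists e', e * e' = 1.
Proof.
move=> e0; pose h := 1 - (e 0%N)^-1 *: e.
have h1 : ord_ge 1 h.
  move=> i; rewrite ltnS leqn0 => /eqP->.
  by rewrite /h pseries_coefD pseries_coefN pseries_coefZ pseries_coef1 mulVf// subrr.
have eE : e = e 0%N *: (1 - h) by rewrite opprB addrC subrK scalerA divff// scale1r.
suff [h' hh'] : exists h', (1 - h) * h' = 1.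
  exists ((e 0%N)^-1 *: h'); rewrite {1}eE -scalerAl -scalerAr scalerA divff//.
  by rewrite scale1r.
(* The geometric series in h, as the value at h of the series with all coefficients 1. *)
exists (eval_pseries h (fun=> 1)); apply/funext => l.
rewrite (@pseries_coefM_congr _ l.+1 _ (1 - h) _ (\sum_(j < l.+1) h ^+ j))//.
  have := subrX1 h l.+1; move/(congr1 -%R); rewrite opprB -mulNr opprB => <-.
  rewrite pseries_coefD pseries_coefN (_ : (h ^+ l.+1) l = 0) ?subr0//.
  by apply: (@ord_geX _ 1 h l.+1 h1); rewrite muln1.
move=> i il; rewrite (eval_pseries_trunc _ h1 il) horner_poly.
by congr (_ i); apply: eq_bigr => j _; rewrite mul1r.
Qed.

Lemma ord_ge_divisible p s : ord_ge p s ->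
  exists s', s = pseries_t k ^+ p * s' /\ s' 0%N = s p.
Proof.
move=> sp; exists (fun n => s (p + n)%N); split; last by rewrite addn0.
apply/funext => n; have [np|pn] := ltnP n p.
  by rewrite sp// (ord_geM (@pseries_t_ord _ p) (@ord_ge0 _ _))// addn0.
rewrite pseries_coefM; have pn' : (p < n.+1)%N by rewrite ltnS.
rewrite (bigD1 (Ordinal pn'))//= pseries_tX_coef eqxx mul1r subnKC// big1 ?addr0//.
by move=> i ip; rewrite pseries_tX_coef; have /negPf -> : (i : nat) != p by []; rewrite mul0r.
Qed.

Lemma ideal_gen_tX p (S : set (pseries k)) :
  (forall s, S s -> ord_ge p s) -> (exists2 s, S s & s p != 0) ->
  ideal_gen setT S = ideal_gen setT [set pseries_t k ^+ p].
Proof.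
move=> Sp [s Ss sp0]; apply/seteqP; split=> x xS I [II].
- move=> tI; apply: xS; split=> // y Sy; have [y' [-> _]] := ord_ge_divisible (Sp y Sy).
  by rewrite mulrC; case: II => _ _ _; apply=> //; apply: tI.
- move=> SI; apply: xS; split=> // _ ->; have [e [sE e0]] := ord_ge_divisible (Sp s Ss).
  have [|e' ee'] := @pseries_inv e; first by rewrite e0.
  rewrite -[pseries_t k ^+ p]mulr1 -ee' mulrA -sE mulrC.
  by case: II => _ _ _; apply=> //; apply: SI.
Qed.

Lemma ideal_gen_tX_ord p (S : set (pseries k)) s :
  ideal_gen setT S = ideal_gen setT [set pseries_t k ^+ p] -> S s -> ord_ge p s.
Proof.
move=> SE Ss; have : ideal_gen setT S s by move=> I [_]; apply.
rewrite SE; apply; split=> [|_ ->]; last exact: pseries_t_ord.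
split=> //= [x y|x y _ yp]; first exact: ord_geD.
by rewrite -[p]add0n; apply: ord_geM.
Qed.

Lemma exact_ordM m n s s' : ord_ge m s /\ s m != 0 -> ord_ge n s' /\ s' n != 0 ->
  ord_ge (m + n) (s * s') /\ (s * s') (m + n)%N != 0.
Proof.
move=> [sm s0] [sn s'0]; split; first exact: ord_geM.
by rewrite ord_ge_coefM// mulf_neq0.
Qed.

Lemma exact_ordX m n s : ord_ge m s /\ s m != 0 ->
  ord_ge (n * m) (s ^+ n) /\ (s ^+ n) (n * m)%N != 0.
Proof.
move=> sm; elim: n => [|n IHn].
  by rewrite mul0n expr0; split=> //; rewrite pseries_coef1 oner_neq0.
by rewrite exprS mulSn; apply: exact_ordM.
Qed.

Lemma exact_ord_inj m n s : ord_ge m s /\ s m != 0 -> ord_ge n s /\ s n != 0 -> m = n.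
Proof.
move=> [sm s0] [sn s'0]; have [mn|nm|//] := ltngtP m n.
  by move: s0; rewrite sn ?eqxx.
by move: s'0; rewrite sm ?eqxx.
Qed.

End ContactOrder.

Section ValuationSheaves.
Variables (k : closedFieldType) (X : variety k).
Local Notation K := (funfield X).
Local Notation sc := (scal X).
Local Notation gen := (alg_gen sc).
Variable v : K -> int.
Hypothesis vV : int_valuation sc v.
Implicit Types (f : K) (A O M : set K) (q : nat).

(* The ideal sheaf of functions of value at least q; it is trivial at the points
   outside of the closure of the centre of v. *)
Definition valuation_ideal q (O : set K) : set K :=
  [set f | O f /\ (O `<=` val_ge v 0 -> val_ge v q%:Z f)].

Lemma valuation_ideal_ideal q A : subalgebra sc A -> ideal A (valuation_ideal q A).
Proof.
move=> sA; split=> [f []//||f h [Af fq] [Ah hq]|a f Aa [Af fq]].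
- by split; [exact: (subalg0 sA)|left].
- by split=> [|AD]; [exact: (subalgD sA)|apply: (val_geD vV); auto].
- split=> [|AD]; first exact: (subalgM sA).
  by rewrite -[q%:Z]add0r; apply: (val_geM vV); auto.
Qed.

(** If v is non-negative on O, denominators are cleared. If it is so on A but not on O, some s in A
    that is a unit of O has positive value, and s^q is in the ideal, which therefore generates O. If
    v takes a negative value on A, the ideal is all of A. *)
Lemma valuation_ideal_sheaf_on q A : affine_open A ->
  sheaf_on (valuation_ideal q) A (valuation_ideal q A).
Proof.
move=> [affA _]; have sA := affine_alg_subalg affA.
split=> [|O [M maxM OE]]; first exact: valuation_ideal_ideal.
have PM := maximal_ideal_prime sA maxM.
have sO : subalgebra sc O by rewrite OE; apply: localize_subalg.
have AO : A `<=` O by rewrite OE; apply: (sub_localize sA); case: maxM.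
have IO : valuation_ideal q A `<=` O by move=> f [/AO].
have [GO _ _ GM] := ideal_gen_ideal sO IO.
have [OD|nOD] := pselect (O `<=` val_ge v 0).
  have AD := subset_trans AO OD; apply/seteqP; split=> [f [Of fq]|]; last first.
    apply: ideal_gen_min; first exact: valuation_ideal_ideal.
    by move=> f [Af fq]; split=> [|_]; [exact: AO|exact: fq].
  move: (Of); rewrite {1}OE => -[a [s [Aa As Ms fE]]].
  have s0 : s != 0 by apply: contra_notN Ms => /eqP->; case: PM => -[].
  have Osi : O s^-1 by rewrite OE; apply: (localizeV sA).
  rewrite fE mulrC; apply: GM => //; apply: ideal_gen_in; split=> // _.
  have -> : a = s * f by rewrite fE mulrC divfK.
  by rewrite -[q%:Z]add0r; apply: (val_geM vV); [apply: AD|apply: fq].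
have -> : valuation_ideal q O = O.
  by apply/seteqP; split=> [f []//|f Of]; split=> // /nOD.
apply/seteqP; split=> [f Of|]; last exact: GO.
rewrite -[f]mulr1; apply: (GM) => //.
have [AD|nAD] := pselect (A `<=` val_ge v 0); last first.
  by apply: ideal_gen_in; split=> [|/nAD//]; exact: (subalg1 sA).
have [h Oh hneg] : exists2 h, O h & ~ val_ge v 0 h.
  by apply: contrapT => no; apply: nOD => h Oh; apply: contrapT => nh; apply: no; exists h.
move: (Oh); rewrite {1}OE => -[a [s [Aa As Ms hE]]].
have s0 : s != 0 by apply: contra_notN Ms => /eqP->; case: PM => -[].
have Osi : O s^-1 by rewrite OE; apply: (localizeV sA).
have vs : 0 < v s.
  rewrite ltNge; apply/negP => vs; apply: hneg; rewrite hE -[0]addr0.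
  apply: (val_geM vV); first exact: AD.
  by right; rewrite (valV vV)//; lia.
rewrite -(mulVf (expf_neq0 q s0)) -exprVn; apply: GM; first exact: (subalgX _ sO).
apply: ideal_gen_in; split=> [|_]; first exact: (subalgX _ sA).
by right; rewrite (valXn vV)//; nia.
Qed.

Lemma valuation_ideal_sheaf q : ideal_sheaf (valuation_ideal q).
Proof.
move=> O /point_chart[A [Aopen AO]].
by exists A, (valuation_ideal q A); split=> //; apply: valuation_ideal_sheaf_on.
Qed.

End ValuationSheaves.

Section BlowupCharts.
Variables (k : closedFieldType) (K : fieldType) (iota : {rmorphism k -> K}).

(** As I is finitely generated, finitely many of the fractions h/g suffice. *)
Lemma blowup_chart_finite (A I : set K) g : affine_alg iota A -> ideal A I ->
  affine_alg iota (alg_gen iota (A `|` [set h / g | h in I])).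
Proof.
move=> [[a AE] aK] II; set B := alg_gen iota _.
have AB : A `<=` B by move=> f Af; apply: alg_gen_in; left.
split; last first.
  move=> f; have [b [c [Ab Ac c0 ->]]] := aK f.
  by exists b, c; split=> //; apply: AB.
have [t [tI It]] : exists s : seq K, [set` s] `<=` I /\ I `<=` ideal_gen A [set` s].
  by move: II; rewrite AE; exact: alg_gen_noetherian.
have sA : subalgebra iota A by rewrite AE; apply: alg_gen_subalg.
exists (a ++ [seq h / g | h <- t]).
set s := a ++ _; have sG : subalgebra iota (alg_gen iota [set` s]).
  exact: alg_gen_subalg.
have AG : A `<=` alg_gen iota [set` s].
  by rewrite AE; apply: alg_gen_sub => f /= fa; rewrite mem_cat fa.
apply/seteqP; split; [apply: (alg_gen_min sG)|apply: (alg_gen_min (alg_gen_subalg iota _))].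
- move=> f [/AG//|[h Ih <-]].
  have [_ /(_ h)] : ideal A [set h | A h /\ alg_gen iota [set` s] (h / g)] /\
      I `<=` [set h | A h /\ alg_gen iota [set` s] (h / g)]; last by case.
    have J : ideal A [set h | A h /\ alg_gen iota [set` s] (h / g)].
      split=> [x []//||x y [Ax Gx] [Ay Gy]|b x Ab [Ax Gx]].
      - split; first exact: (subalg0 sA).
        by rewrite mul0r; apply: (subalg0 sG).
      - split; first exact: (subalgD sA).
        by rewrite mulrDl; apply: (subalgD sG).
      - split; first exact: (subalgM sA).
        by rewrite -mulrA; apply: (subalgM sG) => //; apply: AG.
    split=> //; apply: subset_trans It _; apply: ideal_gen_min => // x tx.
    split; first by case: II => + _ _ _; apply; apply: tI.
    apply: alg_gen_in => /=; rewrite mem_cat; apply/orP; right.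
    by apply/mapP; exists x.
- move=> f /=; rewrite mem_cat => /orP[fa|/mapP[x tx ->]].
    by apply: AB; rewrite AE; apply: alg_gen_in.
  by apply: alg_gen_in; right; exists x => //; apply: tI.
Qed.

End BlowupCharts.

Section ArcValuations.
Variables (k : closedFieldType) (X : variety k).
Local Notation K := (funfield X).
Local Notation sc := (scal X).
Implicit Types (v : K -> \bar int) (f : K) (C W : set (arcs X)).

Lemma generically_is_val_of C (w : K -> int) : int_valuation sc w ->
  (forall f g, C g -> center g f -> f != 0 ->
    generic_order C f (w f)%:E) -> irreducible_set C ->
  is_val_of C (extended_val w).
Proof.
move=> wV wE irrC; split; first exact: extended_valuation.
move=> f [_ [g Cg <-] /= gf]; have [f0|f0] := eqVneq f 0; last first.
  have [U [oU CU UE]] := wE f g Cg gf f0; exists U; split=> // h [Ch Uh].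
  by have [hf hE] := UE h Ch Uh; rewrite extended_valE.
have [U [oU CU UE]] := generically_center Cg gf; exists U; split=> // h [Ch Uh].
by split; [exact: UE|rewrite f0 pull0 ord_t0 extended_val0].
Qed.

(** Two candidates agree on the functions regular at one centre, by a general arc common to both
    open sets, hence on all fractions of such functions. *)
Lemma arc_valE C v : irreducible_set C -> is_val_of C v -> arc_val C = v.
Proof.
move=> irrC vC; suff uniq u : is_val_of C u -> u = v.
  by rewrite /arc_val; apply: uniq; apply: (xgetI _ vC).
move=> uC; have [[u0 uNy uM _ _] uE] := uC; have [[v0 vNy vM _ _] vE] := vC.
have [g Cg] := irrC.1.
have same a : center g a -> u a = v a.
  move=> ga; have [|U [oU CU UE]] := uE a; first by exists (psi 0 g) => //; exists g.
  have [|V [oV CV VE]] := vE a; first by exists (psi 0 g) => //; exists g.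
  have [h [Ch [Uh Vh]]] := irrC.2 U V oU oV CU CV.
  by have [_ <-] := UE h (conj Ch Uh); have [_ <-] := VE h (conj Ch Vh).
apply/funext => f; have [f0|f0] := eqVneq f 0.
  by rewrite f0 (u0 0).2// (v0 0).2.
have [a [b [ga gb b0 fE]]] := center_fraction g f.
have ab0 : a / b <> 0 by rewrite -fE; apply/eqP.
have := vM (a / b) b; have := uM (a / b) b.
rewrite {f f0} fE divfK// same// (same b gb) => ->.
have : v b != +oo%E by apply/eqP => /v0; apply/eqP.
have := vNy b; case: (v b) => // r _ _.
have : u (a / b) != +oo%E by apply/eqP => /u0.
have := uNy (a / b); case: (u _) => // x _ _.
have : v (a / b) != +oo%E by apply/eqP => /v0.
have := vNy (a / b); case: (v _) => // y _ _.
by rewrite -!EFinD => -[] xy; congr EFin; lia.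
Qed.

End ArcValuations.

Section Main.
Variables (k : closedFieldType) (X : variety k).
Local Notation K := (funfield X).
Local Notation sc := (scal X).
Local Notation gen := (alg_gen sc).
Hypothesis char0 : [pchar K] =i pred0.
Hypothesis smoothX : smooth X.
Variables (C : set (arcs X)) (m : nat).
Hypothesis irrC : irreducible_set C.
Hypothesis Csat : forall g h, C g -> psi m h = psi m g -> C h.
Hypothesis ndomC : ~ dominating C.

(* D is the valuation ring of w, and A is the coordinate ring of an affine chart
   of X met by C; the generators of D are fractions h / g with h in the ideal of
   elements of A of value at least q = v g, so D is a local ring of the blow-up
   of that ideal. *)
Lemma cylinder_blowup : exists (v w : K -> int) (c q : nat) A g0 g,
  [/\ [/\ int_valuation sc v, int_valuation sc w, (0 < c)%N, (0 < q)%N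
        & forall f, f != 0 -> v f = c%:Z * w f],
      [/\ C g0, affine_open A, A `<=` center g0, A g
        & g != 0 /\ v g = q%:Z],
      forall f h, C h -> center h f -> f != 0 -> generic_order C f (v f)%:E,
      exists2 u, u != 0 & w u = 1 &
      forall f, val_ge w 0 f -> exists a b,
        let B := gen (A `|` [set h / g | h in valuation_ideal v q A]) in
        [/\ B a, B b, b != 0, w b = 0 & f = a / b]].
Proof.
have [v [vV vE [n [D [e [Dspan Dval]]]]]] :=
  cylinder_valuation char0 smoothX irrC Csat.
have vpos := not_dominating_positive irrC vE ndomC.
have [c [w [u [c0 wV vw u0 wu]]]] := normalize_valuation vV vpos.
(* Dividing the bound for v = c w by c gives the constant e/c, at most |e|. *)
have Dvalw i f : f != 0 -> val_ge w (w f - `|e|%N%:Z) (D i f).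
  move=> f0; have [->|Df0] := eqVneq (D i f) 0; first by left.
  have := Dval i f f0; rewrite !val_geE// !vw//; case: c c0 {vw} => // c _; nia.
have [s rs sres] := residual_basis char0 wV Dspan.
have Ralg := algebraic_over_residual_basis char0 wV Dspan Dvalw rs sres u0 wu.
have [g0 Cg0] := irrC.1.
have [A [Aopen Ag0]] := point_chart (centerP g0).
have [affA _] := Aopen; have sA := affine_alg_subalg affA.
have [a AE aK] := affine_generators affA.
have AO : A `<=` center g0 by apply: sub_closed_point.
have [|L [Lw LE]] := @valuation_ring_essentially_finite_type _ _ sc char0 w s a u
    wV rs u0 wu Ralg.
  by move=> f; rewrite -AE.
have [g1 [Ag1 g10 g1L]] := common_denominator L sA aK.
have AD : A `<=` val_ge v 0 by apply: subset_trans AO (center_val_ge0 vE Cg0).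
have [b [Ab b0 vb]] : exists b, [/\ A b, b != 0 & 0 < v b].
  have [f f0 vf] := vpos; have [x [y [Ax Ay y0 fE]]] := aK f.
  have x0 : x != 0 by apply: contraNneq f0 => x0; rewrite fE x0 mul0r.
  exists x; split=> //; move: vf; rewrite fE (val_div vV)//.
  by have := AD y Ay; rewrite val_geE//; lia.
(* The factor [g1] clears the denominators of the generators of the valuation ring; [b] makes v(g),
   and so the contact order q, positive. *)
pose g := g1 * b; have g0' : g != 0 by rewrite mulf_neq0.
have Ag : A g by apply: (subalgM sA).
have vg : 0 < v g.
  rewrite (valM vV)//; have := AD _ Ag1; rewrite val_geE//; lia.
have [q vgq q0] : exists2 q : nat, v g = q%:Z & (0 < q)%N.
  by move: vg; case: (v g) => // q; exists q.
exists v, w, c, q, A, g0, g; split=> //; first by exists u.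
have Lin : [set` L] `<=` gen (A `|` [set h / g | h in valuation_ideal v q A]).
  move=> l /= lL; apply: alg_gen_in; right; exists (l * g); last by rewrite mulfK.
  split=> [|_]; first by rewrite mulrA; apply: (subalgM sA) => //; apply: g1L.
  have [->|l0] := eqVneq l 0; first by rewrite mul0r; left.
  have := Lw l lL; rewrite val_geE// => wl; right; rewrite (valM vV)// vgq vw//; nia.
move=> f /LE[x [y [Lx Ly y0 wy fE]]]; exists x, y => /=; split=> //.
  by apply: (alg_gen_min _ _ Lx) => //; apply: alg_gen_subalg.
by apply: (alg_gen_min _ _ Ly) => //; apply: alg_gen_subalg.
Qed.

Theorem cylinder_valuation_contact_divisorial :
  (exists (a : set K -> set K) (p : nat) (W : set (arcs X)),
    [/\ ideal_sheaf a, (0 < p)%N, irreducible_component (contact p a) W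
      & arc_val C = arc_val W]) /\
  divisorial_up_to_constant (arc_val C).
Proof.
have [v [w [c [q [A [g0 [g [[vV wV c0 q0 vw] [Cg0 Aopen AO Ag [gn0 vg]] vE [u u0 wu]
  DB]]]]]]]] := cylinder_blowup.
have [affA _] := Aopen; have sA := affine_alg_subalg affA.
have aK f : fractions A f by have [a _] := affine_generators affA; apply.
have AD : A `<=` val_ge v 0 by apply: subset_trans AO (center_val_ge0 vE Cg0).
have vwge f : val_ge v 0 f <-> val_ge w 0 f.
  have [->|f0] := eqVneq f 0; first by split=> _; left.
  by rewrite !val_geE// vw//; nia.
pose a := valuation_ideal v q; pose I := a A.
pose B := gen (A `|` [set h / g | h in I]).
have sB : subalgebra sc B by exact: alg_gen_subalg.
have valC : arc_val C = extended_val v.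
  by apply: arc_valE => //; apply: generically_is_val_of.
have BD : B `<=` val_ge w 0.
  apply: alg_gen_min; first exact: (val_ring_subalg wV).
  move=> f [Af|[h [Ah hq] <-]]; apply/vwge; first exact: AD.
  rewrite -(subrr q%:Z); apply: (val_geM vV); first exact: hq.
  by right; rewrite (valV vV)// vg.
have Ia : ideal A I by apply: valuation_ideal_ideal.
have asheaf : ideal_sheaf a by apply: valuation_ideal_sheaf.
split; last first.
  exists a, (val_ge w 0), (extended_val w), c; split=> //.
  - exists B, [set f | B f /\ val_ge w 1 f]; split.
    + exact: blowup_chart_finite.
    + move=> O BO; exists A, I, g; split=> //; first exact: valuation_ideal_sheaf_on.
      by split=> // _; right; rewrite vg.
    + exact: (val_ge_maximal_prime wV sB BD).
    + apply/seteqP; split=> [f /DB[x [y [Bx By y0 wy ->]]]|f [x [y [Bx By By1 ->]]]].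
        by exists x, y; split=> // -[_]; rewrite val_geE// wy.
      have y0 : y != 0 by apply: contra_notN By1 => /eqP yE; split=> //; rewrite yE; left.
      rewrite -[0]addr0; apply: (val_geM wV); first exact: BD.
      right; rewrite (valV wV)//; have := BD _ By; rewrite val_geE// => wy.
      have : ~ 1 <= w y by move=> ?; apply: By1; split=> //; right.
      lia.
    + exact: (valuation_ring_krull_dim wV u0 wu).
  - split; [exact: extended_valuation|by exists u; rewrite extended_valE// wu|].
    by apply/seteqP; split=> f /extended_val_ge.
  - move=> f; rewrite valC; have [->|f0] := eqVneq f 0.
      by rewrite !extended_val0 gt0_muley// lte_fin ltz_nat.
    by rewrite !extended_valE// vw.
have Aarc h : A `<=` center h -> forall f, I f -> a (center h) f.
  by move=> Ah f [Af fq]; split=> [|_]; [exact: Ah|exact: fq].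
have AC : generically C (fun h => A `<=` center h).
  have [t tE _] := affine_generators affA; rewrite tE.
  by apply: (generically_subalg irrC Cg0); rewrite -tE.
have [U [oU CU UP]] := generically_and irrC AC (vE g g0 Cg0 (AO _ Ag) gn0).
have Ig : I g by split=> // _; right; rewrite vg.
(* Along C the order of an element of the ideal is at least its value, hence at least q, and g has
   order exactly q at general arcs. *)
have CUc : C `&` U `<=` contact q a.
  move=> h [Ch Uh]; have [Ah [hg hgE]] := UP h Ch Uh.
  apply: ideal_gen_tX => [_ [f [hf fq] <-]|]; last first.
    exists (pull h g); first by exists g => //; apply: Aarc.
    by move: hgE; rewrite vg; case: ord_tP => // l _ hl [] <-.
  have [->|f0] := eqVneq f 0; first by rewrite pull0.
  have := generic_order_le irrC (vE f h Ch hf f0) Ch hf.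
  have := fq (center_val_ge0 vE Ch); rewrite val_geE// -lee_fin => fq' fo.
  exact/ord_t_ge/(le_trans fq').
have irrCU : irreducible_set (C `&` U).
  split=> // V V' oV oV' [x [[Cx Ux] Vx]] [y [[Cy Uy] V'y]].
  have [||z [Cz [[Uz Vz] [_ V'z]]]] :=
      irrC.2 (U `&` V) (U `&` V') (openI oU oV) (openI oU oV').
  - by exists x.
  - by exists y.
  - by exists z.
have [W Wcomp CUW] := irreducible_component_exists irrCU CUc.
exists a, q, W; split=> //; have [irrW Wc _] := Wcomp.
rewrite valC; apply/esym/arc_valE => //.
(* Open conditions, that is upper bounds on orders, pass from C to W because W is irreducible and
   contains [C]&[U]. Lower bounds along W come from the contact condition. *)
have toW Q : open Q -> forall h, C h -> Q h -> generically W Q.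
  move=> oQ h Ch Qh; exists Q; split=> //.
  have [|z [Cz [Qz Uz]]] := irrC.2 Q U oQ oU _ CU; first by exists h.
  by exists z; split=> //; apply: CUW.
have coefW f (n : nat) : A f -> f != 0 -> v f = n%:Z ->
    generically W (fun h => center h f /\ pull h f n != 0).
  move=> Af f0 vf; have := vE f g0 Cg0 (AO _ Af) f0; rewrite vf.
  move=> /generically_ex[h Ch [hf /ord_t_fin[_ hn]]].
  exact: (toW _ (open_pull_coef f n) h Ch (conj hf hn)).
have AW : generically W (fun h => A `<=` center h).
  have [t tE _] := affine_generators affA.
  have : generically W (fun h => forall f, f \in t -> center h f).
    apply: (generically_all irrW) => f ft; apply: (toW _ (open_center f) g0) => //.
    by apply: AO; rewrite tE; apply: alg_gen_in.
  by apply: generically_imp => h _ th; rewrite tE; apply: alg_gen_min.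
have Bnum e : B e -> exists e' n, [/\ A e', e = e' / g ^+ n &
    forall h, contact q a h -> A `<=` center h -> ord_ge (n * q) (pull h e')].
  move: e; apply: alg_gen_min.
    split=> [x|_ _ [x [n [Ax -> xo]]] [y [l [Ay -> yo]]]|
      _ _ [x [n [Ax -> xo]]] [y [l [Ay -> yo]]]].
    - exists (sc x), 0%N; split; [by case: sA|by rewrite expr0 divr1|].
      by move=> h _ _; rewrite mul0n.
    - exists (x * g ^+ l + y * g ^+ n), (n + l)%N; split.
      + by apply: (subalgD sA); apply: (subalgM sA) => //; apply: (subalgX _ sA).
      + by rewrite exprD; field; rewrite !expf_neq0.
      + move=> h hc Ah; have sh := center_subalg h.
        have hX j : center h (g ^+ j) by apply: (subalgX _ sh); apply: Ah.
        have hg1 : ord_ge q (pull h g).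
          by apply: (ideal_gen_tX_ord hc); exists g => //; apply: Aarc.
        have [hx hy] := (Ah _ Ax, Ah _ Ay).
        rewrite pullD ?pullM ?pullX//; try by [apply: (subalgM sh)|apply: Ah].
        rewrite mulnDl; apply: ord_geD; first by apply: ord_geM; [exact: xo|exact: ord_geX].
        by rewrite addnC; apply: ord_geM; [exact: yo|exact: ord_geX].
    - exists (x * y), (n + l)%N; split; first exact: (subalgM sA).
        by rewrite exprD; field; rewrite !expf_neq0.
      move=> h hc Ah; rewrite pullM ?mulnDl; [|exact: Ah|exact: Ah].
      by apply: ord_geM; [exact: xo|exact: yo].
  move=> f [Af|[x Ix <-]].
    by exists f, 0%N; split=> //; rewrite expr0 divr1.
  exists x, 1%N; split; rewrite ?expr1//; first by case: Ix.
  move=> h hc Ah; rewrite mul1n; apply: (ideal_gen_tX_ord hc).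
  by exists x => //; apply: Aarc.
have unitW e : B e -> e != 0 -> v e = 0 -> exists e' n, [/\ A e', e = e' / g ^+ n &
    generically W (fun h => ord_ge (n * q) (pull h e') /\ pull h e' (n * q)%N != 0)].
  move=> Be e0 ve; have [e' [n [Ae' eE eo]]] := Bnum e Be; exists e', n; split=> //.
  have e'0 : e' != 0 by apply: contraNneq e0 => e'0; rewrite eE e'0 mul0r.
  have ve' : v e' = (n * q)%N%:Z.
    move: ve; rewrite eE (val_div vV) ?expf_neq0// (valXn vV)// vg; lia.
  have := generically_and irrW AW (coefW e' _ Ae' e'0 ve'); apply: generically_imp.
  by move=> h Wh [Ah [_ hn]]; split=> //; apply: eo => //; apply: Wc.
have gW : generically W (fun h => ord_ge q (pull h g) /\ pull h g q != 0).
  have := generically_and irrW AW (coefW g _ Ag gn0 vg); apply: generically_imp.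
  move=> h Wh [Ah [_ hn]]; split=> //; apply: (ideal_gen_tX_ord (Wc _ Wh)).
  by exists g => //; apply: Aarc.
(* With n = v(f), the function f^q/g^n is a unit of the valuation ring, hence a quotient of two
   elements of B of value 0. Clearing denominators gives the identity [E] in A, in which every
   factor but f has a known order along W; comparing orders yields q ord(f) = q n. *)
have ordW f : A f -> f != 0 -> generic_order W f (v f)%:E.
  move=> Af f0; have [n vf] : exists n : nat, v f = n%:Z.
    by have := AD _ Af; rewrite val_geE//; case: (v f) => // n _; exists n.
  pose y := f ^+ q / g ^+ n.
  have y0 : y != 0 by rewrite mulf_neq0 ?invr_eq0 ?expf_neq0.
  have vy : v y = 0.
    by rewrite (val_div vV) ?expf_neq0// !(valXn vV)// vf vg mulrC subrr.
  have [|b [s [Bb Bs s0 ws yE]]] := DB y; first by apply/vwge; right; rewrite vy.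
  have vs : v s = 0 by rewrite vw// ws mulr0.
  have b0 : b != 0 by apply: contraNneq y0 => b0; rewrite yE b0 mul0r.
  have vb : v b = 0 by move: vy; rewrite yE (val_div vV)// vs subr0.
  have [b' [nb [Ab' bE bW]]] := unitW b Bb b0 vb.
  have [s' [ns [As' sE sW]]] := unitW s Bs s0 vs.
  have s'0 : s' != 0 by apply: contraNneq s0 => s'0; rewrite sE s'0 mul0r.
  have E : f ^+ q * s' * g ^+ nb = g ^+ n * b' * g ^+ ns.
    have : f ^+ q / g ^+ n = (b' / g ^+ nb) / (s' / g ^+ ns) by rewrite -bE -sE.
    move=> E; rewrite -(divfK (expf_neq0 n gn0) (f ^+ q)) E.
    by field; rewrite s'0 !expf_neq0.
  have := generically_and irrW AW (generically_and irrW gW (generically_and irrW bW sW)).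
  apply: generically_imp => h _ [Ah [hg [hb hs]]]; split; first exact: Ah.
  have sh := center_subalg h.
  have hX x j : A x -> center h (x ^+ j) by move=> Ax; apply: (subalgX _ sh); apply: Ah.
  have := congr1 (pull h) E.
  rewrite !pullM ?pullX//; try by [apply: Ah|apply: hX|apply: (subalgM sh); [apply: hX|apply: Ah]].
  have hR := exact_ordM (exact_ordM (exact_ordX n hg) hb) (exact_ordX ns hg).
  case: ord_tP => [->|i io i0] hE.
    move: hR; rewrite -hE expr0n eqn0Ngt q0 !mul0r => -[_].
    by rewrite pseries_coef0 eqxx.
  have hL := exact_ordM (exact_ordM (exact_ordX q (conj io i0)) hs) (exact_ordX nb hg).
  rewrite hE in hL; have := exact_ord_inj hL hR; rewrite vf => ij.
  by have -> : i = n by nia.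
apply: generically_is_val_of => // f h Wh hf f0.
have [x [y [Ax Ay y0 fE]]] := aK f.
have x0 : x != 0 by apply: contraNneq f0 => x0; rewrite fE x0 mul0r.
have := generically_and irrW (generically_center Wh hf)
  (generically_and irrW (ordW x Ax x0) (ordW y Ay y0)).
apply: generically_imp => h' _ [h'f [[h'x xE] [h'y yE]]]; split=> //.
have : ord_t (pull h' f) + ord_t (pull h' y) = ord_t (pull h' x) :> \bar int.
  by rewrite -ord_tM -pullM// fE divfK.
rewrite xE yE fE (val_div vV)//; case: ord_tP => [_|i _ _]; first by rewrite /=.
by rewrite -EFinD => -[] ij; congr EFin; lia.
Qed.

End Main.

Theorem theoremC (R : realType) (X : variety R[i]) (C : set (arcs X)) :
  smooth X -> cylinder C -> irreducible_set C -> ~ dominating C ->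
  (exists (a : set (funfield X) -> set (funfield X)) (p : nat)
      (W : set (arcs X)),
    [/\ ideal_sheaf a, (0 < p)%N, irreducible_component (contact p a) W
      & arc_val C = arc_val W]) /\
  divisorial_up_to_constant (arc_val C).
Proof.
move=> smoothX [m [S _ CE]] irrC ndomC.
have char0 : [pchar (funfield X)] =i pred0.
  by move=> p; rewrite (fmorph_pchar (scal X)) pchar_num.
apply: (cylinder_valuation_contact_divisorial char0 smoothX (m := m)) => //.
by move=> g h; rewrite CE /= => Sg ->.
Qed.
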